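(* A finite non-abelian simple group $G$ belongs to $\mathfrak{Y}_n$ if and only if $G$ is isomorphic to the alternating group $\mathrm{Alt}(5)$ or to $\mathrm{PSL}(2,2^n)$ for some integer $n$ such that $2^n-1$ is a prime.
   Context: $\mathfrak{Y}_n$ denotes the class of all groups $G$ such that $N_G(A)=A$ for every non-abelian subgroup $A\le G$. *)

(* Defs.v *)
From HB Require Import structures.
From mathcomp Require Import all_boot all_order all_algebra all_fingroup all_solvable all_field.
Set Implicit Arguments. Unset Strict Implicit. Unset Printing Implicit Defensive.

Local Open Scope group_scope.

Definition in_Yn (gT : finGroupType) (G : {set gT}) : Prop :=
  forall A : {group gT}, A \subset G -> ~~ abelian A -> 'N_G(A) = A.

Definition SL2 (F : finFieldType) : {set {'GL_2[F]}} :=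
  [set g : {'GL_2[F]} | (\det (GLval g) == 1)%R].

Definition PSL2 (F : finFieldType) := (SL2 F / 'Z(SL2 F))%g.

(* Main.v *)
(* Every proper normal subgroup of a group in the class is abelian, and a non-abelian Sylow subgroup
   is the whole group. So if G is simple and in the class, its Sylow subgroups are abelian, and transfer
   shows that the centralizer C of any non-trivial element is abelian and that N(C)/C has prime order.
   The conjugates of these C partition the non-trivial elements of G, and N(C) is a Frobenius group with
   kernel C, which determines the number of elements in each conjugacy class of such subgroups.

   If |G| is odd, each C yields exceptional characters of G, which are constant and integral on the
   conjugates of the other centralizers C'. A parity argument in the orthogonality relations shows that
   for C and C' not conjugate the exceptional characters of C do not vanish at C', or conversely, and
   then the norms of the rows and of the columns of the character table contradict the class equation.

   If |G| is even, let C be the centralizer of an involution, B = N(C) and p = |B : C|. Counting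
   involutions in the cosets of B and pairs of non-commuting involutions gives |C| = p + 1 and
   |G : B| = p + 2. A complement of C in B acts regularly on the non-trivial elements of C, which makes C
   the additive group of a field F with p + 1 elements, necessarily a power of 2, and G acts on the
   cosets of B as the group of permutations of the projective line over F generated by x + a, z x and
   1/x, where z generates the multiplicative group of F. The same is true of SL(2,F), so G is isomorphic
   to SL(2,F) = PSL(2,F).

   Conversely, let C be the centralizer of a non-trivial element of SL(2,F), where |F| = 2^n. It is
   abelian, and an element t of N(C) outside C generates N(C) modulo C; it inverts C, of odd order, if C
   is semisimple, and permutes the non-trivial elements of C transitively if C is unipotent, since
   2^n - 1 is prime. A non-abelian subgroup A contains such a t normalizing a Sylow subgroup of A lying
   in C, and the Frattini argument gives N(A) = A. *)
Require Import Defs.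
From HB Require Import structures.
From mathcomp Require Import all_boot all_order all_algebra all_fingroup all_solvable all_field all_character.
From mathcomp Require Import ring zify.
Set Implicit Arguments. Unset Strict Implicit. Unset Printing Implicit Defensive.
Local Open Scope group_scope.

(** * Transfer into an abelian Sylow subgroup *)

Section Transfer.

Import FiniteModule.

(** The transfer of [G] into [P / N] sends [z] to a product of conjugates of powers of [z], one for
    each cycle of [z] on the cosets of [P]. The fusion hypothesis turns this product into
    [z ^+ #|G : P|] modulo [N]; it is trivial as [z] lies in the derived subgroup, and [#|G : P|] is
    prime to [p]. *)
Lemma transfer_fusion gT p (G P N : {group gT}) z :
    p.-Sylow(G) P -> N <| P -> abelian (P / N) -> z \in P -> z \in G^`(1) ->
    (forall n g, g \in G -> (z ^+ n) ^ g \in P ->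
       coset N ((z ^+ n) ^ g) = coset N (z ^+ n)) ->
  z \in N.
Proof.
move=> sylP /andP[sNP nNP] abPN Pz G'z fusz.
have sPG := pHall_sub sylP; have Gz := subsetP sPG z Pz.
pose alpha := [morphism of restrm nNP (coset N)].
have abA : abelian (alpha @* P) by rewrite morphim_restrm setIid.
pose V := transfer_morphism G abA.
have trX := transversalP (rcosets_cycle_partition sPG Gz).
have imP x : x \in P -> coset N x \in alpha @* P.
  by move=> Px; rewrite morphim_restrm setIid mem_morphim ?(subsetP nNP).
have Vz : V z = (fmod abA (coset N z) *+ #|G : P|)%R.
  rewrite /= (transfer_cycle_expansion sPG abA Gz trX).
  rewrite -(sum_index_rcosets_cycle sPG Gz trX) -GRing.sumrMnr.
  apply: eq_bigr => x Xx; set n := #|_ : _|.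
  have Gx : x \in G by apply: (subsetP (transversal_sub trX)).
  have Pzx : (z ^+ n) ^ x^-1 \in P.
    rewrite /n; have:= mulg_exp_card_rcosets P z x.
    by rewrite mem_rcoset conjgE invgK mulgA.
  transitivity (fmod abA (coset N ((z ^+ n) ^ x^-1))); first by [].
  rewrite fusz ?groupV // morphX ?(subsetP nNP) //.
  exact: (fmodX abA _ (imP z Pz)).
have V0 : V z = 1.
  have: V z \in V @* G^`(1) by rewrite mem_morphim ?(subsetP (der_sub 1 G)).
  rewrite morphim_der // derg1.
  have /commG1P -> : V @* G \subset 'C(V @* G) by apply: FinRing.zmod_abelian.
  by move/set1P.
have cz : coset N z ^+ #|G : P| = 1.
  rewrite -(fmodK abA (imP z Pz)) -fmvalZ -Vz V0.
  by rewrite FinRing.zmod1gE.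
rewrite coset_idr // ?(subsetP nNP) //.
apply/eqP; rewrite -order_eq1 -dvdn1 -(eqnP (_ : coprime #[coset N z] #|G : P|)).
  by rewrite dvdn_gcd dvdnn order_dvdn cz eqxx.
apply: (pnat_coprime (pi := p)); last by case/and3P: sylP.
rewrite -[p.-nat _]/(p.-elt _) morph_p_elt ?(subsetP nNP) //.
exact: mem_p_elt (pHall_pgroup sylP) Pz.
Qed.

(** An element of [P] centralized by the normalizer of [P] is fused to no other element of [P], so
    transfer with [N = 1] applies. *)
Lemma abelian_Sylow_cent_norm gT p (G P : {group gT}) :
  p.-Sylow(G) P -> abelian P -> P :&: 'Z('N_G(P)) :&: G^`(1) = 1.
Proof.
move=> sylP abP; apply/trivgP/subsetP=> z /setIP[/setIP[Pz /setIP[Nz cNz]] G'z].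
apply: (transfer_fusion sylP (normal1 P) _ Pz G'z) => [|n g Gg Pzg].
  exact: quotient_abelian.
have sPG := pHall_sub sylP.
(* By Sylow in the centralizer of [y ^ g], fusion of [y] into [P] is controlled by ['N_G(P)]. *)
congr coset; set y := z ^+ n.
have Py : y \in P by rewrite groupX.
have cNy : y \in 'C('N_G(P)) by rewrite groupX.
have sylPg : p.-Sylow('C_G[y ^ g]) P.
  apply: pHall_subl sylP; last by rewrite subsetIl.
  by rewrite subsetI sPG sub_cent1 (subsetP abP).
have sylPg' : p.-Sylow('C_G[y ^ g]) (P :^ g).
  apply: (pHall_subl _ (subsetIl _ _)); last by rewrite pHallJ.
  rewrite subsetI -{1}(conjGid Gg) conjSg sPG sub_cent1 centJ memJ_conjg.
  by rewrite (subsetP abP).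
have [c /setIP[Gc cc] defP] := Sylow_trans sylPg' sylPg.
have Ngc : g * c \in 'N_G(P).
  by rewrite inE groupM //= inE conjsgM -defP.
have: y ^ (g * c) = y by rewrite conjgE (centP cNy _ Ngc) mulKg.
rewrite conjgM; have /cent1P ccy := cc.
by rewrite [_ ^ c]conjgE -ccy mulKg => ->.
Qed.

End Transfer.

(** * Local structure of the simple groups in the class *)

Lemma in_YnS gT (G H : {group gT}) : H \subset G -> in_Yn G -> in_Yn H.
Proof.
move=> sHG ynG A sAH nabA; have := ynG A (subset_trans sAH sHG) nabA.
move=> defA; apply/eqP; rewrite eqEsubset subsetI sAH normG andbT.
by rewrite -{2}defA setSI.
Qed.

Lemma in_Yn_quotient gT (G N : {group gT}) : N <| G -> in_Yn G -> in_Yn (G / N).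
Proof.
move=> nsNG ynG B sBG nabB.
have [A defB sNA sAG] := inv_quotientS nsNG sBG.
have nsNA : N <| A by apply: normalS nsNG.
rewrite defB -quotient_subnormG // ynG //.
by apply: contra nabB => abA; rewrite defB quotient_abelian.
Qed.

Lemma in_Yn_normal_abelian gT (G A : {group gT}) :
  in_Yn G -> A <| G -> A :!=: G -> abelian A.
Proof.
move=> ynG /andP[sAG nAG]; apply: contraR => nabA.
by rewrite -(ynG A sAG nabA); apply/eqP/setIidPl.
Qed.

(** In a smallest counterexample [P] is self-normalizing and its proper subgroups are abelian. If
    [G] is perfect, fusion in [P] is controlled by [P], and transfer modulo the derived subgroup of
    [P] gives a contradiction. Otherwise [G] has an abelian maximal normal subgroup whose part of
    order prime to [p] is centralized by [P], and [P] is normal. *)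
Lemma in_Yn_nonabelian_Sylow gT p (G P : {group gT}) :
  in_Yn G -> p.-Sylow(G) P -> ~~ abelian P -> P :=: G.
Proof.
have [n] := ubnP #|G|; elim: n => // n IHn in gT G P * => /ltnSE-leGn.
move=> ynG sylP nabP; apply/eqP; apply/contraT => neqPG.
have sPG := pHall_sub sylP; have pP := pHall_pgroup sylP.
have nilP := pgroup_nil pP.
have NP : 'N_G(P) = P by apply: ynG.
have nonnormP : ~ P <| G by case/andP=> _ /setIidPl defG; rewrite -defG NP eqxx in neqPG.
have abS (A : {group gT}) : A \proper P -> abelian A.
  move=> prAP; apply: contraT => nabA.
  have := nilpotent_proper_norm nilP prAP.
  by rewrite (in_YnS sPG ynG (proper_sub prAP) nabA) properxx.
have maxP y : y \in P -> exists2 M : {group gT}, maximal M P & y \in M.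
  move=> Py; have [|defP|[M maxM sYM]] := @maximal_exists _ <[y]>%G P.
  - by rewrite cycle_subG.
  - by case/negP: nabP; rewrite -defP cycle_abelian.
  by exists M => //; rewrite -cycle_subG.
have sPhiZ : 'Phi(P) \subset 'Z(P).
  rewrite subsetI Phi_sub; apply/centsP=> x Phix y /maxP[M maxM My].
  have /centsP abM := abS M (maxgroupp maxM).
  by apply: abM => //; apply: subsetP (Phi_sub_max maxM) x Phix.
have [perfG | nperfG] := eqVneq G^`(1) G.
  (* A non-trivial subgroup of [P] normal in [G] is factored out: the quotient is excluded by
     transfer if [P / A] is abelian, and by induction otherwise. *)
  have [A nsA | normP] := pickP [pred A : {group gT} | [&& A \subset P, A :!=: 1 & A <| G]].
    case/and3P: nsA => sAP ntA nsAG.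
    have nsAP : A <| P := normalS sAP sPG nsAG.
    have nAP := normal_norm nsAP.
    have sylPA : p.-Sylow(G / A) (P / A) by apply: quotient_pHall.
    have ynGA : in_Yn (G / A) := in_Yn_quotient nsAG ynG.
    have [abPA | nabPA] := boolP (abelian (P / A)).
      have := abelian_Sylow_cent_norm sylPA abPA.
      rewrite -quotient_subnormG // NP -quotient_der ?normal_norm // perfG.
      rewrite (center_idP abPA) setIid (setIidPl (quotientS A sPG)) => PA1.
      case: nonnormP; rewrite (_ : P = A) //; apply/eqP; rewrite -val_eqE eqEsubset sAP.
      by rewrite -quotient_sub1 // PA1 sub1G.
    have ltGA : #|G / A| < n by rewrite (leq_trans _ leGn) // ltn_quotient ?normal_sub.
    have eqPG := IHn _ _ _ ltGA ynGA sylPA nabPA.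
    move: neqPG; rewrite eqEsubset sPG -(quotientSGK (normal_norm nsAG) sAP).
    by rewrite eqPG subxx.
  have NA (A : {group gT}) : A \subset P -> A :!=: 1 -> P \subset 'N(A) -> 'N_G(A) = P.
    move=> sAP ntA nAP.
    have sPN : P \subset 'N_G(A) by rewrite subsetI sPG.
    have sylPN := pHall_subl sPN (subsetIl _ _) sylP.
    apply/esym/(IHn _ _ _ _ (in_YnS (subsetIl _ _) ynG) sylPN nabP).
    apply: leq_trans leGn; apply: proper_card; rewrite properEneq subsetIl andbT.
    apply: contraFN (normP A) => /eqP defN; rewrite /= sAP ntA /normal.
    by rewrite (subset_trans sAP sPG) -defN subsetIr.
  (* ['C_P[z]] contains the Frattini subgroup of [P], hence its derived subgroup, and is therefore
     normal in [P]. *)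
  have NC z : z \in P -> z != 1 -> 'N_G('C_P[z]) = P.
    move=> Pz ntz; apply: NA; first exact: subsetIl.
      by apply/trivgPn; exists z => //; rewrite inE Pz cent1id.
    have sZC : 'Z(P) \subset 'C_P[z] by rewrite setIS // -cent_set1 centS ?sub1set.
    apply: (normal_norm (sub_der1_normal _ (subsetIl _ _))).
    by apply: subset_trans sZC; apply: subset_trans sPhiZ; rewrite (Phi_joing pP) joing_subl.
  have sylC z : z \in P -> z != 1 -> p.-Sylow('C_G[z]) 'C_P[z].
    move=> Pz ntz.
    have pC : p.-group 'C_P[z] by apply: pgroupS pP; apply: subsetIl.
    have sCC : 'C_P[z] \subset 'C_G[z] by rewrite setSI.
    have [Q sylQ sCQ] := Sylow_superset sCC pC.
    rewrite (_ : 'C_P[z] = Q) //; apply/esym.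
    apply: (nilpotent_sub_norm (pgroup_nil (pHall_pgroup sylQ)) sCQ).
    have sQC := pHall_sub sylQ.
    apply/subsetP=> u /setIP[Qu Nu]; have [Gu cu] := setIP (subsetP sQC u Qu).
    by rewrite inE cu andbT -(NC z Pz ntz) inE Gu.
  have fusP z g : z \in P -> g \in G -> z ^ g \in P -> exists2 u, u \in P & z ^ g = z ^ u.
    move=> Pz Gg Pzg; have [-> | ntz] := eqVneq z 1; first by exists 1; rewrite ?conj1g.
    have ntzg : z ^ g != 1 by rewrite conjg_eq1.
    have sylCg : p.-Sylow('C_G[z ^ g]) ('C_P[z] :^ g).
      by rewrite cent1J -{1}(conjGid Gg) -conjIg pHallJ2 sylC.
    have [c /setIP[Gc cc] defC] := Sylow_trans sylCg (sylC _ Pzg ntzg).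
    exists (g * c).
      rewrite -NP inE groupM //= inE; apply/subsetP.
      move: (NC _ Pzg ntzg); rewrite /= defC -conjsgM normJ.
      rewrite -{1}(conjGid (groupM Gg Gc)) -conjIg NC // => ->; exact.
    rewrite conjgM [in RHS]conjgE; have /cent1P ccy := cc.
    by rewrite -ccy mulKg.
  (* Conjugation by elements of [P] is trivial modulo the derived subgroup of [P], so
     [transfer_fusion] applies to every element of [P]. *)
  have sPP' : P \subset P^`(1).
    apply/subsetP=> z Pz; apply: (transfer_fusion sylP (der_normal 1 P) _ Pz).
    - exact: der_abelian.
    - by rewrite perfG (subsetP sPG).
    move=> k g Gg Pzg; have [|u Pu ->] := fusP _ g _ Gg Pzg; first exact: groupX.
    have Pzk : z ^+ k \in P by rewrite groupX.
    rewrite conjg_mulR coset_kerr // mem_commg //.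
  have /(sol_der1_proper (nilpotent_sol nilP) (subxx P)) : P :!=: 1.
    by apply: contra nabP => /eqP->; apply: abelian1.
  by rewrite properE sPP' andbF.
have [|defG|[K maxK sG'K]] := @maximal_exists _ (G^`(1))%G G; first exact: der_sub.
  by case/eqP: nperfG.
have prKG := maxgroupp maxK.
have nsKG := sub_der1_normal sG'K (proper_sub prKG).
have abK : abelian K.
  by apply: (in_Yn_normal_abelian ynG nsKG); move: prKG; rewrite properEneq => /andP[].
pose L := 'O_p^'(K).
have nsLG : L <| G by apply: char_normal_trans (pcore_char _ _) nsKG.
have [_ defK _ _] := dprodP (nilpotent_pcoreC p (abelian_nil abK)).
have sOP : 'O_p(K) \subset P.
  apply: subset_trans (pcore_sub_Hall sylP).
  by apply: pcore_max (pcore_pgroup _ _) (char_normal_trans (pcore_char _ _) nsKG).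
have nPK : ~~ (P \subset K) by apply: contra nabP => /abelianS->.
have PKG : P * K = G.
  have := mulg_normal_maximal nsKG maxK sPG nPK.
  by rewrite (normC (subset_trans sPG (normal_norm nsKG))).
have PLG : P * L = G by rewrite -PKG -defK mulgA (mulGSid sOP).
(* For [M] maximal in [P], the subgroup [M <*> L] is proper and normal in [G = P * L], hence
   abelian; such [M] cover [P]. *)
have cPL : P \subset 'C(L).
  apply/subsetP=> y /maxP[M maxM My].
  have sMP := proper_sub (maxgroupp maxM).
  have nML : M \subset 'N(L).
    by apply: subset_trans (normal_norm nsLG); apply: subset_trans sPG.
  have nsML : M <*> L <| G.
    rewrite /normal join_subG (subset_trans sMP) // (normal_sub nsLG) /=.
    suff: P * L \subset 'N(M <*> L) by rewrite PLG.
    rewrite mul_subG //.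
      apply: normsY; first exact: normal_norm (p_maximal_normal pP maxM).
      exact: subset_trans sPG (normal_norm nsLG).
    by apply: subset_trans (normG _); apply: joing_subr.
  have/(in_Yn_normal_abelian ynG nsML) abML : M <*> L :!=: G.
    apply: contraL (maxgroupp maxM) => /eqP defG.
    have pi1 : (#|L|`_p)%N = 1%N by apply/part_p'nat/pcore_pgroup.
    rewrite properEcard sMP -leqNgt.
    rewrite (card_Hall sylP) -defG norm_joinEl // TI_cardMg.
      by rewrite partnM ?cardG_gt0 // pi1 muln1 (part_pnat_id (pgroupS sMP pP)).
    apply: coprime_TIg; apply: pnat_coprime (pgroupS sMP pP) _; exact: pcore_pgroup.
  apply: (subsetP (subset_trans (joing_subl M L) _)) My.
  by apply: subset_trans abML (centS (joing_subr M L)).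
case: nonnormP; rewrite /normal sPG -PLG mul_subG ?normG //.
by apply: subset_trans (cent_sub _); rewrite centsC.
Qed.

Lemma in_Yn_maximal_normal gT (G : {group gT}) :
    in_Yn G -> G^`(1) != G ->
  exists K : {group gT}, [/\ maximal K G, K <| G, abelian K & prime #|G : K|].
Proof.
move=> ynG nperfG.
have [|/eqP defG|[K maxK sG'K]] := @maximal_exists _ (G^`(1))%G G.
- exact: der_sub.
- by rewrite (negPf nperfG) in defG.
have prKG := maxgroupp maxK.
have nsKG := sub_der1_normal sG'K (proper_sub prKG).
have abK : abelian K.
  apply: (in_Yn_normal_abelian ynG nsKG).
  by move: prKG; rewrite properEneq => /andP[].
exists K; split=> //; apply: index_maxnormal_sol_prime.
  rewrite (series_sol nsKG) abelian_sol //= abelian_sol //.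
  by rewrite sub_der1_abelian.
apply/maxgroupP; rewrite prKG normal_norm //; split=> // H /andP[prHG _] sKH.
by case/maxgroupP: maxK => _; apply.
Qed.

Lemma perfect_abelian_Sylow_cent_norm gT p (G P : {group gT}) (A : {set gT}) :
    p.-Sylow(G) P -> abelian P -> G^`(1) = G -> A \subset P ->
  'N_G(P) \subset 'C(A) -> A \subset [1].
Proof.
move=> sylP abP perfG sAP cAN; rewrite -(abelian_Sylow_cent_norm sylP abP) perfG.
have sPG := pHall_sub sylP.
rewrite subsetI (subset_trans sAP sPG) subsetI sAP subsetI centsC cAN !andbT.
by rewrite subsetI (subset_trans sAP sPG) (subset_trans sAP (normG P)).
Qed.

(** Each Sylow subgroup [T] centralizes [R]. If [T <*> R] is not self-normalizing, it is a proper
    normal subgroup of its normalizer, hence abelian. If it is, it contains the normalizer of [T];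
    transfer gives first [T :&: R = 1], so that this normalizer centralizes [T], and then [T = 1].
    So [R] is central in [G], and transfer excludes every prime divisor of its order. *)
Lemma in_Yn_perfect_abelian_normal gT (G R : {group gT}) :
    in_Yn G -> G^`(1) = G ->
    (forall p (P : {group gT}), p.-Sylow(G) P -> abelian P) ->
  R <| G -> abelian R -> R :=: 1.
Proof.
move=> ynG perfG abSyl nsRG abR; have [sRG nRG] := andP nsRG.
have cTRTR p (T : {group gT}) :
    p.-Sylow(G) T -> T <*> R \subset 'C(T :&: R).
  move=> /abSyl abT; rewrite join_subG (subset_trans abT) ?centS ?subsetIl //.
  by rewrite (subset_trans abR) ?centS ?subsetIr.
have centT p (T : {group gT}) : p.-Sylow(G) T -> T \subset 'C(R).
  move=> sylT; have abT := abSyl p T sylT; have sTG := pHall_sub sylT.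
  have nRT := subset_trans sTG nRG.
  have tiZ A := perfect_abelian_Sylow_cent_norm (A := A) sylT abT perfG.
  have [/eqP defK | neqK] := boolP ((T <*> R) == 'N_G(T <*> R)); last first.
    have nsTR : T <*> R <| 'N_G(T <*> R).
      by rewrite /normal subsetIr andbT subsetI normG join_subG sTG sRG.
    have abTR : abelian (T <*> R).
      by apply: in_Yn_normal_abelian nsTR neqK; apply: in_YnS (subsetIl _ _) ynG.
    apply: subset_trans (joing_subl T R) _; apply: subset_trans abTR _.
    by rewrite centS ?joing_subr.
  have sNK : 'N_G(T) \subset T <*> R.
    by rewrite defK subsetI subsetIl normsY ?subsetIr // subIset // nRG.
  have ti : T :&: R \subset [1].
    by apply: tiZ; rewrite ?subsetIl ?(subset_trans sNK) ?(cTRTR p).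
  suff cNT : 'N_G(T) \subset 'C(T).
    by apply: (subset_trans (tiZ T (subxx T) cNT)); apply: sub1G.
  apply/subsetP=> u Nu; have /setIP[Gu nTu] := Nu.
  have := subsetP sNK u Nu.
  rewrite norm_joinEl // => /mulsgP[t r Tt Rr defu].
  have nTr : r \in 'N(T).
    by rewrite -(groupMl _ (subsetP (normG T) t Tt)) -defu.
  rewrite defu groupM //; first exact: subsetP abT t Tt.
  apply/centP=> y Ty; apply/commgP.
  rewrite -in_set1 -set1gE (subsetP ti) // inE.
  rewrite {1}commgEr groupMr // memJ_norm // groupV Ty commgEl groupMl ?groupV //.
  by rewrite memJ_norm // (subsetP nRT).
have cGR : G \subset 'C(R).
  rewrite -Sylow_gen gen_subG; apply/bigcupsP=> T /SylowP[p _ sylT].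
  exact: centT sylT.
apply/eqP; apply: contraT; rewrite -cardG_gt1 => /pdivP[p pr_p p_dv_R].
have [x Rx ox] := Cauchy pr_p p_dv_R.
have [T sylT] := Sylow_exists p G.
have sxT : T :&: R \subset [1].
  apply: perfect_abelian_Sylow_cent_norm sylT (abSyl p T sylT) perfG _ _.
    exact: subsetIl.
  rewrite (subset_trans (subsetIl _ _)) // (subset_trans cGR) // centS //.
  exact: subsetIr.
have sxG : <[x]>%G \subset G by rewrite cycle_subG (subsetP sRG).
have px : p.-group <[x]>%G by rewrite /pgroup -orderE ox pnat_id.
have [g Gg sxTg] := Sylow_Jsub sylT sxG px.
have: x ^ g \in [1 gT].
  apply: (subsetP sxT); rewrite inE (subsetP sxTg) ?memJ_conjg ?cycle_id //=.
  by rewrite memJ_norm // (subsetP nRG).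
rewrite inE conjg_eq1 => /eqP x1; move: pr_p.
by rewrite -ox x1 order1.
Qed.

Section SimpleYn.

Variables (gT : finGroupType) (G : {group gT}).
Hypotheses (simG : simple G) (nabG : ~~ abelian G) (ynG : in_Yn G).

Lemma nonabelian_simple_perfect : G^`(1) = G.
Proof.
have /simpleP[_ /(_ _ (der_normal 1 G))[G'1 | //]] := simG.
by case/negP: nabG; apply/commG1P; rewrite -derg1 G'1.
Qed.

Lemma simple_in_Yn_abelian_pgroup (p : nat) (P : {group gT}) :
  P \subset G -> p.-group P -> abelian P.
Proof.
move=> sPG pP; have [S sylS sPS] := Sylow_superset sPG pP.
apply: abelianS sPS _; apply: contraT => nabS.
have pG : p.-group G.
  by rewrite -(in_Yn_nonabelian_Sylow ynG sylS nabS) (pHall_pgroup sylS).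
have := sol_der1_proper (pgroup_sol pG) (subxx G).
rewrite nonabelian_simple_perfect properxx => /(_ _)/negP[] //.
by apply: contra nabG => /eqP->; apply: abelian1.
Qed.

(** [H] is not perfect, because a perfect group in the class with abelian Sylow subgroups has no
    non-trivial abelian normal subgroup. *)
Lemma simple_in_Yn_local (H A : {group gT}) :
    H \subset G -> A <| H -> abelian A -> A :!=: 1 ->
  exists K : {group gT}, [/\ maximal K H, K <| H, abelian K & prime #|H : K|].
Proof.
move=> sHG nsAH abA ntA; have ynH := in_YnS sHG ynG.
apply: in_Yn_maximal_normal => //; apply: contra ntA => /eqP perfH; apply/eqP.
apply: in_Yn_perfect_abelian_normal nsAH abA => // p P sylP.
apply: simple_in_Yn_abelian_pgroup (pHall_pgroup sylP).
exact: subset_trans (pHall_sub sylP) sHG.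
Qed.

Let tiZN p (R : {group gT}) (A : {set gT}) :
  p.-Sylow(G) R -> A \subset R -> 'N_G(R) \subset 'C(A) -> A \subset [1].
Proof.
move=> sylR; apply: (perfect_abelian_Sylow_cent_norm sylR).
  exact: simple_in_Yn_abelian_pgroup (pHall_sub sylR) (pHall_pgroup sylR).
exact: nonabelian_simple_perfect.
Qed.

(** A non-abelian ['C_G[x]] would be self-normalizing and so contain the normalizer of [<[x]>]. Let
    [R] be a Sylow subgroup containing [x]. By transfer its normalizer is not inside ['C_G[x]]; each
    case below puts it there. *)
Lemma simple_in_Yn_cent_prime x :
  x \in G -> prime #[x] -> abelian 'C_G[x].
Proof.
move=> Gx pr_x; apply: contraT => nabC; set r := #[x] in pr_x.
have rx : r.-group <[x]> by rewrite /pgroup -orderE pnat_id.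
have sxG : <[x]> \subset G by rewrite cycle_subG.
have ntx : x != 1 by apply: contraTneq pr_x; rewrite /r => ->; rewrite order1.
have [R sylR sxR] := Sylow_superset sxG rx.
have Rx : x \in R by rewrite -cycle_subG.
have sRG := pHall_sub sylR; have rR := pHall_pgroup sylR.
have abR : abelian R := simple_in_Yn_abelian_pgroup sRG rR.
have sRC : R \subset 'C_G[x] by rewrite subsetI sRG sub_cent1 (subsetP abR).
have ntR : R :!=: 1 by apply/trivgPn; exists x.
have notNC : ~ 'N_G(R) \subset 'C_G[x].
  move=> sNC; have cNx : 'N_G(R) \subset 'C([set x]).
    by rewrite cent_set1 (subset_trans sNC) ?subsetIr.
  have sxR1 : [set x] \subset R by rewrite sub1set.
  by have := tiZN sylR sxR1 cNx; rewrite sub1set inE (negPf ntx).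
have sNxC : 'N_G(<[x]>) \subset 'C_G[x].
  have defNC : 'N_G('C_G[x]) = 'C_G[x] by apply: ynG => //; apply: subsetIl.
  suff: 'N_G(<[x]>) \subset 'N_G('C_G[x]) by rewrite defNC.
  rewrite subsetI subsetIl /=.
  rewrite -cent_cycle normsI //; first by rewrite subIset ?normG.
  by rewrite (subset_trans (subsetIr _ _)) ?cent_norm.
have [L [maxL nsLN abL _]] :=
  simple_in_Yn_local (subsetIl G 'N(R)) (normalSG sRG) abR ntR.
have sLN := normal_sub nsLN.
(* Otherwise the normalizer of [R] is [L * R]. It centralizes [R :&: L], which is trivial by
   transfer; then [L] commutes with [R], and transfer kills [R]. *)
have sRL : R \subset L.
  apply: contraT => nsRL; case: (negP ntR); rewrite -subG1.
  have sRN : R \subset 'N_G(R) by rewrite subsetI sRG normG.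
  have defN := mulg_normal_maximal nsLN maxL sRN nsRL.
  have ti : R :&: L \subset [1].
    apply: (tiZN sylR); first exact: subsetIl.
    rewrite -defN mul_subG //.
      by apply: subset_trans abL _; rewrite centS ?subsetIr.
    by apply: subset_trans abR _; rewrite centS ?subsetIl.
  apply: (tiZN sylR); first exact: subxx.
  rewrite -defN mul_subG // (sameP commG1P trivgP) (subset_trans _ ti) //.
  rewrite subsetI commg_subr commg_subl (subset_trans sRN (normal_norm nsLN)) andbT.
  by rewrite (subset_trans sLN) ?subsetIr.
have sLC : L \subset 'C_G[x].
  rewrite subsetI (subset_trans sLN) ?subsetIl //=.
  by rewrite sub_cent1 (subsetP abL) // (subsetP sRL).
have [K [maxK nsKC abK _]] :
    exists K : {group gT}, [/\ maximal K 'C_G[x], K <| 'C_G[x], abelian K & prime #|'C_G[x] : K|].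
  apply: (simple_in_Yn_local (A := <[x]>)) => //; rewrite ?subsetIl ?cycle_abelian //.
    rewrite /normal (subset_trans sxR sRC) /=.
    by rewrite subIset // -cent_cycle cent_sub orbT.
  by rewrite cycle_eq1.
have [sKC nKC] := andP nsKC.
(* If [R] lies in [K], it is characteristic in [K], so ['C_G[x]] normalizes [R]; being non-abelian
   it is not inside [L], and with [L] it generates the normalizer of [R]. *)
have [sRK | nsRK] := boolP (R \subset K).
  have sylRK := pHall_subl sRK (subset_trans sKC (subsetIl _ _)) sylR.
  have charR : R \char K.
    by rewrite -(normal_Hall_pcore sylRK) ?pcore_char // -sub_abelian_normal.
  have sCN : 'C_G[x] \subset 'N_G(R).
    by rewrite subsetI subsetIl (char_norm_trans charR).
  case: notNC.
  have nsCL : ~~ ('C_G[x] \subset L) by apply: contra nabC => /abelianS->.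
  by rewrite -(mulg_normal_maximal nsLN maxL sCN nsCL) mul_subG.
pose W := 'O_r^'(K).
have charW : W \char K := pcore_char _ _.
have nWC : 'C_G[x] \subset 'N(W) := char_norm_trans charW nKC.
have [_ defK _ _] := dprodP (nilpotent_pcoreC r (abelian_nil abK)).
have sOR : 'O_r(K) \subset R.
  have sylRC := pHall_subl sRC (subsetIl _ _) sylR.
  apply: subset_trans (pcore_sub_Hall sylRC).
  by apply: pcore_max (pcore_pgroup _ _) (char_normal_trans (pcore_char _ _) nsKC).
have defC : R * W = 'C_G[x].
  rewrite -(mulg_normal_maximal nsKC maxK sRC nsRK).
  by rewrite -(normC (subset_trans sRC nKC)) -defK mulgA (mulGSid sOR).
have [y Ry nKy] := subsetPn nsRK.
have syR : <[y]> \subset R by rewrite cycle_subG.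
have sWK : W \subset K := char_sub charW.
have sYC : <[y]> <*> W \subset 'C_G[x].
  by rewrite join_subG (subset_trans syR) // (subset_trans sWK).
have nsYC : <[y]> <*> W <| 'C_G[x].
  rewrite /normal sYC -{1}defC mul_subG //; last exact: subset_trans (joing_subr _ _) (normG _).
  rewrite normsY ?(subset_trans sRC nWC) //.
  by rewrite (subset_trans abR) // (subset_trans (centS syR)) ?cent_sub.
(* If [<[y]> <*> W] is proper it is abelian, and then so is ['C_G[x] = K * <[y]>]. If not, [R] is
   the cyclic group [<[y]>], and its normalizer normalizes [<[x]>]. *)
have [eqYC | neqYC] := eqVneq (<[y]> <*> W) 'C_G[x]; last first.
  have ynC : in_Yn 'C_G[x] := in_YnS (subsetIl _ _) ynG.
  have abY := in_Yn_normal_abelian ynC nsYC neqYC.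
  have syC : <[y]> \subset 'C_G[x] := subset_trans syR sRC.
  have nsyK : ~~ (<[y]> \subset K) by rewrite cycle_subG.
  case/negP: nabC; rewrite -(mulg_normal_maximal nsKC maxK syC nsyK).
  have cKy : <[y]> \subset 'C(K).
    rewrite -defK centM subsetI.
    rewrite (subset_trans syR) ?(subset_trans abR) ?centS //=.
    rewrite (subset_trans (joing_subl _ W)) // (subset_trans abY) ?centS //.
    exact: joing_subr.
  by rewrite abelianM abK cycle_abelian.
have defR : R :=: <[y]>.
  apply/eqP; rewrite eq_sym eqEcard syR /=.
  have sylRC := pHall_subl sRC (subsetIl _ _) sylR.
  rewrite (card_Hall sylRC) /= -eqYC norm_joinEl; last first.
    by rewrite (subset_trans (subset_trans syR sRC)).
  have ry : r.-group <[y]> := pgroupS syR rR.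
  rewrite TI_cardMg; last first.
    by apply: coprime_TIg; apply: pnat_coprime ry _; apply: pcore_pgroup.
  rewrite partnM ?cardG_gt0 // part_pnat_id // part_p'nat ?muln1 //.
  exact: pcore_pgroup.
case: notNC; apply: subset_trans sNxC; rewrite setIS //.
by rewrite (char_norm_trans _ (subxx _)) // defR cycle_subgroup_char // -defR.
Qed.

Lemma simple_in_Yn_cent x : x \in G -> x != 1 -> abelian 'C_G[x].
Proof.
move=> Gx ntx; have /pdivP[r pr_r r_dv_x] : 1 < #[x] by rewrite order_gt1.
have sxG : <[x]> \subset G by rewrite cycle_subG.
have [y xy oy] := Cauchy pr_r r_dv_x.
have Gy := subsetP sxG y xy.
apply: abelianS (simple_in_Yn_cent_prime Gy _); last by rewrite oy.
by rewrite setIS // -(cent_set1 y) -(cent_cycle x) centS // sub1set.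
Qed.

(** [M] is not self-normalizing: otherwise it would contain the normalizer of one of its Sylow
    subgroups, against transfer. It remains to see that the abelian normal subgroup [K] of prime
    index is [M]. If [M] is not inside [K], then [K * M] is the whole normalizer and centralizes
    some non-trivial element of [M], which puts the normalizer in [M]. *)
Lemma simple_in_Yn_norm_cent x (M := 'C_G[x]) :
  x \in G -> x != 1 -> prime #|'N_G(M) : M|.
Proof.
move=> Gx ntx; have abM : abelian M := simple_in_Yn_cent Gx ntx.
have Mx : x \in M by rewrite inE Gx cent1id.
have sMG : M \subset G := subsetIl _ _.
have nsMN : M <| 'N_G(M) := normalSG sMG.
have ntM : M != 1 by apply/trivgPn; exists x.
have cenE y : y \in M -> y != 1 -> 'C_G[y] = M.
  move=> My nty; have Gy := subsetP sMG y My.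
  have abMy := simple_in_Yn_cent Gy nty.
  apply/eqP; rewrite eqEsubset !subsetI !subsetIl /= !sub_cent1.
  rewrite (subsetP abMy) ?(subsetP abM) //.
  by rewrite inE Gx cent1C; case/setIP: My.
have neqNM : 'N_G(M) != M.
  apply: contraTneq (ntx) => defN; rewrite negbK.
  have /pdivP[r pr_r r_dv_x] : 1 < #[x] by rewrite order_gt1.
  have [y xy oy] := Cauchy pr_r r_dv_x.
  have sxM : <[x]> \subset M by rewrite cycle_subG.
  have My := subsetP sxM y xy; have Gy := subsetP sMG y My.
  have nty : y != 1 by rewrite -order_gt1 oy prime_gt1.
  have ry : r.-group <[y]> by rewrite /pgroup -orderE oy pnat_id.
  have syG : <[y]> \subset G by rewrite cycle_subG.
  have [R sylR syR] := Sylow_superset syG ry.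
  have Ry : y \in R by rewrite -cycle_subG.
  have abR := simple_in_Yn_abelian_pgroup (pHall_sub sylR) (pHall_pgroup sylR).
  have sRM : R \subset M.
    by rewrite -(cenE y) // subsetI (pHall_sub sylR) sub_cent1 (subsetP abR).
  have sNM : 'N_G(R) \subset M.
    rewrite -defN; apply/subsetP=> n /setIP[Gn nRn]; rewrite inE Gn inE.
    have Ryn : y ^ n \in R by rewrite memJ_norm.
    rewrite -{1}(cenE y) // conjIg -cent1J (conjGid Gn).
    by rewrite (cenE (y ^ n)) ?subxx ?conjg_eq1 ?(subsetP sRM).
  have cNR : 'N_G(R) \subset 'C(R).
    by rewrite (subset_trans sNM) ?(subset_trans abM) ?centS.
  by have /subsetP/(_ y Ry) := tiZN sylR (subxx R) cNR; rewrite inE (negPf nty).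
have [K [maxK nsKN abK prK]] :=
  simple_in_Yn_local (subsetIl G 'N(M)) nsMN abM ntM.
suff defK : K :=: M by move: prK; rewrite defK.
have sMN := normal_sub nsMN; have sKN := normal_sub nsKN.
have [sMK | nsMK] := boolP (M \subset K).
  apply/eqP; rewrite eqEsubset sMK andbT subsetI (subset_trans sKN) ?subsetIl //.
  by rewrite sub_cent1 (subsetP abK) // (subsetP sMK).
have defN := mulg_normal_maximal nsKN maxK sMN nsMK.
have cN u : u \in M -> u \in 'C(K) -> u != 1 -> K = M :> {set _}.
  move=> Mu cKu ntu; case/eqP: neqNM; apply/eqP; rewrite eqEsubset sMN andbT.
  suff: 'N_G(M) \subset 'C_G[u] by rewrite cenE.
  rewrite subsetI subsetIl /= sub_cent1 -[_ :&: _]defN centM inE cKu.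
  by rewrite (subsetP abM).
have [/trivgPn[u /setIP[Mu Ku] ntu] | ] := boolP (M :&: K != 1).
  by apply: cN ntu => //; apply: subsetP abK u Ku.
rewrite negbK => /eqP ti; apply: (cN x Mx _ ntx); apply: (subsetP _ x Mx).
rewrite (sameP commG1P trivgP) -ti subsetI commg_subr commg_subl.
rewrite (subset_trans sMN (normal_norm nsKN)).
by rewrite (subset_trans sKN (normal_norm nsMN)).
Qed.

End SimpleYn.

(** * Groups with abelian centralizers *)

Section CAGroup.

Variables (gT : finGroupType) (G : {group gT}).
Hypothesis abC : forall x, x \in G -> x != 1 -> abelian 'C_G[x].
Hypothesis prN : forall x, x \in G -> x != 1 -> prime #|'N_G('C_G[x]) : 'C_G[x]|.

(** Under [abC] these are the non-trivial maximal abelian subgroups of [G], and distinct ones meet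
    trivially. *)
Definition maxab : {set {group gT}} := [set 'C_G[x]%G | x in G^#].

Lemma maxab_cent (M : {group gT}) x : M \in maxab -> x \in M -> x != 1 -> 'C_G[x] = M.
Proof.
case/imsetP=> y /setD1P[nty Gy] -> /= Cyx ntx; have [Gx cyx] := setIP Cyx.
have abx := abC Gx ntx; have aby := abC Gy nty.
have Cxy : y \in 'C_G[x] by rewrite inE Gy cent1C.
apply/eqP; rewrite eqEsubset !subsetI !subsetIl !sub_cent1.
by rewrite (subsetP abx _ Cxy) (subsetP aby _ Cyx).
Qed.

Lemma cent_maxab x : x \in G -> x != 1 -> 'C_G[x]%G \in maxab.
Proof. by move=> Gx ntx; apply: imset_f; rewrite !inE ntx. Qed.

Lemma maxab_sub (M : {group gT}) : M \in maxab -> M \subset G.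
Proof. by case/imsetP=> y _ ->; apply: subsetIl. Qed.

Lemma maxab_abelian (M : {group gT}) : M \in maxab -> abelian M.
Proof. by case/imsetP=> y /setD1P[nty Gy] ->; apply: abC. Qed.

Lemma maxab_neq1 (M : {group gT}) : M \in maxab -> M :!=: 1.
Proof.
case/imsetP=> y /setD1P[nty Gy] ->; apply/trivgPn; exists y => //.
by rewrite inE Gy cent1id.
Qed.

Lemma maxab_gt1 (M : {group gT}) : M \in maxab -> 1 < #|M|.
Proof. by move/maxab_neq1; rewrite cardG_gt1. Qed.

Lemma maxab_prime (M : {group gT}) : M \in maxab -> prime #|'N_G(M) : M|.
Proof. by case/imsetP=> y /setD1P[nty Gy] ->; apply: prN. Qed.

Lemma maxabJ (M : {group gT}) g : M \in maxab -> g \in G -> (M :^ g)%G \in maxab.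
Proof.
case/imsetP=> y /setD1P[nty Gy] -> Gg; apply/imsetP; exists (y ^ g).
  by rewrite !inE conjg_eq1 nty groupJ.
by apply: val_inj; rewrite /= conjIg conjGid // cent1J.
Qed.

Lemma maxab_conj (M L : {group gT}) g y :
    M \in maxab -> L \in maxab -> g \in G -> y != 1 -> y \in M :^ g -> y \in L ->
  L :=: M :^ g.
Proof.
move=> hM hL Gg nty My Ly.
by rewrite -(maxab_cent hL Ly nty) (maxab_cent (maxabJ hM Gg) My nty).
Qed.

Lemma maxab_TI (M : {group gT}) : M \in maxab -> normedTI M^# G 'N_G(M).
Proof.
move=> hM; apply/normedTI_memJ_P; split; first by rewrite setD_eq0 subG1 maxab_neq1.
  exact: subsetIl.
move=> x g /setD1P[ntx Mx] Gg; rewrite !inE conjg_eq1 ntx Gg /=.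
apply/idP/idP=> [Mxg | sMg]; last by rewrite (subsetP sMg) ?memJ_conjg.
have ntxg : x ^ g != 1 by rewrite conjg_eq1.
by rewrite -(maxab_conj hM hM Gg ntxg) ?memJ_conjg.
Qed.

Lemma maxab_Frobenius (M : {group gT}) :
  M \in maxab -> [Frobenius 'N_G(M) with kernel M].
Proof.
move=> hM; have sMG := maxab_sub hM.
apply/Frobenius_kerP; split; first exact: maxab_neq1.
- rewrite properE normal_sub ?normalSG //.
  apply: contraL (maxab_prime hM) => /= sNM.
  by rewrite (_ : #|_ : _| = 1%N) //; apply/eqP; rewrite indexg_eq1.
- exact: normalSG.
move=> x /setD1P[ntx Mx]; rewrite -(maxab_cent hM Mx ntx).
by rewrite setSI ?subsetIl.
Qed.

(** A non-trivial central element of a Sylow subgroup [R] shows that [R] is abelian; if [R] meets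
    [M] non-trivially it thus lies in [M]. So [M] is a Hall subgroup of [G]. *)
Lemma maxab_Sylow (M : {group gT}) r :
    M \in maxab -> prime r -> r %| #|M| ->
  exists2 R : {group gT}, r.-Sylow(G) R & R \subset M.
Proof.
move=> hM pr_r r_dv_M; have sMG := maxab_sub hM.
have [y My oy] := Cauchy pr_r r_dv_M.
have nty : y != 1 by rewrite -order_gt1 oy prime_gt1.
have Gy := subsetP sMG y My.
have syG : <[y]> \subset G by rewrite cycle_subG.
have ry : r.-group <[y]> by rewrite /pgroup -orderE oy pnat_id.
have [R sylR syR] := Sylow_superset syG ry.
have [rR sRG] := (pHall_pgroup sylR, pHall_sub sylR).
have Ry : y \in R by rewrite -cycle_subG.
have ntZ : 'Z(R) != 1.
  by rewrite center_nil_eq1 ?(pgroup_nil rR) //; apply/trivgPn; exists y.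
have [z /setIP[Rz cRz] ntz] := trivgPn _ ntZ.
have abR : abelian R.
  have Gz := subsetP sRG z Rz.
  by apply: abelianS (abC Gz ntz); rewrite subsetI sRG sub_cent1.
exists R => //.
by rewrite -(maxab_cent hM My nty) subsetI sRG sub_cent1 (subsetP abR).
Qed.

Definition class_cover (M : {group gT}) := class_support M^# G.

Definition maxab_reps : {set {group gT}} := orbit_transversal (conjG_action gT) G maxab.

Lemma maxab_acts : [acts G, on maxab | conjG_action gT].
Proof.
apply/actsP=> g Gg M /=; apply/idP/idP => [|hM]; last exact: maxabJ.
move/maxabJ/(_ (groupVr Gg)); congr (_ \in maxab); apply: val_inj.
by rewrite /= conjsgK.
Qed.

Lemma maxab_repsW : maxab_reps \subset maxab.
Proof. by have [] := orbit_transversalP maxab_acts. Qed.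

Lemma maxab_repsP (M : {group gT}) : M \in maxab ->
  exists2 g, g \in G & (M :^ g)%G \in maxab_reps.
Proof. by have [_ _ _ rep] := orbit_transversalP maxab_acts => /rep. Qed.

Lemma maxab_reps_inj (M L : {group gT}) g :
  M \in maxab_reps -> L \in maxab_reps -> g \in G -> L :=: M :^ g -> M = L.
Proof.
move=> RM RL Gg defL; have [_ _ inj _] := orbit_transversalP maxab_acts.
apply/eqP; rewrite -(inj M L) //; apply/imsetP; exists g => //.
exact: val_inj.
Qed.

Lemma class_cover_inj (M L : {group gT}) x :
    M \in maxab_reps -> L \in maxab_reps ->
  x \in class_cover M -> x \in class_cover L -> M = L.
Proof.
move=> RM RL /imset2P[y g /setD1P[nty My] Gg ->] /imset2P[z h /setD1P[ntz Lz] Gh def_x].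
have hM := subsetP maxab_repsW M RM; have hL := subsetP maxab_repsW L RL.
have Ggh : g * h^-1 \in G by rewrite groupM ?groupV.
apply: (maxab_reps_inj RM RL Ggh); apply: (maxab_conj hM hL Ggh ntz) => //.
by rewrite -(conjgK h z) -def_x -conjgM memJ_conjg.
Qed.

Lemma class_coverP x : x \in G -> x != 1 ->
  exists2 M, M \in maxab_reps & x \in class_cover M.
Proof.
move=> Gx ntx; have [g Gg RM] := maxab_repsP (cent_maxab Gx ntx).
exists ('C_G[x] :^ g)%G => //; apply/imset2P; exists (x ^ g) g^-1; rewrite ?groupV //.
  by rewrite !inE conjg_eq1 ntx memJ_conjg inE Gx cent1id.
by rewrite conjgK.
Qed.

Lemma class_cover_sub M x : M \in maxab -> x \in class_cover M -> x \in G^#.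
Proof.
move=> hM /imset2P[y g /setD1P[nty My] Gg ->].
by rewrite !inE conjg_eq1 nty groupJ // (subsetP (maxab_sub hM)).
Qed.

Lemma card_class_cover (M : {group gT}) : M \in maxab ->
  (#|class_cover M| * (#|'N_G(M) : M| * #|M|) = #|M|.-1 * #|G|)%N.
Proof.
move=> hM; rewrite (card_support_normedTI (maxab_TI hM)) -mulnA (mulnC #|_ : M|).
rewrite Lagrange ?(normal_sub (normalSG _)) ?maxab_sub // [(#|_ : _| * _)%N]mulnC.
by rewrite Lagrange ?subsetIl // (cardsD1 1 M) group1.
Qed.

Lemma big_class_cover (A : Type) (idx : A) (op : Monoid.com_law idx) (F : gT -> A) :
  \big[op/idx]_(x in G^#) F x
    = \big[op/idx]_(M in maxab_reps) \big[op/idx]_(x in class_cover M) F x.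
Proof.
(* [h x] is the representative whose cover contains [x]; the default [G] is not taken on [G^#]. *)
pose h x := odflt G [pick M in maxab_reps | x \in class_cover M].
have hP x : x \in G^# -> h x \in maxab_reps /\ x \in class_cover (h x).
  case/setD1P=> ntx Gx; rewrite /h; case: pickP => [M /andP[] // | no_M].
  by have [M RM Mx] := class_coverP Gx ntx; have := no_M M; rewrite /= RM Mx.
rewrite (partition_big h (mem maxab_reps)) => [|x /hP[] //].
apply: eq_bigr => M RM; apply: eq_bigl => x.
apply/andP/idP=> [[/hP[_ hx] /eqP <-] // | Mx].
have G1x := class_cover_sub (subsetP maxab_repsW M RM) Mx.
by split=> //; have [Rh hx] := hP x G1x; apply/eqP/(class_cover_inj Rh RM hx Mx).
Qed.

Lemma sum_class_cover : (\sum_(M in maxab_reps) #|class_cover M|).+1 = #|G|.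
Proof.
rewrite [RHS](cardsD1 1) group1 add1n; congr _.+1.
by rewrite -[RHS]sum1_card big_class_cover; apply: eq_bigr => M _; rewrite sum1_card.
Qed.

Lemma maxab_reps_coprime (M L : {group gT}) :
  M \in maxab_reps -> L \in maxab_reps -> M != L -> coprime #|M| #|L|.
Proof.
move=> RM RL; have hM := subsetP maxab_repsW M RM; have hL := subsetP maxab_repsW L RL.
apply: contraR; rewrite coprime_has_primes // negbK => /hasP[r].
rewrite !mem_primes => /and3P[pr_r _ r_dv_L] /andP[_ /andP[_ r_dv_M]].
have [R sylR sRM] := maxab_Sylow hM pr_r r_dv_M.
have [T sylT sTL] := maxab_Sylow hL pr_r r_dv_L.
have [g Gg defT] := Sylow_trans sylR sylT.
have ntT : T :!=: 1.
  rewrite -cardG_gt1 (card_Hall sylT) p_part_gt1 mem_primes pr_r cardG_gt0.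
  by rewrite (dvdn_trans r_dv_L) // cardSg ?maxab_sub.
have [z Tz ntz] := trivgPn _ ntT.
apply/eqP/(maxab_reps_inj RM RL Gg)/(maxab_conj hM hL Gg ntz).
  by move: Tz; rewrite defT; apply: subsetP; rewrite conjSg.
exact: subsetP sTL z Tz.
Qed.

End CAGroup.

(** * Exceptional characters *)

Section Exceptional.

Import GroupScope Order.TTheory GRing.Theory Num.Theory.
Local Open Scope ring_scope.

(** For a real non-trivial character, orthogonality to the trivial one and the pairing of [x] with
    its inverse give ['chi_i 1 + 2 a = 0]. The algebraic integer [a] is rational, hence an integer,
    so the degree is even; but it divides the odd order of [G]. *)
Lemma odd_conjC_Iirr_neq gT (G : {group gT}) (i : Iirr G) :
  odd #|G| -> i != 0 -> conjC_Iirr i != i.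
Proof.
move=> oddG nz_i; apply/eqP=> real_i.
have chiV x : 'chi_i x^-1%g = 'chi_i x by rewrite irr_inv -cfConjCE -conjC_IirrE real_i.
(* The enumeration of the group selects one element from each pair of a non-trivial element and its
   inverse. *)
pose h (x : gT) := (enum_rank x < enum_rank x^-1%g)%N.
pose a := \sum_(x in G | h x) 'chi_i x.
have sum0 : 'chi_i 1%g + (a + a) = 0.
  have: '['chi_i, 'chi_0] = 0 by rewrite cfdot_irr (negPf nz_i).
  rewrite cfdotE irr0 => /eqP; rewrite mulf_eq0 invr_eq0 (negPf (neq0CG G)) /=.
  rewrite (eq_bigr (fun x => 'chi_i x)) => [|x Gx]; last by rewrite cfun1E Gx conjC1 mulr1.
  rewrite (bigD1 1%g) //= (bigID h) /=.
  rewrite [X in _ + (_ + X)](reindex_inj invg_inj) /=.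
  rewrite [X in _ + (_ + X)](eq_bigr _ (fun x _ => chiV x)).
  have hE x : (x \in G) && (x != 1%g) && h x = (x \in G) && h x.
    rewrite -andbA; congr (_ && _); have [->|//] := eqVneq x 1%g.
    by rewrite /h invg1 ltnn.
  rewrite (eq_bigl _ _ hE) [X in _ + (_ + X)](eq_bigl (fun x => (x \in G) && h x)) => [/eqP //|x].
  rewrite groupV invg_eq1 -andbA; apply: andb_id2l => Gx.
  have [->|nt_x] := eqVneq x 1%g; first by rewrite /h invg1 ltnn.
  rewrite /h invgK -leqNgt leq_eqVlt orb_idl // => /eqP/val_inj/enum_rank_inj eqx.
  have x2 : (x ^+ 2 = 1)%g by rewrite expgS expg1 {2}eqx mulgV.
  case/eqP: nt_x; apply/eqP; rewrite -order_eq1 -dvdn1 -(eqnP (_ : coprime 2 #|G|)).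
    by rewrite dvdn_gcd order_dvdn x2 eqxx order_dvdG.
  by rewrite coprime2n.
have Aa : a \in Aint by apply: rpred_sum => x _; apply: Aint_irr.
have /natrP[d chi1] := Cnat_irr1 i.
have Za : a \is a Num.int.
  apply: Cint_rat_Aint => //; rewrite (_ : a = - (d%:R / 2)); first by rewrite rpredN rpred_div ?rpred_nat.
  have -> : d%:R = - (a + a) by apply/eqP; rewrite -addr_eq0 -chi1 sum0.
  by field.
have /intrP[z az] := Za.
have := dvd_irr1_cardG i; rewrite chi1 dvdC_nat => d_dv_G.
have := dvdn_odd d_dv_G oddG.
have: (d%:Z + (z + z) == 0) by rewrite -(intr_eq0 algC) !rmorphD /= -az -pmulrn -chi1 sum0.
by lia.
Qed.

Section ExceptionalCharacters.

Variables (gT : finGroupType) (G M : {group gT}).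
Local Notation N := ('N_G(M))%G.
Local Notation cl := (class_support M^# G).
Hypotheses (TIM : normedTI M^# G 'N_G(M)) (frobN : [Frobenius 'N_G(M) with kernel M]).
Hypotheses (abM : abelian M) (oddG : odd #|G|).

Let sNG : N \subset G. Proof. exact: subsetIl. Qed.
Let nsMN : M <| N. Proof. by have /Frobenius_kerP[] := frobN. Qed.
Let sMN : M \subset N. Proof. exact: normal_sub. Qed.
Let sMG : M \subset G. Proof. exact: subset_trans sMN sNG. Qed.
Let oddN : odd #|N|. Proof. exact: oddSg sNG oddG. Qed.

Lemma TI_Ind_id (phi : 'CF(N)) x :
  phi \in 'CF(N, M^#) -> x \in M^# -> 'Ind[G] phi x = phi x.
Proof.
move=> Mphi Mx; have [_ _ TI] := normedTI_memJ_P TIM.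
rewrite cfIndE //; apply: (mulfI (neq0CG N)); rewrite mulVKf ?neq0CG //.
rewrite (big_setID N) /= (setIidPr sNG) [X in _ + X]big1 ?addr0.
  rewrite (eq_bigr (fun => phi x)) => [|y Ny]; last by rewrite cfunJ.
  by rewrite sumr_const mulr_natl.
by move=> y /setDP[Gy nNy]; apply: (cfun_on0 Mphi); rewrite TI.
Qed.

Lemma TI_Ind_isometry :
  {in 'CF(N, M^#) &, forall phi psi : 'CF(N), '['Ind[G] phi, 'Ind[G] psi] = '[phi, psi]}.
Proof.
move=> phi psi Mphi Mpsi; rewrite -Frobenius_reciprocity !(cfdotEl _ Mphi).
congr (_ * _); apply: eq_bigr => x Mx.
have Nx : x \in N by apply: (subsetP sMN); case/setD1P: Mx.
by rewrite cfResE // TI_Ind_id.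
Qed.

(** For [i != 0] the induced character is irreducible because [N] is a Frobenius group; [i = 0] is
    left out of [exc_ker], which thus consists of the irreducible characters of [N] without [M] in
    their kernel. *)
Definition exc_up (i : Iirr M) : Iirr N := cfIirr ('Ind[N] 'chi_i).
Definition exc_ker : {set Iirr N} := [set exc_up i | i in predC1 0].

Lemma exc_upE i : i != 0 -> 'chi_(exc_up i) = 'Ind[N] 'chi[M]_i.
Proof. by move=> nz_i; rewrite cfIirrE // (irr_induced_Frobenius_ker frobN). Qed.

Let Ind1 : 'Ind[N] (1 : 'CF(M)) = #|N : M|%:R *: '1_M.
Proof. exact: cfInd_cfun1. Qed.

Let Res1 : 'Res[M] ('1_M : 'CF(N)) = 1.
Proof.
apply/cfun_inP=> x Mx; rewrite cfResE // cfuniE // Mx cfun1E Mx //.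
Qed.

Lemma exc_ker_Ind1 k : k \in exc_ker -> '['Ind[N] (1 : 'CF(M)), 'chi_k] = 0.
Proof.
case/imsetP=> i nz_i ->; rewrite exc_upE // Ind1 cfdotC -Frobenius_reciprocity.
rewrite linearZ /= Res1 cfdotZr -irr0 cfdot_irr (negPf nz_i) mulr0.
by rewrite conjC0.
Qed.

Lemma exc_ker_neq0 k : k \in exc_ker -> k != 0.
Proof.
move=> Tk; apply: contra_eq_neq (exc_ker_Ind1 Tk) => ->.
rewrite -Frobenius_reciprocity irr0 cfRes_cfun1 cfnorm1.
by rewrite oner_eq0.
Qed.

Lemma exc_ker_conj k : k \in exc_ker -> conjC_Iirr k \in exc_ker.
Proof.
case/imsetP=> i nz_i ->; apply/imsetP; exists (conjC_Iirr i).
  by rewrite inE conjC_Iirr_eq0.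
apply: irr_inj; rewrite conjC_IirrE !exc_upE ?conjC_Iirr_eq0 //.
by rewrite cfAutInd conjC_IirrE.
Qed.

Lemma exc_ker_conj_neq k : k \in exc_ker -> conjC_Iirr k != k.
Proof. by move=> Tk; rewrite odd_conjC_Iirr_neq ?exc_ker_neq0. Qed.

Lemma exc_ker1 k : k \in exc_ker -> 'chi_k 1%g = #|N : M|%:R.
Proof.
case/imsetP=> i nz_i ->; rewrite exc_upE // cfInd1 // lin_char1 ?mulr1 //.
exact/char_abelianP.
Qed.

Lemma exc_ker_Res (i : Iirr M) k :
  i != 0 -> '['Res[M] 'chi[N]_k, 'chi_i] = (k == exc_up i)%:R.
Proof. by move=> nz_i; rewrite cfdot_Res_l -exc_upE // cfdot_irr. Qed.

(** The restriction to [M] of a character in [exc_ker] is the sum of the linear characters that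
    induce it. Comparing degrees, each fibre of [exc_up] has [#|N : M|] elements. *)
Lemma card_exc_ker : (#|exc_ker| * #|N : M| = #|M|.-1)%N.
Proof.
have -> : #|M|.-1 = #|predC1 (0 : Iirr M)|.
  by rewrite cardC1 card_Iirr_abelian.
rewrite -[RHS]sum1_card (partition_big_imset exc_up) /= -sum_nat_const.
apply: eq_bigr => k Tk; apply/eqP; rewrite -(eqr_nat algC) -(exc_ker1 Tk) natr_sum.
rewrite -(cfRes1 M) ['Res[M] 'chi_k]cfun_sum_cfdot sum_cfunE (bigD1 0) //=.
rewrite cfunE irr0 cfdotC -irr0 irr0 Frobenius_reciprocity exc_ker_Ind1 // conjC0 mul0r add0r.
rewrite big_mkcondr /=; apply/eqP; apply: eq_bigr => i nz_i.
rewrite cfunE exc_ker_Res // lin_char1 ?mulr1; last exact/char_abelianP.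
by rewrite eq_sym; case: eqP.
Qed.

Lemma exc_sub_on k l :
  k \in exc_ker -> l \in exc_ker -> 'chi_k - 'chi_l \in 'CF(N, M^#).
Proof.
move=> Tk Tl; apply/cfun_onP=> x; rewrite !inE negb_and negbK !cfunE.
case/orP=> [/eqP-> | nMx]; first by rewrite !exc_ker1 ?subrr.
have off j : j \in exc_ker -> 'chi_j x = 0.
  case/imsetP=> i nz_i ->; rewrite exc_upE //.
  by rewrite (cfun_on0 (cfInd_normal _ nsMN)).
by rewrite !off // subrr.
Qed.

Definition exc_dif (k l : Iirr N) : 'CF(G) := 'Ind[G] ('chi_k - 'chi_l).

Lemma exc_difE (k l : Iirr N) : exc_dif k l = 'Ind[G] 'chi_k - 'Ind[G] 'chi_l.
Proof. by rewrite /exc_dif raddfB. Qed.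

Lemma exc_dif_on k l :
  k \in exc_ker -> l \in exc_ker -> exc_dif k l \in 'CF(G, cl).
Proof. by move=> Tk Tl; apply: cfInd_on => //; apply: exc_sub_on. Qed.

Lemma exc_dif_dot k l k' l' :
    k \in exc_ker -> l \in exc_ker -> k' \in exc_ker -> l' \in exc_ker ->
  '[exc_dif k l, exc_dif k' l'] =
     (k == k')%:R - (k == l')%:R - (l == k')%:R + (l == l')%:R.
Proof.
move=> Tk Tl Tk' Tl'; rewrite TI_Ind_isometry ?exc_sub_on //.
by rewrite cfdotBl !cfdotBr !cfdot_irr opprB addrA addrAC.
Qed.

Lemma exc_dif_vchar k l :
  k \in exc_ker -> l \in exc_ker -> exc_dif k l \in 'Z[irr G, G^#].
Proof.
move=> Tk Tl; rewrite zchar_split cfInd_vchar ?rpredB ?irr_vchar //.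
apply: (cfun_onS _ (exc_dif_on Tk Tl)).
apply/subsetP=> _ /imset2P[y g /setD1P[nty My] Gg ->].
by rewrite !inE conjg_eq1 nty groupJ // (subsetP sMG).
Qed.

Lemma exc_dif_irr k l :
    k \in exc_ker -> l \in exc_ker -> k != l ->
  exists a, exists2 b, b != a & exc_dif k l = 'chi_a - 'chi_b.
Proof.
move=> Tk Tl neq_kl; apply: vchar_norm2 (exc_dif_vchar Tk Tl) _.
by rewrite exc_dif_dot // !eqxx (eq_sym l) (negPf neq_kl) !subr0.
Qed.

(** The difference has norm 2 and vanishes at 1, so it is a difference of two irreducible
    characters; complex conjugation negates it and must exchange them. *)
Lemma exc_conj k :
  k \in exc_ker -> exists a, (conjC_Iirr a != a) &&
    (exc_dif k (conjC_Iirr k) == 'chi_a - 'chi_(conjC_Iirr a)).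
Proof.
move=> Tk; have Tk' := exc_ker_conj Tk.
have neqk : k != conjC_Iirr k by rewrite eq_sym exc_ker_conj_neq.
have [a [b neq_ba Dab]] := exc_dif_irr Tk Tk' neqk.
suff conj_a : conjC_Iirr a = b by exists a; rewrite conj_a neq_ba Dab /=.
have : (exc_dif k (conjC_Iirr k))^*%CF = - exc_dif k (conjC_Iirr k).
  rewrite {1}/exc_dif cfAutInd raddfB /= -!conjC_IirrE conjC_IirrK.
  by rewrite -raddfN opprB.
rewrite Dab raddfB /= -!conjC_IirrE => /(congr1 (cfdotr 'chi_b)).
rewrite /= opprB !cfdotBl !cfdot_irr eqxx eq_sym [a == b]eq_sym (negPf neq_ba) subr0.
case: eqVneq => // _; case: (_ == b) => /eqP; rewrite sub0r ?subr0 eq_sym ?oner_eq0 //.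
  by rewrite -addr_eq0 -mulr2n pnatr_eq0.
by rewrite oppr0 oner_eq0.
Qed.

(* The default value is never taken on [exc_ker]: see [excP]. *)
Definition exc k : Iirr G :=
  odflt 0 [pick a | (conjC_Iirr a != a) &&
             (exc_dif k (conjC_Iirr k) == 'chi_a - 'chi_(conjC_Iirr a))].

Lemma excP k : k \in exc_ker ->
  conjC_Iirr (exc k) != exc k
  /\ exc_dif k (conjC_Iirr k) = 'chi_(exc k) - 'chi_(conjC_Iirr (exc k)).
Proof.
move=> Tk; rewrite /exc; case: pickP => [a /andP[neq_a /eqP Da] // | no_a].
by have [a] := exc_conj Tk; rewrite no_a.
Qed.

Lemma irr_sub_inj a b c d :
  'chi[G]_a - 'chi_b = 'chi_c - 'chi_d -> a != b -> a = c /\ b = d.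
Proof.
move=> eq_ab neq_ab.
have dot i : (a == i)%:R - (b == i)%:R = (c == i)%:R - (d == i)%:R :> algC.
  by rewrite -!cfdot_irr -!cfdotBl eq_ab.

have one (x y : bool) : 1 = x%:R - y%:R :> algC -> x.
  case: x y => [] [] //= /eqP; rewrite ?subr0 ?sub0r ?oner_eq0 //.
  by rewrite -addr_eq0 -mulr2n pnatr_eq0.
have := dot b; rewrite eqxx (negPf neq_ab) sub0r => /(congr1 -%R); rewrite opprK opprB.
have := dot a; rewrite eqxx (eq_sym b a) (negPf neq_ab) subr0.
by move=> /one/eqP-> /one/eqP->.
Qed.

Definition exc_set : {set Iirr G} := exc @: exc_ker.

Lemma exc_setJ k : k \in exc_ker -> exc (conjC_Iirr k) = conjC_Iirr (exc k).
Proof.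
move=> Tk; have [neqe De] := excP Tk.
have [neqe' De'] := excP (exc_ker_conj Tk).
suff [] : exc (conjC_Iirr k) = conjC_Iirr (exc k)
       /\ conjC_Iirr (exc (conjC_Iirr k)) = exc k by [].
apply: irr_sub_inj; last by rewrite eq_sym.
by rewrite -De' conjC_IirrK -opprB -De /exc_dif -raddfN opprB.
Qed.

Lemma exc_set_conj a : a \in exc_set -> conjC_Iirr a \in exc_set.
Proof.
case/imsetP=> k Tk ->; rewrite -exc_setJ //.
by apply: imset_f; apply: exc_ker_conj.
Qed.

Lemma exc_set_neq0 a : a \in exc_set -> a != 0.
Proof.
case/imsetP=> k /excP[neqa _] ->; apply: contraNneq neqa => ->.
by rewrite conjC_Iirr0.
Qed.

Lemma card_exc_set : (#|exc_set| * #|N : M| <= #|M|.-1)%N.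
Proof. by rewrite -card_exc_ker leq_mul2r leq_imset_card orbT. Qed.

Lemma exc_set_gt0 : exists a, a \in exc_set.
Proof.
have [i nz_i] : exists i : Iirr M, i != 0.
  have /Frobenius_kerP[ntM _ _ _] := frobN.
  case: (pickP (predC1 (0 : Iirr M))) => [i nzi|no_i]; first by exists i.
  have := cardC1 (0 : Iirr M); rewrite (eq_card no_i) card0 card_Iirr_abelian //.
  by move=> eqM; case/negP: ntM; rewrite trivg_card_le1 -(prednK (cardG_gt0 M)) -eqM.
by exists (exc (exc_up i)); rewrite !imset_f.
Qed.

Lemma exc_set_on a :
  a \in exc_set -> 'chi_a - 'chi_(conjC_Iirr a) \in 'CF(G, cl).
Proof.
by case/imsetP=> k Tk ->; have [_ <-] := excP Tk; rewrite exc_dif_on ?exc_ker_conj.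
Qed.

(** In the main case the difference has scalar product 1 with that of [k] and its conjugate, and -1
    with that of [l] and its conjugate, so it involves a character from each of the two pairs. These
    are disjoint because the two latter differences are orthogonal. Sign and conjugation stay
    undetermined. *)
Lemma exc_dif_pair k l :
    k \in exc_ker -> l \in exc_ker ->
  exists a b, [/\ a \in [:: exc k; conjC_Iirr (exc k)],
                 b \in [:: exc l; conjC_Iirr (exc l)]
               & exc_dif k l = 'chi_a - 'chi_b \/ exc_dif k l = 'chi_b - 'chi_a].
Proof.
move=> Tk Tl; have [neqk Dk] := excP Tk; have [neql Dl] := excP Tl.
have Tk' := exc_ker_conj Tk; have Tl' := exc_ker_conj Tl.
have [<- | neqkl] := eqVneq k l.
  exists (exc k), (exc k); rewrite !inE eqxx; split=> //; left.
  by rewrite /exc_dif !subrr raddf0.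
have [-> | neqkl'] := eqVneq l (conjC_Iirr k).
  exists (exc k), (conjC_Iirr (exc k)); split; last by left.
    by rewrite inE eqxx.
  by rewrite exc_setJ // !inE eqxx.
have neqk'l : k != conjC_Iirr l.
  by apply: contraNneq neqkl' => ->; rewrite conjC_IirrK.
have [c [d neq_dc Dkl]] := exc_dif_irr Tk Tl neqkl.
move: (exc_dif_dot Tk Tl Tk Tk') (exc_dif_dot Tk Tl Tl Tl') (exc_dif_dot Tk Tk' Tl Tl').
rewrite !eqxx (eq_sym k (conjC_Iirr k)) (eq_sym l k) (eq_sym l (conjC_Iirr l)).
rewrite !(negPf (exc_ker_conj_neq _)) // (negPf neqkl) (negPf neqkl') (negPf neqk'l).
rewrite (inj_eq (can_inj (@conjC_IirrK _ _))) (negPf neqkl) (eq_sym (conjC_Iirr k)) (negPf neqkl').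
rewrite Dkl Dk Dl !cfdotBl !cfdotBr !cfdot_irr !subr0 !addr0 ?sub0r.
set e := exc k in neqk *; set f := exc l in neql *.
have injC := inj_eq (can_inj (@conjC_IirrK _ G)).
have eqC (x y : Iirr G) : (conjC_Iirr x == y) = (x == conjC_Iirr y).
  by rewrite -{1}[y]conjC_IirrK injC.
have n2 : 2 != 0 :> algC by rewrite pnatr_eq0.
move=> dotk dotl dotkl.
have inP x y : x \notin [:: y; conjC_Iirr y] -> (x == y) = false /\ (x == conjC_Iirr y) = false.
  by rewrite !inE negb_or => /andP[/negPf-> /negPf->].
have ck : (c \in [:: e; conjC_Iirr e]) || (d \in [:: e; conjC_Iirr e]).
  apply: contraT; rewrite negb_or => /andP[/inP[c1 c2] /inP[d1 d2]].
  by move/eqP: dotk; rewrite c1 c2 d1 d2 !subrr eq_sym oner_eq0.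
have cl' : (c \in [:: f; conjC_Iirr f]) || (d \in [:: f; conjC_Iirr f]).
  apply: contraT; rewrite negb_or => /andP[/inP[c1 c2] /inP[d1 d2]].
  by move/eqP: dotl; rewrite c1 c2 d1 d2 !subrr eq_sym oppr_eq0 oner_eq0.
have ef : e \notin [:: f; conjC_Iirr f].
  move: dotkl; rewrite !inE injC eqC; case: (eqVneq e f) => [-> | _] /=.
    rewrite eq_sym eqC eq_sym (negPf neql) subr0 sub0r opprK => /eqP.
    by rewrite -mulr2n (negPf n2).
  case: (e == _) => // /eqP; rewrite sub0r subr0 -opprD oppr_eq0.
  by rewrite -mulr2n (negPf n2).
have disj x : x \in [:: e; conjC_Iirr e] -> x \notin [:: f; conjC_Iirr f].
  rewrite !inE => /orP[] /eqP->; first by move: ef; rewrite !inE.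
  by move: ef; rewrite !inE injC eqC orbC.
case/orP: ck => [cke | dke].
  exists c, d; split=> //; last by left.
  by move: cl'; rewrite (negPf (disj c cke)).
exists d, c; split=> //; last by right.
by move: cl'; rewrite (negPf (disj d dke)) orbF.
Qed.

Lemma exc_pair_set k a :
  k \in exc_ker -> a \in [:: exc k; conjC_Iirr (exc k)] -> a \in exc_set.
Proof.
by move=> Tk; rewrite !inE => /orP[] /eqP->; rewrite ?exc_set_conj // imset_f.
Qed.

(** [exc_dif] vanishes outside [cl], so the two characters of [exc_dif_pair] agree there. *)
Lemma exc_set_val a b y :
    a \in exc_set -> b \in exc_set -> y \notin cl ->
  'chi_a y = 'chi_b y \/ 'chi_a y = ('chi_b y)^*.
Proof.
case/imsetP=> k Tk -> /imsetP[l Tl ->] cl'y.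
have [a' [b' [ak bl Dkl]]] := exc_dif_pair Tk Tl.
have: 'chi_a' y = 'chi_b' y.
  have := cfun_on0 (exc_dif_on Tk Tl) cl'y.
  case: Dkl => ->; rewrite !cfunE => /eqP; rewrite subr_eq0 => /eqP //.
move: ak bl; rewrite !inE => /orP[] /eqP-> /orP[] /eqP->.
- by left.
- by rewrite conjC_IirrE cfunE => ->; right.
- rewrite conjC_IirrE cfunE => <-; right; first by rewrite conjCK.
- by rewrite !conjC_IirrE !cfunE => /(can_inj (@conjCK _)); left.
Qed.

(** No [exc_dif] involves ['chi_j], so all non-trivial characters of [M] have the same multiplicity
    [a] in its restriction. The latter is [a0 - a] times the trivial character plus [a] times the
    regular one, and the constant is [a0 - a]. *)
Lemma nonexc_val j : j \notin exc_set ->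
  exists2 c : algC, c \is a Num.int & (forall x, x \in M^# -> 'chi_j x = c)
    /\ (forall i, i != 0 -> '['Ind[G] (1 - 'chi[M]_i), 'chi_j] = c).
Proof.
move=> nSj.
have resE i : i != 0 -> '['Res[M] 'chi[G]_j, 'chi_i] = '['Res[N] 'chi_j, 'chi_(exc_up i)].
  move=> nz_i; rewrite -(cfResRes _ sMN sNG) cfdot_Res_l.
  by rewrite exc_upE.
have resC i l : i != 0 -> l != 0 -> '['Res[M] 'chi[G]_j, 'chi_i] = '['Res[M] 'chi_j, 'chi_l].
  move=> nz_i nz_l; rewrite !resE //; apply/eqP.
  have Ti : exc_up i \in exc_ker by apply: imset_f.
  have Tl : exc_up l \in exc_ker by apply: imset_f.
  rewrite -subr_eq0 -cfdotBr cfdot_Res_l -/(exc_dif _ _).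
  have [a [b [ak bl]]] := exc_dif_pair Ti Tl.
  have ja : (j == a) = false by apply: contraNF nSj => /eqP->; apply: exc_pair_set Ti ak.
  have jb : (j == b) = false by apply: contraNF nSj => /eqP->; apply: exc_pair_set Tl bl.
  by case=> ->; rewrite cfdotBr !cfdot_irr ja jb subrr.
have [i0 nz_i0] : exists i : Iirr M, i != 0.
  have [a /imsetP[k /imsetP[i nz_i _] _]] := exc_set_gt0; by exists i.
pose a := '['Res[M] 'chi[G]_j, 'chi_i0]; pose a0 := '['Res[M] 'chi[G]_j, 'chi_0].
have Zr i : '['Res[M] 'chi[G]_j, 'chi_i] \is a Num.int.
  by rewrite Cint_cfdot_vchar_irr ?cfRes_vchar ?irr_vchar.
exists (a0 - a); first by rewrite rpredB ?Zr.
have defR : 'Res[M] 'chi_j = (a0 - a) *: 1 + a *: cfReg M.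
  rewrite cfReg_sum ['Res[M] _]cfun_sum_cfdot (bigD1 0) //= [in RHS](bigD1 0) //=.
  rewrite scalerDr addrA irr0 cfun1E group1 scale1r -scalerDl subrK -/a0 -irr0.
  congr (_ + _); rewrite scaler_sumr; apply: eq_bigr => i nz_i.
  by rewrite (resC i i0) // lin_char1 ?scale1r //; apply/char_abelianP.
split=> [x /setD1P[ntx Mx] | i nz_i].
  have reg0 : cfReg M x = 0 by rewrite cfRegE (negPf ntx).
  rewrite -(cfResE _ sMG Mx) defR cfunE cfunE cfun1E Mx mulr1 [X in _ + X]cfunE reg0.
  by rewrite mulr0 addr0.
rewrite cfdotC -cfdot_Res_l cfdotBr -irr0 -/a0 (resC i i0) // -/a.
by rewrite conj_intr // rpredB ?Zr.
Qed.

(** The virtual character [alpha] has norm [#|N : M| + 1], and its coefficient at a non-exceptional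
    ['chi_j] is ['chi_j x]. The trivial character contributes 1 to the norm and the exceptional ones
    at least 1. *)
Lemma exc_column x : x \in M^# ->
  \sum_(j | (j \notin exc_set) && (j != 0)) `|'chi[G]_j x| ^+ 2 <= #|N : M|%:R - 1.
Proof.
move=> Mx.
have [a0 /imsetP[k Tk _]] := exc_set_gt0; have /imsetP[i nz_i defk] := Tk.
have Ci : 'chi[M]_i 1%g = 1 by rewrite lin_char1 //; apply/char_abelianP.
pose alpha := 'Ind[G] (1 - 'chi[M]_i).
have defalpha : alpha = 'Ind[G] ('Ind[N] (1 : 'CF(M)) - 'chi_k).
  by rewrite /alpha -(cfIndInd _ sNG sMN) raddfB /= defk exc_upE.
have onM : 'Ind[N] (1 : 'CF(M)) - 'chi_k \in 'CF(N, M^#).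
  apply/cfun_onP=> y; rewrite !inE negb_and negbK !cfunE.
  case/orP=> [/eqP-> | nMy].
    by rewrite cfInd1 // cfun11 mulr1 exc_ker1 // subrr.
  rewrite defk exc_upE // !(cfun_on0 (cfInd_normal _ nsMN)) //.
  by rewrite subrr.
have norm_alpha : '[alpha] = #|N : M|%:R + 1.
  rewrite defalpha TI_Ind_isometry // cfnormB cfnorm_Ind_cfun1 // cfnorm_irr exc_ker_Ind1 //.
  by rewrite conjC0 addr0 subr0.
rewrite lerBrDl -(lerD2r 1) -norm_alpha cfdot_sum_irr.
have Sc j : j \notin exc_set -> `|'chi_j x| ^+ 2 = '[alpha, 'chi_j] * '[alpha, 'chi_j]^*.
  move=> nSj; have [c Zc [valc dotc]] := nonexc_val nSj.
  by rewrite (valc x Mx) /alpha dotc // normCK.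
have Zalpha j : '[alpha, 'chi_j] \is a Num.int.
  by rewrite Cint_cfdot_vchar_irr // cfInd_vchar // rpredB ?irr_vchar // -irr0 irr_vchar.
have dot0 : '[alpha, 'chi_0] = 1.
  rewrite irr0 -Frobenius_reciprocity cfRes_cfun1 cfdotBl cfnorm1 -irr0 cfdot_irr.
  by rewrite (negPf nz_i) subr0.
(* Up to sign [exc_dif k (conjC_Iirr k)] is [alpha] minus its conjugate, so ['chi_(exc k)] or its
   conjugate occurs in [alpha]. *)
have [b Sb nzb] : exists2 b, b \in exc_set & '[alpha, 'chi_b] != 0.
  have [neqk Dk] := excP Tk; set a := exc k in neqk Dk.
  have Sa : a \in exc_set by apply: imset_f.
  have [za | nza] := eqVneq '[alpha, 'chi_a] 0; last by exists a.
  exists (conjC_Iirr a); first exact: exc_set_conj.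
  rewrite conjC_IirrE cfdot_conjCr conjC_eq0 /alpha cfAutInd raddfB /= rmorph1.
  apply: contra_neq (oner_neq0 algC) => za'.
  have <- : '[exc_dif k (conjC_Iirr k), 'chi_a] = 1.
    by rewrite Dk cfdotBl !cfdot_irr eqxx (negPf neqk) subr0.
  rewrite exc_difE conjC_IirrE defk exc_upE // cfAutInd !cfIndInd //.
  move/eqP: za za'; rewrite /alpha !raddfB /= !cfdotBl subr_eq0 => /eqP-> /eqP.
  by move/eqP.
rewrite [X in _ <= X](bigD1 0) //= dot0 conjC1 mulr1 -addrA lerD2l.
rewrite [X in _ <= X](bigID (mem exc_set)) /= addrC.
rewrite lerD //; last first.
  rewrite le_eqVlt; apply/orP; left; apply/eqP.
  by apply: eq_big => [j|j /andP[nSj _]]; [rewrite andbC | rewrite Sc].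
rewrite (bigD1 b) /=; last by rewrite Sb exc_set_neq0.
rewrite -[1]addr0 lerD // -?normCK.
  by rewrite exprn_ege1 // norm_intr_ge1.
by rewrite sumr_ge0 // => j _; rewrite -normCK exprn_ge0.
Qed.

End ExceptionalCharacters.

End Exceptional.

(** * The order is even *)

Section OddOrder.

Import GroupScope Order.TTheory GRing.Theory Num.Theory.
Local Open Scope ring_scope.

(* For an index [i] standing for a centralizer [M]: [m = #|M|], [p = #|'N(M) : M|], [n] is the number
   of conjugates of elements of [M^#], [w = (m - 1) / p], [s] is the number of exceptional characters
   of [M], and [E i k] says that these do not vanish on the class of [k]. The row inequality fails for
   an [i] with [p i] minimal and then [w i] maximal. *)
Lemma odd_class_numbers (T : finType) (R : {set T}) (m p n w s : T -> nat)
    (E : rel T) g i0 :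
    i0 \in R -> (0 < g)%N ->
    {in R, forall i, n i * (p i * m i) = (m i).-1 * g}%N ->
    {in R, forall i, (1 < p i)%N /\ (1 < w i)%N} ->
    {in R, forall i, m i = (w i * p i).+1} ->
    {in R, forall i, (s i <= w i)%N} ->
    {in R &, injective m} ->
    {in R &, forall i k, i != k -> E i k || E k i} ->
    {in R, forall k, #|[set i in R | (i != k) && E i k]|.*2 <= (p k).-1}%N ->
    {in R, forall i, s i * (\sum_(k in R | (k != i) && E i k) n k).+1
                     + n i * (m i - p i) <= s i * g}%N ->
    (\sum_(k in R) n k).+1 = g -> False.
Proof.
move=> Ri0 g_gt0 nE gt1 mE sw m_inj tour col row tot.
have [i1 Ri1 min1] : exists2 i, i \in R & {in R, forall k, p i <= p k}%N.
  by case: (arg_minnP p Ri0) => i Ri mini; exists i.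
pose R1 := [set k in R | p k == p i1].
have [i [Ri mini maxi]] : exists i, [/\ i \in R, {in R, forall k, p i <= p k}%N
                          & {in R, forall k, p k = p i -> w k <= w i}%N].
  have R1i1 : i1 \in R1 by rewrite inE Ri1 eqxx.
  have [i R1i maxi] := arg_maxnP w R1i1.
  have {R1i}/setIdP[Ri /eqP pi] : i \in R1 by [].
  exists i; split=> //; first by move=> k; rewrite pi; apply: min1.
  by move=> k Rk; rewrite pi => pk; apply: maxi; apply/setIdP; rewrite pk.
set O := (\sum_(k in R | (k != i) && E i k) n k)%N.
set I := (\sum_(k in R | (k != i) && ~~ E i k) n k)%N.
have totE : g = (n i + O + I).+1.
  rewrite -tot (bigD1 i) //= (bigID (E i)) /= addnA; congr (_ + _ + _).+1;
    by apply: eq_bigl => k; rewrite andbA.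
have [p_gt1 w_gt1] := gt1 i Ri; have sw_i := sw i Ri.
(* By [tour], every [k] counted in [I] satisfies [E k i], so by [col] there are at most half of
   [p i - 1] of them, each with [P * n k <= g]. The row inequality at [i] then yields the bound. *)
have bound P : {in R, forall k, k != i -> P <= p k}%N -> (2 * P * (w i - 1) <= p i * w i + 1)%N.
  move=> minP.
  have card_I : (#|[set k in R | (k != i) && ~~ E i k]|.*2 <= (p i).-1)%N.
    apply: leq_trans (col i Ri); rewrite leq_double subset_leq_card //.
    apply/subsetP=> k; rewrite !inE => /and3P[Rk neqki nE_ik]; rewrite Rk neqki /=.
    by have := tour _ _ Rk Ri neqki; rewrite (negPf nE_ik) orbF.
  have PI : (P * I <= #|[set k in R | (k != i) && ~~ E i k]| * g)%N.
    rewrite -sum_nat_const big_distrr /= [X in (_ <= X)%N](eq_bigl (fun k => (k \in R) && ((k != i) && ~~ E i k))).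
      apply: leq_sum => k /and3P[Rk neqki _].
      have [pk_gt1 wk_gt1] := gt1 k Rk.
      have mk := mE k Rk; have := nE k Rk; have := minP k Rk neqki.
      rewrite mk /= => lePp eqn.
      have m_gt0 : (0 < (w k * p k).+1)%N by [].
      rewrite -(leq_pmul2r m_gt0); nia.
    by move=> k; rewrite inE.
  have row_i := row i Ri; rewrite -/O in row_i.
  have nm : (n i * m i = w i * g)%N.
    have := nE i Ri; rewrite (mE i Ri) /=.
    have p_gt0 : (0 < p i)%N by lia.
    by move=> h; apply/eqP; rewrite -(eqn_pmul2r p_gt0); apply/eqP; nia.
  have le1 : (n i * (m i - p i) <= w i * (n i + I))%N by nia.
  have mi := mE i Ri.
  have eqpw : (m i - p i = (p i - 1) * (w i - 1) + w i)%N.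
    rewrite mi; case: (p i) (w i) p_gt1 w_gt1 => [|p'] [|w'] // _ _.
    by rewrite !subSS !subn0 mulSn mulnS; lia.
  have le2 : (n i * ((p i - 1) * (w i - 1)) <= w i * I)%N.
    by move: le1; rewrite eqpw; set A := ((_ - 1) * _)%N; lia.
  have le3 : (2 * P * I <= (p i - 1) * g)%N.
    have := leq_mul card_I (leqnn g); rewrite -muln2 -subn1 => leIg.
    apply: leq_trans leIg; rewrite [X in (_ <= X)%N]mulnAC -mulnA mulnC leq_mul2r.
    by rewrite PI orbT.
  have p1_gt0 : (0 < p i - 1)%N by rewrite subn_gt0.
  have wg_gt0 : (0 < w i * g)%N by rewrite muln_gt0 g_gt0 (ltnW w_gt1).
  suff : (2 * P * (w i - 1) * ((p i - 1) * (w i * g)) <= (p i * w i + 1) * ((p i - 1) * (w i * g)))%N.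
    by rewrite leq_pmul2r // muln_gt0 p1_gt0.
  set a := (w i - 1)%N in le2 *; set b := (p i - 1)%N in le2 le3 *.
  have le4 : (2 * P * (n i * (b * a)) <= w i * (b * g))%N.
    apply: leq_trans (leq_mul (leqnn (w i)) le3).
    by rewrite [X in (_ <= X)%N]mulnCA leq_mul2l le2 orbT.
  have le5 := leq_mul (leqnn (m i)) le4.
  have -> : (2 * P * a * (b * (w i * g)) = m i * (2 * P * (n i * (b * a))))%N.
    by rewrite -nm; ring.
  apply: leq_trans le5 _; rewrite mi addn1 (mulnC (p i)) leq_mul2l; apply/orP; right.
  by rewrite mulnCA.
(* Taking [P = p i] forces [w i = 2]. Another [k] with [p k = p i] would have [w k = 2] by
   maximality and thus the same [m]; so [P = p i + 1] is also allowed, and it gives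
   [2 * p i + 2 <= 2 * p i + 1]. *)
have w2 : w i = 2%N.
  have := bound (p i) (fun k Rk _ => mini k Rk); nia.
have := bound (p i).+1 _; rewrite w2; move=> /(_ _)/wrap[]; last by lia.
move=> k Rk neqki; rewrite ltn_neqAle mini // andbT; apply: contra neqki => /eqP pk.
apply/eqP/m_inj => //; rewrite (mE k Rk) (mE i Ri) -pk w2.
suff -> : w k = 2%N by [].
have := maxi k Rk (esym pk); have [_] := gt1 k Rk; rewrite w2; lia.
Qed.

Lemma odd_sum_conjC_irr_even gT (G : {group gT}) (F : Iirr G -> algC) :
    odd #|G| -> (forall i, i != 0 -> F i \is a Num.int) ->
    (forall i, F (conjC_Iirr i) = F i) ->
  exists z : int, \sum_(i | i != 0) F i = (z + z)%:~R.
Proof.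
move=> oddG ZF Fconj.
pose h (i : Iirr G) := (i < conjC_Iirr i)%N.
have /intrP[z defz] : \sum_(i | (i != 0) && h i) F i \is a Num.int.
  by apply: rpred_sum => i /andP[nz_i _]; apply: ZF.
exists z; rewrite (bigID h) /= rmorphD /= -defz; congr (_ + _).
rewrite (reindex_inj (can_inj (@conjC_IirrK _ G))) /=.
apply: eq_big => [i | i _]; last exact: Fconj.
rewrite conjC_Iirr_eq0; apply: andb_id2l => nz_i.
rewrite /h conjC_IirrK -leqNgt ltn_neqAle andb_idl // => _.
by rewrite eq_sym (inj_eq val_inj) odd_conjC_Iirr_neq.
Qed.

(** * Character tables of groups of odd order with abelian centralizers *)

Section OddCA.

Variables (gT : finGroupType) (G : {group gT}).
Hypothesis abC : forall x, (x \in G -> x != 1 -> abelian 'C_G[x])%g.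
Hypothesis prN : forall x, (x \in G -> x != 1 -> prime #|'N_G('C_G[x]) : 'C_G[x]|)%g.
Hypotheses (oddG : odd #|G|) (ntG : G :!=: 1%g).

Local Notation R := (maxab_reps G).
Local Notation cov M := (class_cover G M).
Local Notation exc M := (exc_set G M).

Let maxab_R M : M \in R -> M \in maxab G.
Proof. by apply/subsetP/maxab_repsW. Qed.

Let point (M : {group gT}) : gT := repr M^#.

Let pointP M : M \in R -> point M \in M^#.
Proof.
move/maxab_R/(maxab_neq1)=> /trivgPn[x Mx ntx].
by apply: (mem_repr x); rewrite !inE ntx.
Qed.

Let point_cov M : M \in R -> point M \in cov M.
Proof. by move=> RM; apply: mem_class_support; apply: pointP. Qed.

Let TI M (RM : M \in R) := maxab_TI abC (maxab_R RM).
Let Frob M (RM : M \in R) := maxab_Frobenius abC prN (maxab_R RM).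
Let abM M (RM : M \in R) := maxab_abelian abC (maxab_R RM).

(** ['chi_a] minus its conjugate would vanish outside each of two disjoint covers, so ['chi_a] would
    be real. *)
Lemma exc_set_disjoint M L a :
  M \in R -> L \in R -> M != L -> a \in exc M -> a \notin exc L.
Proof.
move=> RM RL neqML aM; apply/negP=> aL.
have onM := exc_set_on (TI RM) (Frob RM) (abM RM) oddG aM.
have onL := exc_set_on (TI RL) (Frob RL) (abM RL) oddG aL.
have: 'chi_a - 'chi_(conjC_Iirr a) = 0.
  apply/cfunP=> x; rewrite [RHS]cfunE.
  have [xM | nxM] := boolP (x \in cov M); last exact: (cfun_on0 onM nxM).
  apply: (cfun_on0 onL); apply: contra neqML => xL.
  by apply/eqP; apply: (class_cover_inj abC RM RL xM xL).
move/eqP; rewrite subr_eq0 => /eqP/irr_inj/eqP.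
rewrite eq_sym (negPf (odd_conjC_Iirr_neq oddG _)) //.
exact: (exc_set_neq0 (TI RM) (Frob RM) (abM RM) oddG aM).
Qed.

Lemma nonexc_cov M a x :
    M \in R -> a \notin exc M -> x \in cov M ->
  'chi_a x = 'chi_a (point M) /\ 'chi_a x \is a Num.int.
Proof.
move=> RM aM /imset2P[y g My Gg ->]; rewrite cfunJ //.
have [c Zc [val _]] := nonexc_val (TI RM) (Frob RM) (abM RM) oddG aM.
by rewrite !val ?pointP.
Qed.

(** For distinct representatives, [exc_set_val] shows that either all exceptional characters of [M]
    vanish on the cover of [L] or none does. *)
Definition exc_adj (M L : {group gT}) := [exists a in exc M, 'chi_a (point L) != 0].

Lemma exc_adjP M L a x :
    M \in R -> L \in R -> M != L -> exc_adj M L -> a \in exc M -> x \in cov L ->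
  1 <= `|'chi_a x| ^+ 2.
Proof.
move=> RM RL neqML /exists_inP[b Mb nzb] Ma Lx.
have nLa := exc_set_disjoint RM RL neqML Ma.
have [-> Za] := nonexc_cov RL nLa Lx.
have cM'y : point L \notin cov M.
  apply: contra neqML => /(class_cover_inj abC RM RL) -> //.
  exact: point_cov.
rewrite exprn_ege1 // norm_intr_ge1 //.
have := exc_set_val (TI RM) (Frob RM) (abM RM) oddG Ma Mb cM'y.
by case=> ->; rewrite ?conjC_eq0.
Qed.

(** If neither relation holds, every product [F a] is an integer, and conjugate characters give
    equal products. The second orthogonality relation between the two classes then says that 1 plus
    an even integer is 0. *)
Lemma exc_adj_total M L :
  M \in R -> L \in R -> M != L -> exc_adj M L || exc_adj L M.
Proof.
move=> RM RL neqML; apply: contraT; rewrite negb_or => /andP[nML nLM].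
have z_ML a : a \in exc M -> 'chi_a (point L) = 0.
  by move=> Ma; apply: contraNeq nML => nz; apply/exists_inP; exists a.
have z_LM a : a \in exc L -> 'chi_a (point M) = 0.
  by move=> La; apply: contraNeq nLM => nz; apply/exists_inP; exists a.
pose F a := 'chi[G]_a (point M) * ('chi_a (point L))^*.
have GL : point L \in G.
  by have /setD1P[_ /(subsetP (maxab_sub (maxab_R RL)))] := pointP RL.
have ZF a : F a \is a Num.int.
  rewrite /F; have [Ma | nMa] := boolP (a \in exc M).
    by rewrite z_ML // conjC0 mulr0 rpred0.
  have [La | nLa] := boolP (a \in exc L); first by rewrite z_LM // mul0r rpred0.
  have [_ ZM] := nonexc_cov RM nMa (point_cov RM).
  have [_ ZL] := nonexc_cov RL nLa (point_cov RL).
  by rewrite conj_intr // rpredM.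
have Fconj a : F (conjC_Iirr a) = F a.
  by rewrite /F conjC_IirrE !cfConjCE -rmorphM /= conj_intr // ZF.
have [z sumF] := odd_sum_conjC_irr_even oddG (fun i _ => ZF i) Fconj.
have := second_orthogonality_relation (point M) GL.
rewrite (bigD1 0) //= irr0 !cfun1E GL.
have GM : point M \in G.
  by have /setD1P[_ /(subsetP (maxab_sub (maxab_R RM)))] := pointP RM.
rewrite GM conjC1 mulr1 sumF (_ : _ \in _ = false).
  move/eqP; rewrite mulr0n -[true%:R]/((1 : int)%:~R) -intrD intr_eq0; lia.
apply: contraNF neqML => /imsetP[g Gg defM]; apply/eqP.
apply: (class_cover_inj abC RM RL (point_cov RM)).
by rewrite defM; apply: memJ_class_support => //; apply: pointP.
Qed.

(** Each such [M] contributes at least 2 to the column bound of [L]: an exceptional character and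
    its conjugate, both of absolute value at least 1 there. *)
Lemma exc_adj_column L : L \in R ->
  (#|[set M in R | (M != L) && exc_adj M L]|.*2 <= #|'N_G(L) : L|.-1)%N.
Proof.
move=> RL; set I := [set M in R | _]; set x := point L.
have pr_p : prime #|'N_G(L) : L| := maxab_prime prN (maxab_R RL).
have col := exc_column (TI RL) (Frob RL) (abM RL) oddG (pointP RL).
pose F a := `|'chi[G]_a x| ^+ 2.
have F_ge0 a : 0 <= F a by rewrite exprn_ge0.
rewrite -(ler_nat algC) -muln2 -subn1 natrB ?prime_gt0 //.
apply: le_trans col; rewrite -/x.
have le1 : (#|I| * 2)%:R <= \sum_(M in I) \sum_(a in exc M) F a.
  rewrite natrM mulr_natl -sumr_const; apply: ler_sum => M /setIdP[RM /andP[neqML adjML]].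
  have [a Ma] := exc_set_gt0 (Frob RM) (abM RM).
  have Mca := exc_set_conj (TI RM) (Frob RM) (abM RM) oddG Ma.
  have neq_a : conjC_Iirr a != a.
    exact: odd_conjC_Iirr_neq (exc_set_neq0 (TI RM) (Frob RM) (abM RM) oddG Ma).
  rewrite (bigD1 a) //= (bigD1 (conjC_Iirr a)) /=; last by rewrite Mca.
  rewrite addrA -[2]addr0 lerD ?sumr_ge0 // (_ : 2 = 1 + 1) //.
  by rewrite lerD // (exc_adjP RM RL neqML adjML) ?point_cov.
apply: le_trans le1 _; rewrite (exchange_big_dep predT) //= [X in _ <= X]big_mkcond.
apply: ler_sum => a _ /=.
have [M /andP[/setIdP[RM /andP[neqML adjML]] Ma] | noM] := pickP [pred M in I | a \in exc M].
  rewrite (bigD1 M) /=; last by rewrite !inE RM neqML adjML.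
  rewrite big1 ?addr0.
    rewrite (exc_set_disjoint RM RL neqML Ma).
    by rewrite (exc_set_neq0 (TI RM) (Frob RM) (abM RM) oddG Ma).
  move=> M' /andP[/andP[/setIdP[RM' _] M'a] neqM'].
  by rewrite (negPf (exc_set_disjoint RM' RM neqM' M'a)) in Ma.
rewrite big_pred0; last by move=> M; apply: noM.
by case: ifP => _; rewrite ?F_ge0.
Qed.

(** The sum over [G] of the squared absolute values of the exceptional characters of [M] is
    [#|exc M| * #|G|]. At 1 and at each element of an adjacent cover they contribute at least
    [#|exc M|]; at each element of the cover of [M], at least [#|M|] less 1 for the trivial
    character and less the bound of [exc_column]. *)
Lemma exc_adj_row M : M \in R ->
  (#|exc M| * (\sum_(L in R | (L != M) && exc_adj M L) #|cov L|).+1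
    + #|cov M| * (#|M| - #|'N_G(M) : M|) <= #|exc M| * #|G|)%N.
Proof.
move=> RM; set s := #|exc M|; set d := (#|M| - _)%N.
pose f x := \sum_(a in exc M) `|'chi[G]_a x| ^+ 2.
have f_ge0 x : 0 <= f x by apply: sumr_ge0 => a _; rewrite exprn_ge0.
have sum_f : \sum_(x in G) f x = (s * #|G|)%:R.
  rewrite exchange_big /= natrM mulr_natl -sumr_const; apply: eq_bigr => a _.
  have := cfnorm_irr a; rewrite cfdotE => /(canRL (mulVKf (neq0CG G))).
  rewrite mulr1 => <-.
  by apply: eq_bigr => x _; rewrite normCK.
have covM x : x \in cov M -> d%:R <= f x.
  move=> /imset2P[y g My Gg ->]; rewrite /f.
  rewrite (eq_bigr (fun a => `|'chi[G]_a y| ^+ 2)) => [|a _]; last by rewrite cfunJ.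
  have col := exc_column (TI RM) (Frob RM) (abM RM) oddG My.
  have [nty My'] := setD1P My; have Gy := subsetP (maxab_sub (maxab_R RM)) y My'.
  have := second_orthogonality_relation y Gy.
  rewrite (maxab_cent abC (maxab_R RM) My' nty) class_refl mulr1n.
  rewrite (bigD1 0) //= irr0 cfun1E Gy conjC1 mulr1 (bigID (mem (exc M))) /=.
  rewrite (eq_bigl (fun a => a \in exc M)) => [|a]; last first.
    by apply/andb_idl => Ma; apply: (exc_set_neq0 (TI RM) (Frob RM) (abM RM) oddG Ma).
  rewrite (eq_bigr (fun a => `|'chi_a y| ^+ 2)) => [|a _]; last by rewrite normCK.
  rewrite [X in _ + (_ + X)](eq_bigl (fun a => (a \notin exc M) && (a != 0))) => [|a]; last by rewrite andbC.
  rewrite [X in _ + (_ + X)](eq_bigr (fun a => `|'chi_a y| ^+ 2)) => [defM|a _]; last by rewrite normCK.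
  rewrite /d natrB; last first.
    have := Frobenius_ker_dvd_ker1 (Frob RM); have := maxab_gt1 (maxab_R RM).
    by case: #|M| => [|[|m]] //= _ dv_m; apply: leqW; apply: dvdn_leq dv_m.
  rewrite -defM lerBlDl addrCA [X in _ <= X]addrC lerD2l addrC.
  by rewrite -lerBrDr.
have le_sum c (A : {set gT}) : (forall x, x \in A -> c%:R <= f x) -> (c * #|A|)%:R <= \sum_(x in A) f x.
  by move=> lef; rewrite mulnC natrM mulr_natl -sumr_const; apply: ler_sum.
rewrite -(ler_nat algC) -sum_f (big_setD1 1%g) ?group1 //= (big_class_cover abC).
rewrite [X in _ + X](bigD1 M) //= natrD mulnS natrD -addrA lerD //.
  rewrite -[s]mul1n /s -sum1_card natrM mul1r natr_sum; apply: ler_sum => a _.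
  have /natrP[[|n] chi1] := Cnat_irr1 a; first by have := irr1_gt0 a; rewrite chi1 ltxx.
  by rewrite chi1 exprn_ege1 // ger0_norm ?ler0n // ler1n.
rewrite addrC lerD //; first by rewrite mulnC; apply: le_sum => x; apply: covM.
rewrite [X in _ <= X](bigID (exc_adj M)) /= -[X in X <= _]addr0.
rewrite lerD //; last by apply: sumr_ge0 => L _; apply: sumr_ge0.
rewrite big_distrr natr_sum /=.
rewrite [X in X <= _](eq_bigl (fun L => (L \in R) && (L != M) && exc_adj M L)).
  apply: ler_sum => L /andP[/andP[RL neqLM] adjML]; apply: le_sum => x Lx.
  rewrite -[s]mul1n /s -sum1_card natrM mul1r natr_sum; apply: ler_sum => a Ma.
  by apply: (exc_adjP RM RL _ adjML Ma Lx); rewrite eq_sym.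
by move=> L; rewrite andbA.
Qed.

Lemma odd_CA_trivial : False.
Proof.
have [x Gx ntx] := trivgPn _ ntG.
have [M0 RM0 _] := class_coverP Gx ntx.
pose p (M : {group gT}) := #|'N_G(M) : M|.
have p_dv M : M \in R -> (p M %| #|M|.-1)%N by move=> RM; apply: Frobenius_ker_dvd_ker1 (Frob RM).
have mE M : M \in R -> #|M| = (#|M|.-1 %/ p M * p M).+1.
  by move=> RM; rewrite divnK ?p_dv // prednK.
have p_gt1 M : M \in R -> (1 < p M)%N by move=> RM; apply: prime_gt1 (maxab_prime prN (maxab_R RM)).
have oddp M : M \in R -> odd (p M).
  move=> RM; apply: dvdn_odd oddG; apply: dvdn_trans (dvdn_indexg _ _) _.
  by rewrite cardSg ?subsetIl.
apply: (@odd_class_numbers _ R (fun M => #|M|) p (fun M => #|cov M|)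
   (fun M => #|M|.-1 %/ p M)%N (fun M => #|exc M|) exc_adj #|G| M0) => //=.
- by move=> M RM; rewrite (card_class_cover abC) ?maxab_R.
- move=> M RM; split; first exact: p_gt1.
  have := mE M RM; have := maxab_gt1 (maxab_R RM).
  have : odd #|M| := oddSg (maxab_sub (maxab_R RM)) oddG.
  have := oddp M RM.
  (* A quotient 0 would make [M] trivial, and a quotient 1 would give it the even order
     [p M + 1]. *)
  case: (_ %/ _)%N => [|[|w]] //; first by move=> _ _; case: #|M| => [|[]].
  by rewrite mul1n => oddpM + _ => /[swap] ->; rewrite /= oddpM.
- by move=> M RM; rewrite leq_divRL ?(ltnW (p_gt1 M RM)) //; apply: (card_exc_set (Frob RM) (abM RM)).
- move=> M L RM RL eqML; apply/eqP; apply: contraTT (maxab_gt1 (maxab_R RM)) => neqML.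
  have := maxab_reps_coprime abC RM RL neqML; rewrite eqML /coprime gcdnn => /eqP->.
  by [].
- by move=> M L RM RL; apply: exc_adj_total.
- exact: exc_adj_column.
- exact: exc_adj_row.
exact: sum_class_cover.
Qed.

End OddCA.

End OddOrder.

(** * Counting involutions *)

Section Numbers.

Local Open Scope nat_scope.

(* For an index [i] standing for a centralizer [M]: [m = #|M|], [p = #|'N(M) : M|] and [n] is the
   number of conjugates of elements of [M^#]; [i1] is the class of the centralizers of involutions, [j]
   the index of their normalizers, and the last hypothesis counts the pairs of non-commuting
   involutions. *)
Lemma even_class_numbers (T : finType) (R : {set T}) (m p n : T -> nat) g j i1 ia
    (P := p i1) :
    i1 \in R -> ia \in R -> 0 < g ->
    {in R, forall i, n i * (p i * m i) = (m i).-1 * g} ->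
    {in R, forall i, 1 < m i} -> {in R, forall i, m i %| g} ->
    (\sum_(i in R) n i).+1 = g ->
    prime P -> odd P -> p ia = 2 -> P %| m ia -> P.+1 %| m i1 -> coprime (m i1) P ->
    {in R, forall i, p i = 2 -> odd (m i)} ->
    j * (P * m i1) = g ->
    2 * P * (j - 1) = m i1 * \sum_(i in R | p i == 2) (m i).-1 ->
  m i1 = P.+1 /\ j = P.+2.
Proof.
move=> R1 Ra g_gt0 nE m_gt1 m_dv tot prP oddP pa2 P_dv_a P_dv_1 coP odd2 jE cnt.
have P3 : 3 <= P by move: (prime_gt1 prP) oddP; case: (P) => [|[|[|]]].
pose x i := g %/ m i.
have xE i : i \in R -> x i * m i = g by move=> Ri; rewrite divnK ?m_dv.
have pn i : i \in R -> p i * n i + x i = g.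
  move=> Ri; have m1 := m_gt1 i Ri; have h := nE i Ri; have hx := xE i Ri.
  have mi_gt0 : 0 < m i by apply: ltn_trans m1.
  apply/eqP; rewrite -(eqn_pmul2r mi_gt0) mulnDl hx mulnAC mulnC.
  by rewrite h -mulSnr prednK // mulnC.
have neq1a : i1 != ia by apply: contraTneq oddP; rewrite /P => ->; rewrite pa2.
set S := \sum_(i in R | p i == 2) (m i).-1 in cnt.
have P_dv_S : P %| S.
  rewrite -(Gauss_dvdr _ (_ : coprime P (m i1))) 1?coprime_sym //.
  by rewrite -cnt mulnAC dvdn_mull.
have S1 : S = (m ia).-1 + \sum_(i in R | (p i == 2) && (i != ia)) (m i).-1.
  rewrite /S (bigD1 ia) /= ?Ra ?pa2 //; congr (_ + _).
  by apply: eq_bigl => i; rewrite andbA.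
(* Were [ia] the only index with [p = 2], then [P] would divide both [m ia] and [m ia - 1]. *)
have [ib /and3P[Rb /eqP pb2 neqba] | no_b] := pickP [pred i in R | (p i == 2) && (i != ia)]; last first.
  suff: P %| 1 by rewrite dvdn1 => /eqP P1; move: P3; rewrite P1.
  have : P %| (m ia).-1 by move: P_dv_S; rewrite S1 (eq_bigl _ _ no_b) big_pred0 ?addn0.
  have := P_dv_a; rewrite -{1}(prednK (ltnW (m_gt1 ia Ra))) -addn1.
  by move=> h1 h2; move: h1; rewrite dvdn_addr // dvdn1 => /eqP ->.
have neq1b : i1 != ib by apply: contraTneq oddP; rewrite /P => ->; rewrite pb2.
have pn1 := pn i1 R1; have pna := pn ia Ra; have pnb := pn ib Rb.
rewrite pa2 in pna; rewrite pb2 in pnb; rewrite -/P in pn1.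
have xE1 := xE i1 R1; have xEa := xE ia Ra; have xEb := xE ib Rb.
have odd_a := odd2 ia Ra pa2; have odd_b := odd2 ib Rb pb2.
have sum_le (A : {set T}) : A \subset R -> (\sum_(i in A) n i).+1 <= g.
  by move=> sAR; rewrite -tot ltnS [X in _ <= X](big_setID A) /= (setIidPr sAR) leq_addr.
(* An index with [p = 2] has [m >= 3], hence [n >= g / 3]; three of them would exceed the total. *)
have only_b : \sum_(i in R | (p i == 2) && (i != ia)) (m i).-1 = (m ib).-1.
  rewrite (bigD1 ib) ?Rb ?pb2 //= big_pred0 ?addn0 // => ic.
  apply/negP=> /andP[/and3P[Rc /eqP pc2 neqca] neqcb].
  have pnc := pn ic Rc; rewrite pc2 in pnc; have xEc := xE ic Rc.
  have : (\sum_(i in [set ia; ib; ic]) n i).+1 <= g.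
    by apply: sum_le; apply/subsetP=> i; rewrite !inE -orbA => /or3P[] /eqP->.
  rewrite setUC big_setU1 ?inE ?negb_or ?neqca //= big_setU1 ?inE 1?eq_sym //= big_set1.
  have odd_c := odd2 ic Rc pc2.
  have le3 y i : i \in R -> odd (m i) -> x i * m i = g -> y = x i -> 3 * y <= g.
    move=> Ri oddi <- ->; rewrite mulnC leq_mul2l; apply/orP; right.
    by have := m_gt1 i Ri; move: oddi; case: (m i) => [|[|[|]]].
  have h1 := le3 _ _ Ra odd_a xEa erefl; have h2 := le3 _ _ Rb odd_b xEb erefl.
  have h3 := le3 _ _ Rc odd_c xEc erefl => h.
  by clear -h h1 h2 h3 pna pnb pnc g_gt0; lia.
rewrite only_b in S1.
have b_gt1 := m_gt1 ib Rb; have a_gt1 := m_gt1 ia Ra.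
have b_ge3 : 3 <= m ib by move: odd_b b_gt1; case: (m ib) => [|[|[|]]].
have [k bE] : exists k, m ib = (k * P).+2.
  have /dvdnP[k kE] : P %| m ib - 2.
    by rewrite -(dvdn_addr _ P_dv_a) (_ : m ia + _ = S) // S1; clear -a_gt1 b_ge3; lia.
  by exists k; clear -kE b_ge3; lia.
have odd_k : odd k by move: odd_b; rewrite bE /= negbK oddM => /andP[].
have [l aE] := dvdnP P_dv_a.
have odd_l : odd l by move: odd_a; rewrite aE oddM => /andP[].
have [c m1E] := dvdnP P_dv_1.
have c_gt0 : 0 < c by case: (c) m1E (m_gt1 i1 R1) => // ->.
have tot3 : n i1 + n ia + n ib + 1 <= g.
  have : (\sum_(i in [set i1; ia; ib]) n i).+1 <= g.
    by apply: sum_le; apply/subsetP=> i; rewrite !inE -orbA => /or3P[] /eqP->.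
  rewrite setUC big_setU1 ?inE ?negb_or ?(eq_sym ib) ?neq1b ?(eq_sym ia ib) ?neqba //=.
  by rewrite big_setU1 ?inE //= big_set1 => h; clear -h; lia.
(* This is the class equation restricted to the three known indices, multiplied by [2 * P], with
   each [n] expressed through [x = g / m]. *)
have ineq : 2 * g + 2 * P <= 2 * x i1 + P * x ia + P * x ib.
  have h : 2 * P * (n i1 + n ia + n ib + 1) <= 2 * P * g by rewrite leq_mul2l tot3 orbT.
  have e2 : P * (2 * n ia + x ia) = P * g by rewrite pna.
  have e3 : P * (2 * n ib + x ib) = P * g by rewrite pnb.
  by clear -h e2 e3 pn1; lia.
have Pxb : P * x ib + 2 * x ib <= g.
  rewrite -xEb bE -mulnDl mulnC leq_mul2l addn2 !ltnS leq_pmull ?orbT //.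
  by case: (k) odd_k.
have x1le : P * x i1 + x i1 <= g.
  by rewrite -mulSnr -[X in _ <= X]xE1 m1E mulnC leq_mul2l leq_pmull ?orbT.
have x14 : 4 * x i1 <= g.
  by apply: leq_trans x1le; rewrite -mulSnr leq_mul2r ltnS P3 orbT.
(* The inequality now forces [m ia = P], [m i1 = P + 1] and [m ib = P + 2]: with q = P + 1, these
   are the orders q - 1, q and q + 1 of the centralizers in SL(2,q). *)
have l1 : l = 1.
  apply/eqP; apply: contraT => neql1; have l3 : 3 <= l by case: (l) odd_l neql1 => [|[|[|]]].
  have : 3 * (P * x ia) <= g.
    by rewrite -xEa aE [X in _ <= X]mulnC -mulnA leq_mul2r l3 orbT.
  by move=> h; clear -h ineq Pxb x14 g_gt0; lia.
have Pxa : P * x ia = g by rewrite -xEa aE l1 mul1n mulnC.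
have hP : P * (g + 2 * P) <= P * (2 * x i1 + P * x ib) by rewrite leq_mul2l; apply/orP; right; clear -ineq Pxa; lia.
have c1 : c = 1.
  apply/eqP; apply: contraT => neqc1; have c2 : 2 <= c by case: (c) c_gt0 neqc1 => [|[|]].
  have : 2 * (P * x i1 + x i1) <= g.
    by rewrite -mulSnr -[X in _ <= X]xE1 m1E [X in _ <= X]mulnC -mulnA leq_mul2r c2 orbT.
  have h1 := leq_mul (leqnn P) Pxb => h2; clear -h1 h2 hP ineq Pxa g_gt0 P3; lia.
have k1 : k = 1.
  apply/eqP; apply: contraT => neqk1; have k3 : 3 <= k by case: (k) odd_k neqk1 => [|[|[|]]].
  have h3 : 3 * (P * x ib) + 2 * x ib <= g.
    have h := leq_mul k3 (leqnn (P * x ib)); move: xEb; rewrite bE.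
    by clear -h; lia.
  have eq1 : P * x i1 + x i1 = g by rewrite -mulSnr -[RHS]xE1 m1E c1 mul1n mulnC.
  have h4 := leq_mul (leqnn P) h3; have h5 := leq_mul P3 (leqnn g).
  clear -h4 h5 h3 eq1 hP ineq Pxa P3 g_gt0; lia.
split; first by rewrite m1E c1 mul1n.
move: cnt; rewrite S1 m1E c1 bE aE l1 k1 !mul1n /= => cnt.
have P_gt0 : 0 < 2 * P by clear -P3; lia.
have : 2 * P * (j - 1) == 2 * P * P.+1 by apply/eqP; clear -cnt P3; lia.
by rewrite eqn_pmul2l // => /eqP h; clear -h; lia.
Qed.

End Numbers.

Section Involutions.

Variable gT : finGroupType.
Implicit Types t u x : gT.

Lemma invol_mul t : t ^+ 2 = 1 -> t * t = 1.
Proof. by rewrite expgS expg1. Qed.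

Lemma invol_inv t : t ^+ 2 = 1 -> t^-1 = t.
Proof. by move/invol_mul=> t2; apply/eqP; rewrite eq_invg_mul t2. Qed.

Lemma invol_mulJ t u : t ^+ 2 = 1 -> u ^+ 2 = 1 -> (t * u) ^ t = (t * u)^-1.
Proof.
by move=> t2 u2; rewrite conjgE invMg !invol_inv // !mulgA (invol_mul t2) mul1g.
Qed.

Lemma invol_mulJr t u : t ^+ 2 = 1 -> u ^+ 2 = 1 -> (u * t) ^ t = (u * t)^-1.
Proof.
by move=> t2 u2; rewrite conjgE invMg !invol_inv // -!mulgA (invol_mul t2) mulg1.
Qed.

Lemma invol_odd_conj t u :
  t ^+ 2 = 1 -> u ^+ 2 = 1 -> odd #[t * u] -> exists k, u = t ^ ((t * u) ^+ k).
Proof.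
(* The exponent is half of [#[x] + 1], so that [x ^+ j] is a square root of [x]. *)
move=> t2 u2 odd_tu; set x := t * u; exists (#[x]./2).+1; set j := _.+1.
have xj2 : x ^+ j * x ^+ j = x.
  rewrite -expgD (_ : (j + j = #[x].+1)%N) ?expgS ?expg_order ?mulg1 //.
  by rewrite -[in RHS](odd_double_half #[x]) odd_tu /j; lia.
have: t * (x ^+ j) * t = (x ^+ j)^-1.
  by rewrite -expgVn -invol_mulJ // -conjXg conjgE invol_inv // mulgA.
rewrite conjgE => <-; rewrite -!mulgA (mulgA t t) (invol_mul t2) mul1g xj2.
by rewrite /x mulgA (invol_mul t2) mul1g.
Qed.

(** The product [x * x ^ t] is fixed by [t]. *)
Lemma card_conj_invol t (M : {group gT}) :
    t ^+ 2 = 1 -> t \in 'N(M) -> abelian M -> 'C_M[t] = 1 ->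
  {in M, forall x, x ^ t = x^-1}.
Proof.
move=> t2 nMt abM cMt x Mx.
have Mxt : x ^ t \in M by rewrite memJ_norm.
suff : x * x ^ t \in 'C_M[t] by rewrite cMt => /set1P/eqP; rewrite -eq_invg_mul => /eqP.
rewrite inE groupM //; apply/cent1P; apply/commgP; apply/conjg_fixP.
by rewrite conjMg -conjgM (invol_mul t2) conjg1 (centsP abM).
Qed.

End Involutions.

(** * Involutions in simple groups with abelian centralizers *)

Section EvenCA.

Variables (gT : finGroupType) (G : {group gT}).
Hypothesis abC : forall x, x \in G -> x != 1 -> abelian 'C_G[x].
Hypothesis prN : forall x, x \in G -> x != 1 -> prime #|'N_G('C_G[x]) : 'C_G[x]|.
Hypotheses (simG : simple G) (nabG : ~~ abelian G).

Definition invols : {set gT} := [set x in G | #[x] == 2].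

Lemma invols_sub x : x \in invols -> x \in G.
Proof. by case/setIdP. Qed.

Lemma invols_neq1 x : x \in invols -> x != 1.
Proof. by case/setIdP=> _ /eqP ox; rewrite -order_gt1 ox. Qed.

Lemma invols_sqr x : x \in invols -> x ^+ 2 = 1.
Proof. by case/setIdP=> _ /eqP <-; apply: expg_order. Qed.

Lemma mem_invols x : x \in G -> x != 1 -> x ^+ 2 = 1 -> x \in invols.
Proof.
move=> Gx ntx x2; rewrite inE Gx; apply/eqP/nt_prime_order => //.
Qed.

Lemma involsJ x g : g \in G -> (x ^ g \in invols) = (x \in invols).
Proof. by move=> Gg; rewrite !inE groupJr // orderJ. Qed.

(** If [t * u] has odd order, [t] and [u] are conjugate. Otherwise some power of [t * u] is an
    involution, and its abelian centralizer contains both. *)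
Lemma invols_nconj_commute t u :
  t \in invols -> u \in invols -> u \notin t ^: G -> commute t u.
Proof.
move=> It Iu not_tu; have [Gt Gu] := (invols_sub It, invols_sub Iu).
have [t2 u2] := (invols_sqr It, invols_sqr Iu).
have [odd_tu | even_tu] := boolP (odd #[t * u]).
  have [k defu] := invol_odd_conj t2 u2 odd_tu.
  by case/negP: not_tu; rewrite defu memJ_class // groupX ?groupM.
set x := t * u in even_tu; pose z := x ^+ (#[x]./2).
have even_x : (#[x] = #[x]./2.*2)%N by rewrite even_halfK.
have Gz : z \in G by rewrite groupX ?groupM.
have z2 : z ^+ 2 = 1 by rewrite -expgM muln2 -even_x expg_order.
have ntz : z != 1.
  rewrite -order_dvdn; apply: contraL (order_gt0 x) => /dvdn_leq le_x.
  by move: even_x le_x; case: #[x]./2 => [->|n] // -> /(_ isT); lia.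
have czt : t \in 'C_G[z].
  rewrite inE Gt cent1C; apply/cent1P/commgP/conjg_fixP.
  by rewrite conjXg invol_mulJ // expgVn invol_inv.
have czx : x \in 'C_G[z].
  rewrite inE groupM //; apply/cent1P; exact: commuteX.
have czu : u \in 'C_G[z].
  by have := groupM czt czx; rewrite /x mulgA (invol_mul t2) mul1g.
exact: (centsP (abC Gz ntz)).
Qed.

(** If [u] were not conjugate to [t], it would commute with the whole class of [t], which generates
    the simple group [G]. *)
Lemma invols_conj t u : t \in invols -> u \in invols -> u \in t ^: G.
Proof.
move=> It Iu; apply/contraT => not_tu; have [Gt Gu] := (invols_sub It, invols_sub Iu).
have sTC : t ^: G \subset 'C_G[u].
  apply/subsetP=> _ /imsetP[g Gg ->]; rewrite inE groupJ //; apply/cent1P.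
  apply: invols_nconj_commute; rewrite ?involsJ //.
  by apply: contra not_tu => /imsetP[h Gh ->]; rewrite -conjgM memJ_class ?groupM.
have nsT : <<t ^: G>> <| G.
  rewrite /normal gen_subG class_subG // norms_gen //.
  exact: class_norm.
have [_ /(_ _ nsT)[T1 | TG]] := simpleP _ simG.
  have := invols_neq1 It; rewrite -in_set1 -[[set 1]]T1 mem_gen //.
  by rewrite class_refl.
case/negP: nabG; apply: abelianS (abC Gu (invols_neq1 Iu)).
by move: sTC; rewrite -gen_subG [<<_>>]TG.
Qed.

Section InvolutionCentralizer.

Variable t0 : gT.
Hypothesis It0 : t0 \in invols.

Local Notation M := 'C_G[t0].
Local Notation B := 'N_G('C_G[t0]).
Local Notation p := #|'N_G('C_G[t0]) : 'C_G[t0]|.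

Let Gt0 : t0 \in G. Proof. exact: invols_sub. Qed.
Let Mt0 : t0 \in M. Proof. by rewrite inE Gt0 cent1id. Qed.
Let hM : 'C_G[t0]%G \in maxab G. Proof. by rewrite cent_maxab ?invols_neq1. Qed.
Let pr_p : prime p. Proof. exact: (maxab_prime prN hM). Qed.
Let sMG : M \subset G. Proof. exact: subsetIl. Qed.
Let sBG : B \subset G. Proof. exact: subsetIl. Qed.
Let nsMB : M <| B. Proof. exact: normalSG. Qed.
Let sMB : M \subset B. Proof. exact: normal_sub. Qed.
Let abM : abelian M. Proof. exact: (maxab_abelian abC hM). Qed.

Lemma card_invols : (#|invols| * #|M| = #|G|)%N.
Proof.
have -> : invols = t0 ^: G.
  apply/setP=> x; apply/idP/imsetP=> [/(invols_conj It0)/imsetP // | [g Gg ->]].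
  by rewrite involsJ.
by rewrite -index_cent1 mulnC Lagrange.
Qed.

Lemma invols_centE : invols :&: M = t0 ^: B.
Proof.
apply/setP=> x; apply/setIP/imsetP=> [[Ix Mx] | [g /setIP[Gg nMg] ->]]; last first.
  by rewrite involsJ // memJ_norm.
have /imsetP[g Gg defx] := invols_conj It0 Ix; exists g => //.
have ntx := invols_neq1 Ix.
rewrite inE Gg inE /= -{2}(maxab_cent abC hM Mx ntx) defx.
by rewrite conjIg conjGid // cent1J.
Qed.

Lemma card_invols_cent : #|invols :&: M| = p.
Proof.
rewrite invols_centE -index_cent1; congr #|_ : _|.
by rewrite -setIA (setIC 'N(_)) setIA; apply/setIidPl; apply: subset_trans (normG _).
Qed.

Lemma even_cent : ~~ odd #|M|.
Proof.
rewrite -dvdn2 -(_ : #[t0] = 2) ?order_dvdG //.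
by have /setIdP[_ /eqP] := It0.
Qed.

Lemma coprime_cent_index : coprime #|M| p.
Proof.
apply: coprime_dvdr (Frobenius_ker_dvd_ker1 (maxab_Frobenius abC prN hM)) _.
by rewrite coprimenP.
Qed.

Lemma odd_index : odd p.
Proof.
have [p2|//] := even_prime pr_p.
by have := coprime_cent_index; rewrite p2 coprimen2 (negPf even_cent).
Qed.

(** In the abelian group [M] the [p] involutions and 1 form a subgroup; it shows that [p + 1]
    divides [#|M|]. *)
Lemma invols_cent_group :
  exists2 Q : {group gT}, Q \subset M & #|Q| = p.+1 /\ {in Q, forall x, x ^+ 2 = 1}.
Proof.
pose Q := [set x in M | x ^+ 2 == 1].
have gQ : group_set Q.
  apply/group_setP; split=> [|x y /setIdP[Mx /eqP x2] /setIdP[My /eqP y2]].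
    by rewrite inE group1 expg1n /=.
  rewrite inE groupM // expgMn ?x2 ?y2 ?mulg1 ?eqxx //.
  exact: (centsP abM).
exists (Group gQ); first by apply/subsetP=> x /setIdP[].
split=> [|x /setIdP[_ /eqP] //].
rewrite /= -card_invols_cent (cardsD1 1) inE group1 expg1n eqxx add1n; congr _.+1.
apply: eq_card => x; apply/setD1P/setIP=> [[ntx /setIdP[Mx /eqP x2]]|[Ix Mx]].
  by split=> //; apply: mem_invols => //; apply: (subsetP sMG).
split; first exact: invols_neq1.
by rewrite inE Mx invols_sqr /=.
Qed.

Lemma norm_cent_coprime x : x \in B -> coprime #[x] p -> x \in M.
Proof.
move=> Bx cop; have nMx : x \in 'N(M) by case/setIP: Bx.
apply: coset_idr => //; apply/eqP; rewrite -order_eq1 -dvdn1 -(eqnP cop) dvdn_gcd.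
rewrite morph_order //= -card_quotient ?normal_norm // order_dvdG //.
by rewrite mem_quotient.
Qed.

Lemma invols_norm : invols :&: B = invols :&: M.
Proof.
apply/setP=> x; apply/setIP/setIP=> [[Ix Bx] | [Ix /(subsetP sMB)Bx]] //; split=> //.
apply: norm_cent_coprime => //.
by have /setIdP[_ /eqP->] := Ix; rewrite coprime2n; apply: odd_index.
Qed.

Section OutsideInvolution.

Variable t : gT.
Hypotheses (It : t \in invols) (nBt : t \notin B).

Let Gt : t \in G. Proof. exact: invols_sub. Qed.
Let tK x : (x ^ t) ^ t = x.
Proof. by rewrite -conjgM invol_mul ?conjg1 ?invols_sqr. Qed.

(** An element of [M] that [t] conjugates into [B] is conjugated into [M], since its order is prime
    to [p]; if it is not 1, then [t] normalizes [M]. *)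
Lemma norm_centI_TI : (B :&: B :^ t) :&: M = 1.
Proof.
apply/trivgP/subsetP=> y /setIP[/setIP[_ Bty] My]; apply: contraR nBt => nty.
have Byt : y ^ t \in B by move: Bty; rewrite mem_conjg invol_inv ?invols_sqr.
have Myt : y ^ t \in M.
  apply: norm_cent_coprime => //; rewrite orderJ.
  exact: coprime_dvdl (order_dvdG My) coprime_cent_index.
have Mty : y \in M :^ t by rewrite -(tK y) memJ_conjg.
rewrite inE Gt inE /=.
have {}nty : y != 1 by rewrite inE in nty.
by have := maxab_conj abC hM hM Gt nty Mty My; move=> /= {1}<-.
Qed.

Lemma card_norm_centI_le : #|B :&: B :^ t| <= p.
Proof.
rewrite -(leq_pmul2r (cardG_gt0 M)) (mulnC p) Lagrange // -TI_cardMg ?norm_centI_TI //.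
by rewrite subset_leq_card // mul_subG // subsetIl.
Qed.

(** [t] inverts [u * t]. With [card_norm_centI_le] this bounds by [p] the number of involutions in
    the coset. *)
Lemma invols_coset_sub : [set u * t | u in invols :&: B :* t] \subset B :&: B :^ t.
Proof.
apply/subsetP=> _ /imsetP[u /setIP[Iu Btu] ->].
have But : u * t \in B.
  by move: Btu; rewrite mem_rcoset invol_inv ?invols_sqr.
have utJ : (u * t) ^ t = (u * t)^-1.
  by rewrite invol_mulJr ?invols_sqr.
by rewrite inE But -[u * t]tK memJ_conjg utJ groupV.
Qed.

Lemma card_invols_coset_le : #|invols :&: B :* t| <= p.
Proof.
rewrite -(card_imset _ (mulIg t)) (leq_trans _ card_norm_centI_le) //.
exact: subset_leq_card invols_coset_sub.
Qed.

Lemma full_coset_inverted :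
    #|invols :&: B :* t| = p ->
  #|B :&: B :^ t| = p /\ {in B :&: B :^ t, forall y, y ^ t = y^-1}.
Proof.
move=> full; have def : [set u * t | u in invols :&: B :* t] = B :&: B :^ t.
  apply/eqP; rewrite eqEcard invols_coset_sub (card_imset _ (mulIg t)) full.
  exact: card_norm_centI_le.
split; first by rewrite -def (card_imset _ (mulIg t)).
rewrite -def => _ /imsetP[u /setIP[Iu _] ->].
by rewrite invol_mulJr ?invols_sqr.
Qed.

End OutsideInvolution.

(** There are [p * #|G : B|] involutions in all and at most [p] in each coset of [B], so every coset
    has exactly [p]. *)
Lemma card_invols_coset g : g \in G -> g \notin B -> #|invols :&: B :* g| = p.
Proof.
move=> Gg nBg.
have le_p C : C \in rcosets B G -> #|invols :&: C| <= p.
  case/rcosetsP=> h Gh ->.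
  have [-> | [t /setIP[It Bht]]] := set_0Vmem (invols :&: B :* h); first by rewrite cards0.
  have eqC : B :* h = B :* t by apply/esym/rcoset_eqP.
  rewrite eqC; have [Bt | nBt] := boolP (t \in B); last exact: card_invols_coset_le.
  by rewrite rcoset_id // invols_norm card_invols_cent.
have RB : B :* 1 \in rcosets B G by apply/rcosetsP; exists 1.
have RBg : B :* g \in rcosets B G by apply/rcosetsP; exists g.
have neqBg : B :* g != B :* 1.
  by rewrite mulg1; apply: contra nBg => /eqP <-; apply: rcoset_refl.
have sumI : (\sum_(C in rcosets B G) #|invols :&: C|)%N = (\sum_(C in rcosets B G) p)%N.
  transitivity #|invols|; last first.
    rewrite sum_nat_const -[#|rcosets _ _|]/#|G : B|; apply/eqP.
    rewrite -(eqn_pmul2r (cardG_gt0 M)) card_invols -mulnA (mulnC p) Lagrange //.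
    by rewrite mulnC Lagrange.
  rewrite -[RHS]sum1_card.
  have -> : (\sum_(x in invols) 1 = \sum_(x in G | x \in invols) 1)%N.
    by apply: eq_bigl => x; rewrite andb_idl // => /invols_sub.
  rewrite [RHS](set_partition_big_cond _ (rcosets_partition sBG)) /=.
  by apply: eq_bigr => C _; rewrite -sum1_card; apply: eq_bigl => x; rewrite inE andbC.
apply/eqP; rewrite eqn_leq le_p //= leqNgt; apply/negP=> ltp.
move/eqP: sumI; rewrite (bigD1 (B :* g)) //= [X in _ == X](bigD1 (B :* g)) //=.
rewrite ltn_eqF // -addSn leq_add //; apply: leq_sum => C /andP[RC _].
exact: le_p.
Qed.

Lemma exists_inverting_invol :
  exists2 t, t \in invols :\: B &
    #|B :&: B :^ t| = p /\ {in B :&: B :^ t, forall y, y ^ t = y^-1}.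
Proof.
have [g Gg nBg] : exists2 g, g \in G & g \notin B.
  apply/subsetPn; apply/negP=> sGB.
  have nsMG : M <| G by rewrite /normal sMG (subset_trans sGB) ?subsetIr.
  have [_ /(_ _ nsMG)[M1 | MG]] := simpleP _ simG.
    by move: Mt0; rewrite M1 inE (negPf (invols_neq1 It0)).
  by case/negP: nabG; rewrite -MG.
have pB := card_invols_coset Gg nBg.
have /card_gt0P[t /setIP[It Bgt]] : 0 < #|invols :&: B :* g| by rewrite pB prime_gt0.
have eqB : B :* g = B :* t by apply/esym/rcoset_eqP.
have nBt : t \notin B.
  by apply: contra nBg => Bt; rewrite -(rcoset_id Bt) -eqB rcoset_refl.
exists t; first by rewrite inE nBt.
by apply: full_coset_inverted => //; rewrite -eqB.
Qed.

End InvolutionCentralizer.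

Lemma maxab_indexJ (L : {group gT}) g :
  g \in G -> #|'N_G(L :^ g) : L :^ g| = #|'N_G(L) : L|.
Proof. by move=> Gg; rewrite normJ -{1}(conjGid Gg) -conjIg indexJg. Qed.

Lemma maxab_index2 (L : {group gT}) t :
  L \in maxab G -> t \in invols -> t \in 'N(L) -> t \notin L -> #|'N_G(L) : L| = 2.
Proof.
move=> hL It nLt nLt'; have pr := maxab_prime prN hL.
have o2 : #[coset L t] = 2.
  apply: nt_prime_order => //; first by rewrite -morphX // invols_sqr ?morph1.
  by apply: contra nLt' => /eqP/(coset_idr nLt).
apply/esym/eqP; rewrite -dvdn_prime2 // -o2 -card_quotient; last first.
  by rewrite subIset // subxx orbT.
by rewrite order_dvdG // mem_quotient // inE invols_sub.
Qed.

Lemma maxab_index2_odd (L : {group gT}) :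
  L \in maxab G -> #|'N_G(L) : L| = 2 -> odd #|L|.
Proof.
move=> hL iL; have := Frobenius_ker_dvd_ker1 (maxab_Frobenius abC prN hL).
by rewrite iL dvdn2 -{2}(prednK (cardG_gt0 L)).
Qed.

(** [s ^+ 2] lies in [L]; if it were not 1, its centralizer [L] would contain [s]. For the same
    reason [s] fixes no non-trivial element of [L]. *)
Lemma index2_invol (L : {group gT}) s :
    L \in maxab G -> #|'N_G(L) : L| = 2 -> s \in 'N_G(L) :\: L ->
  s \in invols /\ {in L, forall x, x ^ s = x^-1}.
Proof.
move=> hL iL /setDP[/setIP[Gs nLs] nLs'].
have Ls2 : s ^+ 2 \in L.
  apply: coset_idr; first by rewrite groupX.
  have : #[coset L s] %| 2.
    by rewrite -iL -card_quotient ?subsetIr // order_dvdG // mem_quotient // in_setI Gs.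
  by rewrite morphX // order_dvdn => /eqP.
have s2 : s ^+ 2 = 1.
  apply: contraNeq nLs' => nts2; rewrite -(maxab_cent abC hL Ls2 nts2) inE Gs.
  by apply/cent1P; apply: commuteX.
split.
  by apply: mem_invols => //; apply: contraNneq nLs' => ->.
apply: card_conj_invol => //; first exact: (maxab_abelian abC hL).
apply/trivgP/subsetP=> x /setIP[Lx csx]; apply: contraR nLs'.
by rewrite inE => ntx; rewrite -(maxab_cent abC hL Lx ntx) inE Gs cent1C.
Qed.

Definition inverters (x : gT) : {set gT} := [set t in invols | x ^ t == x^-1].

(** An involution inverting [x] normalizes [L] and lies outside it, so the index is 2; conversely
    every element of the other coset is an inverting involution. *)
Lemma card_inverters (L : {group gT}) x :
    L \in maxab G -> x \in L^# -> x ^+ 2 != 1 ->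
  #|inverters x| = if #|'N_G(L) : L| == 2 then #|L| else 0.
Proof.
move=> hL /setD1P[ntx Lx] x2; have sLG := maxab_sub hL.
have inN t : t \in inverters x -> t \in 'N_G(L) :\: L.
  case/setIdP=> It /eqP xt; have Gt := invols_sub It.
  rewrite !inE Gt; apply/andP; split.
    apply: contra x2 => Lt; rewrite expgS expg1 -eq_invg_mul -xt.
    by rewrite conjgE (centsP (maxab_abelian abC hL) x Lx t Lt) mulKg.
  have Lxt : x ^ t \in L by rewrite xt groupV.
  have ntxt : x ^ t != 1 by rewrite conjg_eq1.
  have Ltxt : x ^ t \in L :^ t by rewrite memJ_conjg.
  by have := maxab_conj abC hL hL Gt ntxt Ltxt Lxt; move=> /= {2}->.
case: eqP => [iL | niL]; last first.
  apply/eqP; rewrite cards_eq0; apply/eqP/setP=> t; rewrite [RHS]inE.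
  apply/negP=> xt; apply: niL; have /setDP[/setIP[_ nLt] nLt'] := inN t xt.
  by apply: (@maxab_index2 L t) => //; case/setIdP: xt.
have -> : inverters x = 'N_G(L) :\: L.
  apply/setP=> t; apply/idP/idP=> [/inN // | Nt].
  by have [It xt] := index2_invol hL iL Nt; rewrite inE It xt ?eqxx.
rewrite cardsD (setIidPr (normal_sub (normalSG sLG))).
rewrite -(Lagrange (normal_sub (normalSG sLG))) iL muln2 -addnn addnK //.
Qed.

(** The elements inverted by [t] are the products [t * u] with [u ^+ 2 = 1], and such a product has
    square 1 exactly when [u] commutes with [t]. *)
Lemma card_class_inverters t : t \in invols ->
  #|[set x in G | (x ^+ 2 != 1) && (t \in inverters x)]| + #|invols :&: 'C_G[t]| = #|invols|.
Proof.
move=> It; have [Gt t2] := (invols_sub It, invols_sqr It).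
have -> : [set x in G | (x ^+ 2 != 1) && (t \in inverters x)]
        = [set t * u | u in invols :\: 'C_G[t]].
  apply/setP=> x; apply/setIdP/imsetP=> [[Gx /andP[x2 /setIdP[_ /eqP xt]]] | [u Iu' ->]].
    have xt' : t * (x * t) = x^-1 by rewrite -xt conjgE invol_inv.
    have tx2 : (t * x) ^+ 2 = 1.
      by rewrite expgS expg1 !mulgA -(mulgA t x t) xt' mulVg.
    exists (t * x); last by rewrite mulgA invol_mul ?mul1g.
    have cxt : t * x \in 'C_G[t] -> x ^+ 2 = 1.
      case/setIP=> _ /cent1P; rewrite /commute -mulgA => /mulgI ctx.
      have xV : x = x^-1 by rewrite -xt' ctx mulgA invol_mul ?mul1g.
      by rewrite expgS expg1 {2}xV mulgV.
    rewrite in_setD; apply/andP; split; first by apply: contra x2 => /cxt->.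
    apply: mem_invols => //; first exact: groupM.
    by apply: contraNneq x2 => tx1; rewrite cxt ?tx1 ?group1.
  have [Iu ncu] := setDP Iu'; have [Gu u2] := (invols_sub Iu, invols_sqr Iu).
  rewrite groupM //; split=> //; rewrite inE It invol_mulJ // eqxx !andbT.
  apply: contra ncu; rewrite expgS expg1 -eq_invg_mul invMg !invol_inv //.
  by move/eqP=> ctu; rewrite inE Gu; apply/cent1P.
rewrite (card_imset _ (mulgI t)) cardsD addnC subnKC //.
  by rewrite subset_leq_card // subsetIl.
Qed.

Lemma sum_inverters :
  \sum_(x in G^# | x ^+ 2 != 1) #|inverters x|
    = \sum_(L in maxab_reps G | #|'N_G(L) : L| == 2) #|class_cover G L| * #|L|.
Proof.
rewrite big_mkcondr /= (big_class_cover abC) /= [RHS]big_mkcondr /=.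
apply: eq_bigr => L RL; have hL := subsetP (maxab_repsW G) L RL.
transitivity (\sum_(x in class_cover G L) (if #|'N_G(L) : L| == 2 then #|L| else 0)).
  apply: eq_bigr => _ /imset2P[y g /setD1P[nty Ly] Gg ->].
  have Lyg : y ^ g \in (L :^ g)^# by rewrite !inE conjg_eq1 nty memJ_conjg.
  have := card_inverters (maxabJ hL Gg) Lyg; rewrite maxab_indexJ //= cardJg.
  have [y2 _ | _ ->//] := eqVneq ((y ^ g) ^+ 2) 1.
  case: eqP => // iL; have := maxab_index2_odd hL iL.
  rewrite -(cardJg L g) => /(dvdn_odd (order_dvdG (subsetP (subsetDl _ _) _ Lyg))).
  rewrite (nt_prime_order _ y2) // conjg_eq1 //.
by rewrite sum_nat_const; case: ifP; rewrite ?muln0.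
Qed.

Section EvenStructure.

Variable t0 : gT.
Hypothesis It0 : t0 \in invols.
Local Notation M := 'C_G[t0].
Local Notation B := 'N_G('C_G[t0]).
Local Notation p := #|'N_G('C_G[t0]) : 'C_G[t0]|.

Lemma card_noncommuting_invols :
  (#|invols| * (#|invols| - p)
    = \sum_(L in maxab_reps G | #|'N_G(L) : L| == 2) #|class_cover G L| * #|L|)%N.
Proof.
rewrite -sum_inverters.
transitivity (\sum_(x in G^# | x ^+ 2 != 1) \sum_(t in invols) (t \in inverters x : nat)).
  rewrite exchange_big /= -sum_nat_const; apply: eq_bigr => t It.
  rewrite -(card_class_inverters It).
  have -> : #|invols :&: 'C_G[t]| = p.
    rewrite card_invols_cent //; have /imsetP[g Gg ->] := invols_conj It0 It.
    by rewrite -(maxab_indexJ [group of M] Gg) conjIg conjGid // cent1J.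
  rewrite addnK -sum1_card big_mkcond [RHS]big_mkcond; apply: eq_bigr => x _ /=.
  rewrite !inE; have [-> | ntx] := eqVneq x 1; first by rewrite expg1n eqxx andbF.
  by case: (x \in G); case: (_ != 1); case: (t \in _).
apply: eq_bigr => x _; rewrite -sum1_card big_mkcond [RHS]big_mkcond.
by apply: eq_bigr => t _; rewrite [t \in inverters x]inE; case: (t \in invols); case: eqP.
Qed.

Lemma even_numbers : #|M| = p.+1 /\ #|G : B| = p.+2.
Proof.
have Gt0 := invols_sub It0; have nt0 := invols_neq1 It0.
have hM : 'C_G[t0]%G \in maxab G by rewrite cent_maxab.
have pr_p : prime p := maxab_prime prN hM.
have [t /setDP[It nBt] [cardD invD]] := exists_inverting_invol It0.
set D := _ :&: _ in cardD invD.
have [y Dy nty] : exists2 y, y \in D & y != 1.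
  by apply/trivgPn; rewrite -cardG_gt1 cardD prime_gt1.
have Gy : y \in G by case/setIP: Dy => /setIP[].
have abD : abelian D by apply: cyclic_abelian; apply: prime_cyclic; rewrite cardD.
have sDA : D \subset 'C_G[y].
  by rewrite subsetI sub_cent1 (subsetP abD) // !subIset ?subxx.
have hA : 'C_G[y]%G \in maxab G by rewrite cent_maxab.
have Gt := invols_sub It.
(* The centralizer of [y] serves as the index [ia]: it contains [D], of order [p], and [t]
   normalizes it without lying in it because it inverts [y], of odd order. *)
have iA : #|'N_G('C_G[y]) : 'C_G[y]| = 2.
  apply: (maxab_index2 hA It).
    by rewrite inE conjIg conjGid // -cent1J invD // -cent_cycle cycleV cent_cycle.
  apply: contra nty => /setIP[_ /cent1P cyt].
  have yV : y = y^-1 by rewrite -invD // conjgE -cyt mulKg.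
  have y2 : #[y] %| 2 by rewrite order_dvdn expgS expg1 {2}yV mulgV.
  have odd_y : odd #[y] by apply: dvdn_odd (order_dvdG Dy) _; rewrite cardD odd_index.
  rewrite -order_eq1 -dvdn1 -(eqnP (_ : coprime 2 #[y])) ?coprime2n //.
  by rewrite dvdn_gcd y2 dvdnn.
have [g1 Gg1 R1] := maxab_repsP hM; have [g2 Gg2 R2] := maxab_repsP hA.
have RW L : L \in maxab_reps G -> L \in maxab G := subsetP (maxab_repsW G) L.
have [Q sQM [cardQ _]] := invols_cent_group It0.
have := @even_class_numbers _ (maxab_reps G) (fun L => #|L|) (fun L => #|'N_G(L) : L|)
  (fun L => #|class_cover G L|) #|G| #|G : B| _ _ R1 R2.
rewrite /= !maxab_indexJ // !cardJg; apply=> //.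
- by move=> L RL; apply: (card_class_cover abC); apply: RW.
- by move=> L RL; apply: (maxab_gt1 (RW L RL)).
- by move=> L RL; rewrite cardSg ?maxab_sub ?RW.
- exact: sum_class_cover.
- exact: odd_index.
- by rewrite -cardD cardSg.
- by rewrite -cardQ cardSg.
- exact: coprime_cent_index.
- by move=> L RL /(maxab_index2_odd (RW L RL)).
- rewrite [(p * _)%N]mulnC Lagrange ?(normal_sub (normalSG _)) ?subsetIl //.
  by rewrite mulnC Lagrange ?subsetIl.
have I_gt0 : 0 < #|invols| by apply/card_gt0P; exists t0.
have IE : (#|invols| = p * #|G : B|)%N.
  apply/eqP; rewrite -(eqn_pmul2r (cardG_gt0 M)) card_invols // mulnAC (mulnC p) Lagrange; last first.
    by rewrite (normal_sub (normalSG _)) ?subsetIl.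
  by rewrite Lagrange ?subsetIl.
have dbl : (2 * (#|invols| * (#|invols| - p))
    = \sum_(L in maxab_reps G | #|'N_G(L) : L| == 2) #|L|.-1 * #|G|)%N.
  rewrite card_noncommuting_invols big_distrr; apply: eq_bigr => L /andP[RL /eqP iL] /=.
  by rewrite -(card_class_cover abC (RW L RL)) iL mulnCA.
(* Multiplication by [#|invols|] replaces [#|M|] by [#|G|], and the equation becomes twice
   [card_noncommuting_invols]. *)
apply/eqP; rewrite -(eqn_pmul2l I_gt0); apply/eqP.
rewrite [RHS]mulnA card_invols // big_distrr /= -(eq_bigr _ (fun _ _ => mulnC _ _)) -dbl.
have -> : (#|invols| - p = p * (#|G : B| - 1))%N by rewrite IE mulnBr muln1.
by rewrite [RHS]mulnCA !mulnA.
Qed.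

End EvenStructure.

End EvenCA.

(** * The projective line *)

Section ProjectiveLine.

Import GRing.Theory.

Lemma finField_of_ops (T : finType) (zero one : T) (opp inv : T -> T) (add mul : T -> T -> T) :
  associative add -> commutative add -> left_id zero add -> left_inverse zero opp add ->
  associative mul -> commutative mul -> left_id one mul -> left_distributive mul add ->
  one != zero -> (forall a, a != zero -> mul (inv a) a = one) -> inv zero = zero ->
  exists F : finFieldType, exists f : F -> T,
    [/\ bijective f, f 0%R = zero, f 1%R = one, {morph f : a b / (a + b)%R >-> add a b}
      & {morph f : a b / (a * b)%R >-> mul a b}].
Proof.
move=> addA addC add0 addN mulA mulC mul1 mulDl nz mulV inv0.
pose zM := GRing.isZmodule.Build T addA addC add0 addN.
pose Z : zmodType := HB.pack T zM.
pose rM := GRing.Zmodule_isComNzRing.Build Z mulA mulC mul1 mulDl nz.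
pose R : comNzRingType := HB.pack T zM rM.
pose fM := GRing.ComNzRing_isField.Build R mulV inv0.
pose F : fieldType := HB.pack T zM rM fM.
pose FF : finFieldType := HB.pack T zM rM fM.
exists FF, id; split=> //.
by exists id.
Qed.

(** Conjugations by powers of [y] commute and are transitive on the non-trivial elements of [S], so
    each is determined by the image of [s0]. They become the multiplications of a field with
    additive group [S] and unit [s0]. *)
Lemma regular_cycle_field gT (S : {group gT}) y s0 :
    abelian S -> y \in 'N(S) -> s0 \in S -> s0 != 1 ->
    (forall s, s \in S -> s != 1 -> exists i, s = s0 ^ (y ^+ i)) ->
  exists F : finFieldType, exists f : F -> gT, exists z : F,
    [/\ injective f, (forall s, s \in S -> exists a, s = f a),
        (forall a, f a \in S) /\ f 1%R = s0,
        {morph f : a b / (a + b)%R >-> a * b}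
      & [/\ forall a, f (z * a)%R = f a ^ y, z != 0%R & forall a, a != 0%R -> exists i, a = (z ^+ i)%R]].
Proof.
move=> abS nSy Ss0 nts0 regS.
have nSyi i : y ^+ i \in 'N(S) by rewrite groupX.
pose T := subg_of S.
have lgP (a : T) : exists i, (a != 1) ==> (sgval a == s0 ^ (y ^+ i)).
  have [-> | nta] := eqVneq a 1; first by exists 0.
  have [|i ->] := regS (sgval a) (subgP a); last by exists i => /=.
  by rewrite -(inj_eq (@subg_inj _ S)) in nta.
(* A logarithm to the base [s0]; its value at 1, the zero of the field, is arbitrary, hence the case
   distinctions in [mul] and [inv]. *)
pose lg a := xchoose (lgP a).
have lgE a : a != 1 -> sgval a = s0 ^ (y ^+ lg a).
  by move=> nta; have /implyP/(_ nta)/eqP := xchooseP (lgP a).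
have actC i j x : (x ^ (y ^+ i)) ^ (y ^+ j) = (x ^ (y ^+ j)) ^ (y ^+ i).
  by rewrite -!conjgM -!expgD addnC.
have actE i j x : x \in S -> s0 ^ (y ^+ i) = s0 ^ (y ^+ j) -> x ^ (y ^+ i) = x ^ (y ^+ j).
  move=> Sx eq_ij; have [-> | ntx] := eqVneq x 1; first by rewrite !conj1g.
  by have [k ->] := regS x Sx ntx; rewrite actC eq_ij actC.
(* The product is determined by [s0 ^ (y ^+ i) * s = s ^ (y ^+ i)]. *)
pose mul (a b : T) : T := if a == 1 then 1 else subg S (sgval b ^ (y ^+ lg a)).
have mulE a b : a != 1 -> sgval (mul a b) = sgval b ^ (y ^+ lg a).
  by move=> nta; rewrite /mul (negPf nta) subgK // memJ_norm ?subgP.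
have mul1 (b : T) : mul 1 b = 1 by rewrite /mul eqxx.
have mulr1 (a : T) : mul a 1 = 1.
  by apply: val_inj; rewrite /mul; case: eqP => //= _; rewrite conj1g subgK.
have mulC : commutative mul.
  move=> a b; have [-> | nta] := eqVneq a 1; first by rewrite mul1 mulr1.
  have [-> | ntb] := eqVneq b 1; first by rewrite mul1 mulr1.
  by apply: val_inj; rewrite /= !mulE // (lgE a) // (lgE b) // actC.
have mul_eq1 a b : a != 1 -> b != 1 -> mul a b != 1.
  move=> nta ntb; rewrite -(inj_eq val_inj) /= mulE // conjg_eq1.
  by rewrite -(inj_eq val_inj) in ntb.
have mulCA a b c : mul a (mul b c) = mul b (mul a c).
  have [-> | nta] := eqVneq a 1; first by rewrite !mul1 mulr1.
  have [-> | ntb] := eqVneq b 1; first by rewrite !mul1 mulr1.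
  by apply: val_inj; rewrite /= !mulE // actC.
have mulA : associative mul.
  by move=> a b c; rewrite (mulC b) mulCA mulC.
pose one : T := subg S s0.
have ntone : one != 1 by rewrite -(inj_eq val_inj) /= subgK.
have mul1r : left_id one mul.
  move=> b; apply: val_inj; rewrite /= mulE // -[RHS]conjg1 -(expg0 y).
  apply: actE; first exact: subgP.
  by rewrite -lgE // subgK // expg0 conjg1.
have mulDr : right_distributive mul (fun a b => a * b).
  move=> a b c; have [-> | nta] := eqVneq a 1; first by rewrite !mul1 mulg1.
  by apply: val_inj; rewrite /= mulE // conjMg !mulE.
have mulDl : left_distributive mul (fun a b => a * b).
  by move=> a b c; rewrite mulC mulDr !(mulC c).
have addC : commutative (fun a b : T => a * b).
  by move=> a b; apply: val_inj; apply: (centsP abS); apply: subgP.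
pose inv (a : T) : T := if a == 1 then 1 else subg S (s0 ^ (y ^- lg a)).
have mulV a : a != 1 -> mul (inv a) a = one.
  move=> nta; rewrite mulC; apply: val_inj; rewrite /= mulE // /inv (negPf nta).
  rewrite !subgK // ?memJ_norm ?groupV //.
  by rewrite -conjgM mulVg conjg1.
have inv1 : inv 1 = 1 by rewrite /inv eqxx.
have [F [h [bij_h h0 h1 hD hM]]] := finField_of_ops (@mulgA T) addC (@mul1g T) (@mulVg T)
  mulA mulC mul1r mulDl ntone mulV inv1.
have inj_h := bij_inj bij_h; have [h' hK h'K] := bij_h.
have Sz : s0 ^ y \in S by rewrite memJ_norm.
pose z := h' (subg S (s0 ^ y)).
have hz : h z = subg S (s0 ^ y) by rewrite h'K.
have nthz : h z != 1 by rewrite hz -(inj_eq val_inj) /= subgK // conjg_eq1.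
have zE a : sgval (h (z * a)%R) = sgval (h a) ^ y.
  rewrite hM mulE // -(expg1 y); apply: actE; first exact: subgP.
  by rewrite -lgE // hz subgK // expg1.
exists F, (fun a => sgval (h a)), z; split.
- by move=> a b /val_inj/inj_h.
- by move=> s Ss; exists (h' (subg S s)); rewrite h'K subgK.
- by split=> [a|]; [apply: subgP | rewrite h1 subgK].
- by move=> a b; rewrite hD.
split=> //; first by rewrite -(inj_eq inj_h) h0.
have zi i : sgval (h (z ^+ i)%R) = s0 ^ (y ^+ i).
  elim: i => [|i IHi]; first by rewrite expr0 h1 subgK // conjg1.
  by rewrite exprS zE IHi -conjgM -expgSr.
move=> a nza; exists (lg (h a)); apply/inj_h/val_inj; rewrite /= zi -lgE //.
by rewrite -h0 (inj_eq inj_h).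
Qed.

(** * Groups acting on a projective line *)

Section ProjectiveLineModel.

Variables (F : finFieldType) (z : F).

(* [None] is the point at infinity. *)
Definition proj_inv (x : option F) : option F :=
  if x is Some b then if (b == 0)%R then None else Some (b^-1)%R else Some 0%R.

Definition proj_gens : {set {perm option F}} :=
  [set s : {perm option F} |
    [|| [exists a, [forall x, s x == omap (fun b => (b + a)%R) x]],
        [forall x, s x == omap (fun b => (z * b)%R) x]
      | [forall x, s x == proj_inv x]]].

Variables (gT : finGroupType) (G B : {group gT}) (f : F -> gT) (y t : gT).
Hypotheses (sBG : B \subset G) (Gt : t \in G) (tt : t * t = 1) (yt : t * y = y^-1 * t).
Hypotheses (By : y \in B) (Bf : forall a, f a \in B).
Hypothesis fD : {morph f : a b / (a + b)%R >-> a * b}.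
Hypothesis fy : forall a, f (z * a)%R = f a ^ y.
Hypotheses (nzz : z != 0%R) (gen_z : forall a : F, a != 0%R -> exists i, a = (z ^+ i)%R).
Hypothesis covG : forall g, g \in G -> g \in B \/ exists a, g \in B :* (t * f a).
Hypothesis inj_f : forall a b, t * f a \in B :* (t * f b) -> a = b.
Hypothesis out_f : forall a, t * f a \notin B.
Hypothesis fix_t : t * f 1%R * t \in B :* (t * f 1%R).
Hypothesis gen_B : B \subset <<f @: setT :|: [set y]>>.
Hypothesis core_B : forall g, g \in G -> (forall h, h \in G -> h * g \in B :* h) -> g = 1.

(* The projective line is identified with the set of cosets of [B]: [B] itself is the point at
   infinity, and [B :* (t * f a)] is the point [a]. *)
Let pt (x : option F) : gT := if x is Some a then t * f a else 1.

Let ptG x : pt x \in G.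
Proof. by case: x => [a|] /=; rewrite ?groupM ?group1 // (subsetP sBG). Qed.

Let ptP g : g \in G -> exists x, g \in B :* pt x.
Proof.
by case/covG=> [Bg | [a Bg]]; [exists None; rewrite mulg1 | exists (Some a)].
Qed.

Let pt_inj x x' : pt x \in B :* pt x' -> x = x'.
Proof.
case: x x' => [a|] [b|] //=.
- by move/inj_f->.
- by rewrite mulg1 (negPf (out_f a)).
by rewrite mem_rcoset mul1g groupV (negPf (out_f b)).
Qed.

Let idx (g : gT) : option F := odflt None [pick x | g \in B :* pt x].

Let idxP g : g \in G -> g \in B :* pt (idx g).
Proof.
move=> /ptP[x Bx]; rewrite /idx; case: pickP => [//|] /(_ x).
by rewrite Bx.
Qed.

Let idx_eq g x : g \in G -> g \in B :* pt x -> idx g = x.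
Proof.
move=> Gg Bx; apply: pt_inj; have := idxP Gg.
by move/rcoset_eqP=> eqB; rewrite -(rcoset_eqP Bx) eqB rcoset_refl.
Qed.

(** [is_action] asks for injectivity at every element of the ambient group, hence the identity
    outside [G]. *)
Let to x g := if g \in G then idx (pt x * g) else x.

Let toE x g x' : g \in G -> pt x * g \in B :* pt x' -> to x g = x'.
Proof. by move=> Gg Bx; rewrite /to Gg; apply: idx_eq; rewrite ?groupM. Qed.

Let toP x g : g \in G -> pt x * g \in B :* pt (to x g).
Proof. by move=> Gg; rewrite /to Gg; apply: idxP; rewrite groupM. Qed.

Fact proj_is_action : is_action G to.
Proof.
split=> [g x x' | x g h Gg Gh].
  rewrite /to; case: ifP => // Gg eqi; apply: pt_inj.
  have := idxP (groupM (ptG x) Gg); rewrite eqi => /rcoset_eqP Bx.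
  have := idxP (groupM (ptG x') Gg); rewrite -{}Bx mem_rcoset invMg mulgA mulgK.
  by rewrite -groupV invMg invgK -mem_rcoset.
apply: toE; first exact: groupM.
have /rcosetP[b Bb eqb] := toP x Gg; rewrite mulgA eqb -mulgA.
have /rcosetP[c Bc ->] := toP (to x g) Gh.
by rewrite mulgA mem_rcoset mulgK groupM.
Qed.

Let act := Action proj_is_action.
Let phi := [morphism of actperm act].

Let f0 : f 0%R = 1.
Proof. by apply: (mulgI (f 0%R)); rewrite -fD GRing.addr0 mulg1. Qed.

Let to_f a x : to x (f a) = omap (fun b => (b + a)%R) x.
Proof.
apply: toE; first exact: subsetP sBG _ (Bf a).
by case: x => [b|] /=; rewrite ?mulg1 ?mul1g // -mulgA -fD rcoset_refl.
Qed.

Let to_y x : to x y = omap (fun b => (z * b)%R) x.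
Proof.
apply: toE; first exact: subsetP sBG _ By.
case: x => [b|] /=; rewrite ?mulg1 ?mul1g //.
rewrite -mulgA (_ : f b * y = y * f (z * b)%R); last by rewrite fy conjgC.
by rewrite mulgA yt -mulgA mem_rcoset mulgK groupV.
Qed.

Let tyi i : t * y ^+ i = y ^- i * t.
Proof.
elim: i => [|i IHi]; first by rewrite expg0 invg1 mulg1 mul1g.
by rewrite {1}expgSr mulgA IHi -mulgA yt mulgA -invMg -expgS.
Qed.

Let tyNi i : t * y ^- i = y ^+ i * t.
Proof. by apply: (mulIg (y ^+ i)); rewrite mulgKV -mulgA tyi mulgA mulgV mul1g. Qed.

Let fzi i a : f (z ^+ i * a)%R = f a ^ (y ^+ i).
Proof.
elim: i => [|i IHi]; first by rewrite GRing.expr0 GRing.mul1r conjg1.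
by rewrite GRing.exprS -GRing.mulrA fy IHi -conjgM -expgSr.
Qed.

(** With [b = z ^+ i], the element [f b] is the conjugate of [f 1] by [y ^+ i], and [t] inverts [y].
    This reduces the point [b] to the point 1, which [t] fixes by [fix_t]. *)
Let to_t x : to x t = proj_inv x.
Proof.
apply: toE => //; case: x => [b|] /=; last first.
  by rewrite mul1g f0 mulg1 rcoset_refl.
have [-> | nzb] := eqVneq b 0%R; first by rewrite f0 /= mulg1 tt mulg1.
have [i def_b] := gen_z nzb; have Byi : y ^+ i \in B by rewrite groupX.
have -> : f b = y ^- i * f 1%R * y ^+ i.
  by rewrite def_b -(GRing.mulr1 (z ^+ i)%R) fzi conjgE mulgA.
rewrite /pt; have -> : f b^-1%R = y ^+ i * f 1%R * y ^- i.
  have: f 1%R = f b^-1%R ^ (y ^+ i) by rewrite -fzi -def_b GRing.divff.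
  by move->; rewrite conjgE !mulgA mulgV mul1g mulgK.
have tE : t = y ^+ i * t * y ^+ i by rewrite -tyNi mulgKV.
have ytE : y ^+ i * t = t * y ^- i by rewrite {2}tE mulgK.
have [c Bc eqc] := rcosetP fix_t.
have -> : t * (y ^- i * f 1%R * y ^+ i) * t = y ^+ i * (t * f 1%R * t) * y ^- i.
  by rewrite -!mulgA [y ^+ i * t]ytE !mulgA tyNi.
rewrite eqc {1}tE mem_rcoset !invMg !mulgA !invgK.
by rewrite mulgKV !mulgK !groupM.
Qed.

Let ker1 : 'ker phi = 1.
Proof.
apply/trivgP/subsetP=> g kg; have Gg := dom_ker kg; rewrite inE.
have phig : actperm act g = 1 by apply: mker.
apply/eqP/core_B => // h Gh; have [x /rcosetP[b Bb ->]] := ptP Gh.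
have /permP/(_ x) := phig; rewrite actpermE perm1 /= => tox.
have /rcosetP[c Bc eqc] := toP x Gg; rewrite tox in eqc.
by rewrite -mulgA eqc mem_rcoset invMg !mulgA mulgK !groupM ?groupV.
Qed.

Let genG : G :=: <<f @: setT :|: [set y] :|: [set t]>>.
Proof.
apply/eqP; rewrite eqEsubset gen_subG !subUset !sub1set Gt (subsetP sBG) // !andbT.
set H := <<_>>; have sBH : B \subset H by apply: subset_trans gen_B (genS (subsetUl _ _)).
have Ht : t \in H by rewrite mem_gen // !inE eqxx orbT.
apply/andP; split.
  apply/subsetP=> g /covG[/(subsetP sBH)// | [a /rcosetP[b Bb ->]]].
  by rewrite !groupM // ?(subsetP sBH).
by apply/subsetP=> _ /imsetP[a _ ->]; apply: subsetP sBG _ (Bf a).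
Qed.

(** The action on the cosets of [B] is faithful by [core_B], and the generators [f a], [y] and [t]
    act as x + a, z x and 1/x. Two groups with such data over the same [F] and [z] are therefore
    isomorphic. *)
Lemma isog_proj_gens : G \isog <<proj_gens>>.
Proof.
have sX : f @: setT :|: [set y] :|: [set t] \subset G.
  by have := genG; rewrite /= => ->; apply: subset_gen.
suffices <- : phi @* G = <<proj_gens>> by apply: sub_isog => //; rewrite ker1.
have -> : phi @* G = phi @* <<f @: setT :|: [set y] :|: [set t]>> by congr (_ @* _).
rewrite morphim_gen //; congr <<_>>; rewrite morphimEsub //.
have Gf a : f a \in G by apply: subsetP sBG _ (Bf a).
have Gy : y \in G by apply: subsetP sBG _ By.
apply/setP=> s; rewrite inE; apply/imsetP/idP.
  case=> g; rewrite !inE => /orP[/orP[/imsetP[a _ ->] | /eqP->] | /eqP->] ->.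
  - by apply/orP; left; apply/existsP; exists a; apply/forallP=> x; rewrite actpermE /= to_f.
  - by apply/or3P/Or32/forallP=> x; rewrite actpermE /= to_y.
  by apply/or3P/Or33/forallP=> x; rewrite actpermE /= to_t.
case/or3P=> [/existsP[a] | |] /forallP sE.
- exists (f a); first by rewrite !inE imset_f.
  by apply/permP=> x; rewrite actpermE /= to_f (eqP (sE x)).
- exists y; first by rewrite !inE eqxx orbT.
  by apply/permP=> x; rewrite actpermE /= to_y (eqP (sE x)).
exists t; first by rewrite !inE eqxx orbT.
by apply/permP=> x; rewrite actpermE /= to_t (eqP (sE x)).
Qed.

End ProjectiveLineModel.

End ProjectiveLine.

(** * Recognition of the simple groups of even order *)

Section EvenRecognition.

Variables (gT : finGroupType) (G : {group gT}).
Hypothesis abC : forall x, x \in G -> x != 1 -> abelian 'C_G[x].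
Hypothesis prN : forall x, x \in G -> x != 1 -> prime #|'N_G('C_G[x]) : 'C_G[x]|.
Hypotheses (simG : simple G) (nabG : ~~ abelian G).
Variables (t0 : gT) (It0 : t0 \in invols G).

Let M := 'C_G[t0]%G.
Let B := 'N_G(M)%G.
Let p := #|B : M|.

Let Gt0 : t0 \in G. Proof. exact: invols_sub It0. Qed.
Let t0n1 : t0 != 1. Proof. exact: invols_neq1 It0. Qed.
Let pr_p : prime p. Proof. exact: prN. Qed.
Let abM : abelian M. Proof. exact: abC. Qed.
Let sMB : M \subset B. Proof. by rewrite subsetI subsetIl normG. Qed.
Let sBG : B \subset G. Proof. exact: subsetIl. Qed.
Let nMB : B \subset 'N(M). Proof. exact: subsetIr. Qed.
Let oM : #|M| = p.+1. Proof. by case: (even_numbers abC prN simG nabG It0). Qed.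
Let oGB : #|G : B| = p.+2. Proof. by case: (even_numbers abC prN simG nabG It0). Qed.

Let M_sqr x : x \in M -> x ^+ 2 = 1.
Proof.
have [Q sQM [oQ Q2]] := invols_cent_group abC simG nabG It0.
suffices <- : Q :=: M by apply: Q2.
by apply/eqP; rewrite eqEcard sQM oQ oM leqnn.
Qed.

Let M_conj x : x \in M -> x != 1 -> x \in t0 ^: B.
Proof.
move=> Mx ntx; rewrite -(invols_centE abC simG nabG It0) inE Mx andbT.
by apply: mem_invols (M_sqr Mx); rewrite ?(subsetP (subsetIl _ _) _ Mx).
Qed.

Let oM2 : exists n, #|M| = (2 ^ n)%N.
Proof.
suffices /p_natP[n ->]: 2.-nat #|M| by exists n.
apply/pgroupP=> q pr_q /(Cauchy pr_q)[x Mx oq].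
have: #[x] %| 2 by rewrite order_dvdn M_sqr.
by rewrite oq dvdn_prime2 // inE.
Qed.

Lemma even_recognition : exists F : finFieldType, exists z : F,
  [/\ z != 0%R, forall a : F, a != 0%R -> exists i, a = (z ^+ i)%R,
      exists2 n, prime (2 ^ n - 1) & #|F| = (2 ^ n)%N & G \isog <<proj_gens z>>].
Proof.
have [t /setDP[It nBt] [oD invD]] := exists_inverting_invol abC prN simG nabG It0.
have := norm_centI_TI abC prN It0 It nBt.
rewrite -/M -/B in oD invD nBt *; set D := B :&: B :^ t => tiDM.
have Gt := invols_sub It; have t2 := invols_sqr It.
have tt : t * t = 1 by rewrite -expg2.
have tV : t^-1 = t by apply: (mulgI t); rewrite mulgV.
have [y defD] : exists y, D = <[y]>.
  by apply/cyclicP/prime_cyclic; rewrite /D oD.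
have Dy : y \in D by rewrite defD cycle_id.
have By : y \in B by case/setIP: Dy.
have defB : M * D = B.
  apply/eqP; rewrite eqEcard mul_subG ?subsetIl //=.
  rewrite TI_cardMg; last by rewrite setIC.
  by rewrite /D oD -/p -(Lagrange sMB).
(* The non-trivial elements of [M] form one class under [B = M * D]; as [M] is abelian, the powers
   of [y] already permute them transitively. *)
have orbM s s' : s \in M -> s' \in M -> s != 1 -> s' != 1 -> exists i, s' = s ^ (y ^+ i).
  have conjM x : x \in M -> x != 1 -> exists2 d, d \in D & x = t0 ^ d.
    move=> Mx /(M_conj Mx)/imsetP[b]; rewrite -defB => /imset2P[m d Mm Dd ->] ->.
    exists d => //; rewrite conjgM; congr (_ ^ _); apply/conjg_fixP/commgP.
    by apply/commute_sym/cent1P; case/setIP: Mm.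
  move=> Ms Ms' /(conjM _ Ms)[d Dd ->] /(conjM _ Ms')[d' Dd' ->].
  have: d^-1 * d' \in <[y]> by rewrite -defD groupM ?groupV.
  by case/cycleP=> i eqi; exists i; rewrite -eqi -conjgM mulKVg.
have inj_c a b : a \in M -> b \in M -> t * a \in B :* (t * b) -> a = b.
  move=> Ma Mb; rewrite mem_rcoset invMg !mulgA => Bab.
  suffices: a * b^-1 \in [1 gT] by rewrite inE => /eqP/(canRL (mulgKV _)); rewrite mul1g.
  have Mab : a * b^-1 \in M by rewrite groupM ?groupV.
  rewrite -tiDM; apply/setIP; split=> //; apply/setIP; split.
    exact: subsetP sMB _ Mab.
  by rewrite mem_conjg conjgE invgK !mulgA.
have out_c a : a \in M -> t * a \notin B.
  by move=> Ma; rewrite groupMr // (subsetP sMB).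
have covG g : g \in G -> g \in B \/ exists2 a, a \in M & g \in B :* (t * a).
  pose X := [set B :* (t * a) | a in M].
  have oX : #|X| = p.+1.
    rewrite card_in_imset // => a b Ma Mb eqB; apply: inj_c => //.
    by rewrite -eqB rcoset_refl.
  have sX : (B : {set gT}) |: X \subset rcosets B G.
    rewrite subUset sub1set; apply/andP; split.
      by apply/rcosetsP; exists 1; rewrite ?group1 ?mulg1.
    apply/subsetP=> _ /imsetP[a Ma ->]; apply/rcosetsP; exists (t * a) => //.
    by rewrite groupM // (subsetP sBG) // (subsetP sMB).
  have nXB : (B : {set gT}) \notin X.
    by apply/imsetP=> [[a Ma eqB]]; have := out_c a Ma; rewrite eqB rcoset_refl.
  have eqX : (B : {set gT}) |: X = rcosets B G.
    apply/eqP; rewrite eqEcard sX cardsU1 nXB oX.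
    by have ->: #|rcosets B G| = p.+2; rewrite ?add1n ?leqnn ?oGB.

  move=> Gg; have: B :* g \in (B : {set gT}) |: X by rewrite eqX; apply/rcosetsP; exists g.
  case/setU1P=> [<- | /imsetP[a Ma eqB]]; first by left; apply: rcoset_refl.
  by right; exists a => //; rewrite -eqB rcoset_refl.
(* Being conjugate to [t0], which lies in [B], [t] fixes some coset of [B], but not [B] itself. The
   fixed coset gives [s0], later the unit of the field, so that [t] fixes the point 1 as required by
   [fix_t]. *)
have [s0 Ms0 [nts0 fix_s0]] : exists2 s, s \in M & s != 1 /\ t * s * t \in B :* (t * s).
  have /imsetP[g Gg def_t] := invols_conj abC simG nabG It0 It.
  have Bt0 : t0 \in B by rewrite (subsetP sMB) // inE Gt0 cent1id.
  case/covG: Gg => [Bg | [s Ms /rcosetP[b Bb def_g]]].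
    by rewrite def_t groupJ in nBt.
  have Bts : t * s * t \in B :* (t * s).
    have ts: t ^ (t * s)^-1 = t0 ^ b by rewrite {1}def_t def_g conjgM conjgK.
    by rewrite mem_rcoset -[t * s * t * _]mulgA -{1}[t * s]invgK -conjgE ts groupJ.
  exists s => //; split=> //; apply: contraNneq nBt => s1.
  by move: Bts; rewrite s1 !mulg1 tt mem_rcoset mul1g groupV.
have [F [f [z [inj_f onto_f [Mf f1] fD [fy nzz gen_z]]]]] :=
  regular_cycle_field abM (subsetP nMB y By) Ms0 nts0
    (fun s Ms nts => orbM s0 s Ms0 Ms nts0 nts).
exists F, z; split=> //.
  have [n oMn] := oM2; exists n; first by rewrite -oMn oM subn1.
  rewrite -oMn -(card_imset predT inj_f); apply: eq_card => x.
  apply/imsetP/idP=> [[a _ ->] // | Mx].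
  by have [a ->] := onto_f x Mx; exists a.
have sfM : f @: setT = M.
  apply/setP=> x; apply/imsetP/idP=> [[a _ ->] // | Mx].
  by have [a ->] := onto_f x Mx; exists a; rewrite ?inE.
apply: (@isog_proj_gens F z gT G B f y t) => //.
- by have := invD y Dy; rewrite conjgE tV => <-; rewrite -!mulgA tt mulg1.
- by move=> a; apply: subsetP sMB _ (Mf a).
- move=> g /covG[Bg | [a Ma Bg]]; [by left | right].
  by have [a' def_a] := onto_f a Ma; exists a'; rewrite -def_a.
- by move=> a b /inj_c eqab; apply/inj_f/eqab.
- by move=> a; apply: out_c.
- by rewrite f1.
- rewrite sfM -defB defD mul_subG ?cycle_subG //; first by rewrite sub_gen ?subsetUl.
  by rewrite mem_gen // !inE eqxx orbT.
move=> g Gg coreg; have: g \in gcore B G.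
  apply/bigcapP=> h Gh; have := coreg h Gh.
  by rewrite mem_rcoset mem_conjg conjgE invgK mulgA.
have [_ /(_ (gcore_group B G))] := simpleP _ simG.
case=> [|/= ->|/= eqG _]; first by rewrite gcore_normal.
  by move/set1P.
have: G \subset B by rewrite -eqG gcore_sub.
by move/(indexgS G); rewrite oGB indexgg.
Qed.

End EvenRecognition.

(** * A criterion for membership, and Alt(5) *)

Lemma isog_in_Yn (aT rT : finGroupType) (G : {group aT}) (H : {group rT}) :
  G \isog H -> in_Yn G -> in_Yn H.
Proof.
move/isog_symr/isogP=> [f injf defG] ynG A sAH nabA; rewrite /= in defG.
have := ynG (f @* A)%G; rewrite -{1}defG morphimS //= injm_abelian // => /(_ isT nabA).
rewrite -defG -injm_subnorm // => eqA.
by apply: (injm_morphim_inj injf) eqA; rewrite ?subsetIl.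
Qed.

(** By transfer every Sylow subgroup meets the derived subgroup trivially, so no prime divides the
    order of the latter. *)
Lemma abelian_of_local (gT : finGroupType) (A : {group gT}) :
  (forall r (R : {group gT}), r.-Sylow(A) R -> 'N_A(R) \subset 'C(R)) -> abelian A.
Proof.
move=> locA; suffices A'1: A^`(1) == 1 by rewrite (sameP derG1P eqP).
rewrite trivg_card1; apply: contraT => nt; have := pdivP; move=> /(_ #|A^`(1)|)[].
  by rewrite ltn_neqAle eq_sym nt cardG_gt0.
move=> r pr_r r_dv; have [R sylR] := Sylow_exists r A.
have sRA := pHall_sub sylR; have cRN := locA r R sylR.
have abR : abelian R.
  by apply: subset_trans cRN; rewrite subsetI sRA normG.
have := abelian_Sylow_cent_norm sylR abR.
have -> : R :&: 'Z('N_A(R)) = R.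
  apply/setIidPl; rewrite subsetI subsetI sRA normG /=.
  by rewrite centsC.
move=> tiR; have := Sylow_setI_normal (der_normal 1 A) sylR.
rewrite setIC tiR => /card_Hall/eqP; rewrite cards1 eq_sym.
by rewrite p_part_eq1 mem_primes pr_r cardG_gt0 r_dv.
Qed.

(* The alternative is the dichotomy semisimple/unipotent in [SL(2,2^n)]. *)
Lemma in_Yn_criterion (gT : finGroupType) (G : {group gT}) :
    (forall x, x \in G -> x != 1 -> abelian 'C_G[x]) ->
    (forall x t, x \in G -> x != 1 -> t \in 'N_G('C_G[x]) :\: 'C_G[x] ->
       'N_G('C_G[x]) \subset 'C_G[x] * <[t]> /\
       (odd #|'C_G[x]| /\ {in 'C_G[x], forall c, c ^ t = c^-1} \/
        forall R : {group gT}, R \subset 'C_G[x] -> R :!=: 1 -> t \in 'N(R) -> R :=: 'C_G[x])) ->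
  in_Yn G.
Proof.
move=> abC locG A sAG nabA; apply/eqP; rewrite eqEsubset subsetI sAG normG !andbT.
have [r [R [sylR nCR]]] : exists r, exists R : {group gT},
    r.-Sylow(A) R /\ ~~ ('N_A(R) \subset 'C(R)).
  (* Bounding [r] by [#|A|] makes the quantifier finite; for larger [r] the Sylow subgroup is
     trivial. *)
  have: ~~ [forall R : {group gT}, [forall r : 'I_#|A|.+1, r.-Sylow(A) R ==> ('N_A(R) \subset 'C(R))]].
    apply: contra nabA => /forallP locA; apply: abelian_of_local => r R sylR.
    have [r_le | r_gt] := leqP r #|A|.
      by have /forallP/(_ (Ordinal (r_le : r < #|A|.+1)))/implyP := locA R; apply.
    have: R :==: 1.
      rewrite trivg_card1 (card_Hall sylR) p_part_eq1.
      by apply: contraL r_gt; rewrite mem_primes -leqNgt => /and3P[_ _ /dvdn_leq->].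
    by move/eqP->; rewrite cents1.
  case/forallPn=> R /forallPn[r]; rewrite negb_imply => /andP[sylR nCR].
  by exists r, R.
have sRA := pHall_sub sylR; have sRG := subset_trans sRA sAG.
have ntR : R :!=: 1 by apply: contraNneq nCR => ->; rewrite cents1.
have [z Zz ntz] : exists2 z, z \in 'Z(R) & z != 1.
  apply/trivgPn; rewrite center_nil_eq1 // (pgroup_nil (pHall_pgroup sylR)) //.
have /setIP[Rz cRz] := Zz; have Gz := subsetP sRG z Rz.
have sRC : R \subset 'C_G[z] by rewrite subsetI sRG sub_cent1.
have abR : abelian R := abelianS sRC (abC z Gz ntz).
have defC : 'C_G[z] = 'C_G(R).
  apply/eqP; rewrite eqEsubset subsetI subsetIl /=; apply/andP; split.
    exact: subset_trans (abC z Gz ntz) (centS sRC).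
  by rewrite -cent_set1 setIS // centS // sub1set.
have sNN : 'N_G(R) \subset 'N_G('C_G[z]).
  by rewrite defC subsetI subsetIl normsI ?norms_cent ?subsetIr // subIset ?normG.
have [t /setIP[At Nt] nCt] := subsetPn nCR; have Gt := subsetP sAG t At.
have NCt : t \in 'N_G('C_G[z]) :\: 'C_G[z].
  apply/setDP; split; first by apply: (subsetP sNN); apply/setIP.
  by apply: contra nCt; rewrite defC => /setIP[].
have [sNC alt] := locG z t Gz ntz NCt.
have nAN : A <| 'N_G(A) by rewrite normal_subnorm.
apply/subsetP=> y; rewrite -(Frattini_arg nAN sylR).
case/mulsgP=> a n Aa /setIP[/setIP[Gn NAn] NRn] ->; rewrite groupMl //.
have /(subsetP sNC)/mulsgP[c tk Cc /cycleP[k ->] def_n] : n \in 'N_G('C_G[z]).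
  by apply: (subsetP sNN); rewrite inE Gn.
rewrite def_n groupMr ?groupX //.
(* In the unipotent case [R] is all of ['C_G[z]] and contains [c]. In the semisimple case the
   commutator of [t] and [c] is [c ^+ 2], which therefore lies in [A], and [c] is a power of it
   since its order is odd. *)
case: alt => [[oddC invC] | eqC]; last first.
  by apply: (subsetP sRA); rewrite (eqC R) // (subsetP (subset_trans sNN (subsetIr _ _))) // inE.
have NAc : c \in 'N(A).
  rewrite -(mulgK (t ^+ k) c) -def_n groupMr // groupV groupX //.
  exact: subsetP (normG A) t At.
have Ac2 : c ^+ 2 \in A.
  have <- : t^-1 * t ^ c = c ^+ 2.
    transitivity (c^-1 ^ t * c); first by rewrite !conjgE !mulgA.
    by rewrite conjVg invC // invgK expg2.
  by rewrite groupM ?groupV // memJ_norm.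
have co2: coprime #|'C_G[z]| 2 by rewrite coprimen2.
by rewrite -(expgK co2 Cc) groupX.
Qed.

Lemma simple_card_le_index_fact (gT : finGroupType) (G H : {group gT}) :
  simple G -> H \proper G -> #|G| <= (#|G : H|)`!.
Proof.
move=> simG /andP[sHG nsGH]; pose S := rcosets H G.
have nSG := actsRs_rcosets H G; pose f := actperm <[nSG]>.
have [_ /(_ (gcore_group H G) (gcore_normal sHG)) [/= K1 | /= KG]] := simpleP _ simG; last first.
  by rewrite -KG gcore_sub in nsGH.
have /card_injm <- //: 'injm f.
  by rewrite ker_actperm astab_actby setIT astabRs_rcosets K1 subsetIr.
rewrite -[#|G : H|]/(#|S|) -card_perm; apply/subset_leq_card/subsetP=> s.
case/morphimP=> g _ Gg ->; apply/subsetP=> x; rewrite inE actpermE /=.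
by apply: contraNT => /negPf nSx; rewrite /actby nSx.
Qed.

Lemma abelian_card_lt6 (gT : finGroupType) (A : {group gT}) : #|A| < 6 -> abelian A.
Proof.
have [p4 | np4] := eqVneq #|A| 4; first by move=> _; apply: (@card_p2group_abelian _ 2).
move=> ltA6; suffices: (#|A| == 1%N) || prime #|A|.
  by case/orP=> [|/prime_cyclic/cyclic_abelian//]; rewrite -trivg_card1 => /eqP->; apply: abelian1.
by move: np4 ltA6 (cardG_gt0 A); case: #|A| => [|[|[|[|[|[|n]]]]]].
Qed.

(** A proper normalizer [H] has index at least 5, so a non-abelian [A] properly contained in [H] has
    order 6, and [H] has order 12. A Sylow 3-subgroup of [A] is then normal in [H] and Sylow in [G];
    the number of its conjugates divides 5 and is 1 modulo 3, so it is normal in [G]. *)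
Lemma simple_card60_in_Yn (gT : finGroupType) (G : {group gT}) :
  simple G -> #|G| = 60 -> in_Yn G.
Proof.
move=> simG oG A sAG nabA; pose H := 'N_G(A)%G.
have sAH : A \subset H by rewrite subsetI sAG normG.
have sHG : H \subset G by apply: subsetIl.
have nAH : A <| H by rewrite /normal sAH subsetIr.
have [eqHG | ltHG] := eqVproper sHG.
  have [_ /(_ A)] := simpleP _ simG; rewrite -{1}eqHG => /(_ nAH)[A1 | AG].
    by rewrite A1 abelian1 in nabA.
  by rewrite [LHS]eqHG AG.
have [<- // | ltAH] := eqVproper sAH.
have oA : 6 <= #|A| by rewrite leqNgt; apply: contra nabA => /abelian_card_lt6.
have := simple_card_le_index_fact simG ltHG; rewrite oG => le60.
have i5 : 5 <= #|G : H|.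
  by rewrite leqNgt; apply: contraTN le60; case: #|G : H| => [|[|[|[|[|k]]]]].
have oH : #|H| = 12 /\ #|A| = 6.
  have := Lagrange sHG; have := Lagrange sAH; rewrite oG => <-.
  have := proper_card ltAH; have := Lagrange sAH.
  move: i5 oA; move: #|G : H| #|A| #|H| #|H : A| => a b c d a5 b6 <- bd ab.
  have a_le : a <= 10 by nia.
  have d_le : d <= 2 by nia.
  have d2 : d = 2 by nia.
  subst d; nia.
have [oH12 oA6] := oH.
have [T sylT] := Sylow_exists 3 A.
have oT : #|T| = 3 by rewrite (card_Hall sylT) oA6 p_part.
have sTA := pHall_sub sylT.
have nTA : T <| A.
  apply: index2_normal => //; apply/eqP.
  by rewrite -divgS // oT oA6.
have nTH : T <| H.
  apply: char_normal_trans nAH; rewrite -(normal_Hall_pcore sylT nTA).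
  exact: pcore_char.
have sylTG : 3.-Sylow(G) T.
  by rewrite pHallE (subset_trans sTA sAG) oG oT p_part.
have oS := card_Syl sylTG; have := card_Syl_mod G (isT : prime 3); rewrite oS.
have sHN : H \subset 'N_G(T) by rewrite subsetI sHG normal_norm.
have := Lagrange (subsetIl G 'N(T)); have := cardSg sHN; rewrite oG oH12.
case/dvdnP=> k -> eq60 mod3.
have i1 : #|G : 'N_G(T)| = 1%N.
  move: eq60 mod3; move: #|_ : _| => a eq60; clear -eq60.
  have : a <= 5 by case: k eq60 => [|k] eq60; nia.
  by case: a eq60 => [|[|[|[|[|[|a]]]]]] //; lia.
have nTG : T <| G.
  rewrite /normal (subset_trans sTA sAG) /=; have := eqP (introT eqP i1).
  by move/eqP; rewrite indexg_eq1 subsetI => /andP[].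
have [_ /(_ T nTG)[T1 | TG]] := simpleP _ simG.
  by rewrite T1 cards1 in oT.
by rewrite TG oG in oT.
Qed.

Lemma Alt5_in_Yn : in_Yn 'Alt_('I_5).
Proof.
apply: simple_card60_in_Yn; first by rewrite simple_Alt5 ?card_ord.
have := @card_Alt 'I_5; rewrite card_ord => /(_ isT).
by move=> e; apply/eqP; rewrite -(eqn_pmul2l (isT : 0 < 2)) e.
Qed.

(** * The groups SL(2,F) in characteristic 2 *)

Section SpecialLinear2.

Import GRing.Theory.
Local Open Scope ring_scope.

Section SL2.

Variable F : finFieldType.

Definition mx22 (a b c d : F) : 'M[F]_2 :=
  \matrix_(i, j) if i == 0 then if j == 0 then a else b else if j == 0 then c else d.

Lemma mx22_eta (A : 'M[F]_2) : A = mx22 (A 0 0) (A 0 1) (A 1 0) (A 1 1).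
Proof.
apply/matrixP=> i j; rewrite !mxE; have [->|ni] := eqVneq i 0.
  by have [->|nj] := eqVneq j 0; last by case: j nj => [[|[|j]] ltj] // _; congr (A _ _); apply: val_inj.
have -> : i = 1 by case: i ni => [[|[|i]] lti] // _; apply: val_inj.
by have [->|nj] := eqVneq j 0; last by case: j nj => [[|[|j]] ltj] // _; congr (A _ _); apply: val_inj.
Qed.

Lemma det_mx22 a b c d : \det (mx22 a b c d) = a * d - b * c.
Proof.
rewrite (expand_det_row _ 0) big_ord_recl big_ord1 /cofactor !det_mx11 !mxE /=.
by rewrite mul1r mulN1r mulrN.
Qed.

Lemma mul_mx22 a b c d a' b' c' d' :
  mx22 a b c d *m mx22 a' b' c' d' =
  mx22 (a * a' + b * c') (a * b' + b * d') (c * a' + d * c') (c * b' + d * d').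
Proof.
apply/matrixP=> i j; rewrite !mxE big_ord_recl big_ord1 !mxE /=.
by case: (i == 0); case: (j == 0).
Qed.

(** [insubd] replaces a singular matrix by 1; the lemmas assume determinant 1. *)
Definition sl2 (a b c d : F) : {'GL_2[F]} := insubd (1%g : {'GL_2[F]}) (mx22 a b c d).

Lemma GLval_sl2 a b c d : a * d - b * c = 1 -> GLval (sl2 a b c d) = mx22 a b c d.
Proof.
move=> det1; rewrite -[GLval _]/(val _) val_insubd.
have uA: mx22 a b c d \is a GRing.unit by rewrite -[_ \is a _]/(_ \in unitmx) unitmxE det_mx22 det1 unitr1.
by rewrite uA.
Qed.

Lemma mem_sl2 a b c d : a * d - b * c = 1 -> sl2 a b c d \in SL2 F.
Proof. by move=> det1; rewrite inE GLval_sl2 // det_mx22 det1. Qed.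

Lemma sl2P g : g \in SL2 F -> exists a b c d : F, a * d - b * c = 1 /\ g = sl2 a b c d.
Proof.
rewrite inE [GLval g]mx22_eta; set a := GLval g 0 0; set b := GLval g 0 1.
set c := GLval g 1 0; set d := GLval g 1 1; rewrite det_mx22 => /eqP det1.
by exists a, b, c, d; split=> //; apply: val_inj; rewrite /= GLval_sl2 // -mx22_eta.
Qed.

Lemma sl2M_det a b c d a' b' c' d' : a * d - b * c = 1 -> a' * d' - b' * c' = 1 ->
  (a * a' + b * c') * (c * b' + d * d') - (a * b' + b * d') * (c * a' + d * c') = 1 :> F.
Proof.
move=> e e'; transitivity ((a * d - b * c) * (a' * d' - b' * c')); first by ring.
by rewrite e e' mulr1.
Qed.

Lemma sl2M a b c d a' b' c' d' : a * d - b * c = 1 -> a' * d' - b' * c' = 1 ->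
  (sl2 a b c d * sl2 a' b' c' d')%g =
  sl2 (a * a' + b * c') (a * b' + b * d') (c * a' + d * c') (c * b' + d * d').
Proof.
move=> det1 det1'; apply: val_inj; rewrite /= GLval_sl2 ?sl2M_det //.
by rewrite -mul_mx22 -(GLval_sl2 det1) -(GLval_sl2 det1').
Qed.

Lemma sl21 : sl2 1 0 0 1 = 1%g.
Proof.
apply: val_inj; rewrite /= GLval_sl2 ?mulr1 ?mul0r ?subr0 //.
by rewrite [RHS]mx22_eta !mxE.
Qed.

Lemma sl2V a b c d : a * d - b * c = 1 -> ((sl2 a b c d)^-1)%g = sl2 d (- b) (- c) a.
Proof.
move=> det1; have det1' : d * a - (- b) * (- c) = 1 by rewrite -det1; ring.
apply: (mulgI (sl2 a b c d)); rewrite mulgV sl2M // -sl21; congr sl2; try (by ring).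
  by rewrite -det1; ring.
by rewrite -det1; ring.
Qed.

Fact SL2_group_set : group_set (SL2 F).
Proof.
apply/group_setP; split=> [|_ _ /sl2P[a [b [c [d [e ->]]]]] /sl2P[a' [b' [c' [d' [e' ->]]]]]].
  by rewrite -sl21 mem_sl2 // mulr1 mul0r subr0.
by rewrite sl2M // mem_sl2 // sl2M_det.
Qed.
Canonical SL2_group := Group SL2_group_set.

End SL2.

(** * SL(2,F) on the projective line in characteristic 2 *)

Section SL2Model.

Variables (F : finFieldType) (z : F).
Hypothesis ch2 : 2 \in [pchar F].
Hypotheses (nzz : z != 0) (gen_z : forall a : F, a != 0 -> exists i, a = z ^+ i).

Let oppF (a : F) : - a = a. Proof. exact: oppr_pchar2. Qed.
Let sqr_inj (a b : F) : a ^+ 2 = b ^+ 2 -> a = b.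
Proof.
move/eqP; rewrite eqf_sqr => /orP[/eqP // | /eqP->]; exact: oppF.
Qed.

Definition borel : {set {'GL_2[F]}} := [set g in SL2 F | GLval g 1 0 == 0].

Lemma mem_borel a b c d : a * d - b * c = 1 -> (sl2 a b c d \in borel) = (c == 0).
Proof. by move=> det1; rewrite inE mem_sl2 // GLval_sl2 // mxE. Qed.

Fact borel_group_set : group_set borel.
Proof.
apply/group_setP; split=> [|g h].
  by rewrite -sl21 mem_borel // mulr1 mul0r subr0.
case/setIdP=> /sl2P[a [b [c [d [e ->]]]]] g0 /setIdP[/sl2P[a' [b' [c' [d' [e' ->]]]]]] h0.
rewrite !GLval_sl2 // !mxE /= in g0 h0; rewrite sl2M // mem_borel ?sl2M_det //.
by rewrite (eqP g0) (eqP h0) mul0r mulr0 addr0.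
Qed.
Canonical borel_group := Group borel_group_set.

Let f (a : F) := sl2 1 a 0 1.
Let t : {'GL_2[F]} := sl2 0 1 1 0.

Let det_f (a : F) : 1 * 1 - a * 0 = 1. Proof. by ring. Qed.
Let det_t : 0 * 0 - 1 * 1 = 1 :> F. Proof. by rewrite oppF; ring. Qed.

Let tf a : (t * f a)%g = sl2 0 1 1 a.
Proof. by rewrite sl2M //; congr sl2; ring. Qed.

Let det_tf (a : F) : 0 * a - 1 * 1 = 1. Proof. by rewrite oppF; ring. Qed.

Let mem_coset a b c d e : a * d - b * c = 1 ->
  (sl2 a b c d \in (borel :* (t * f e))%g) = (c * e == d).
Proof.
move=> det1; have det' : e * 0 - (- 1) * (-1) = 1 by rewrite -(det_tf e); ring.
rewrite mem_rcoset tf sl2V // sl2M // mem_borel ?sl2M_det //.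
by rewrite mulrN1 subr_eq0.
Qed.

Lemma isog_SL2_proj_gens : SL2 F \isog <<proj_gens z>>%g.
Proof.
(* Squaring is bijective in characteristic 2. The diagonal matrix [y] conjugates [f a] into
   [f (v ^+ 2 * a)], so [v] has to be a square root of [z]. *)
have [v vz] : exists v, v ^+ 2 = z.
  have inj_sqr : injective (fun a : F => a ^+ 2) by apply: sqr_inj.
  by exists (invF inj_sqr z); rewrite (f_invF inj_sqr).
have nzv : v != 0 by move: nzz; rewrite -vz expf_eq0.
have det_y: v^-1 * v - 0 * 0 = 1 by rewrite mulVf //; ring.
pose y : {'GL_2[F]} := sl2 v^-1 0 0 v.
have det_yV: v * v^-1 - (- 0) * (- 0) = 1 by rewrite mulfV //; ring.
have yi i : (y ^+ i)%g = sl2 (v ^- i) 0 0 (v ^+ i).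
  elim: i => [|i IHi]; first by rewrite expg0 expr0 invr1 sl21.
  have det_yi : v ^- i * v ^+ i - 0 * 0 = 1.
    by rewrite mulVf ?expf_neq0 //; ring.
  rewrite expgSr IHi sl2M //; congr sl2; rewrite ?exprSr ?invfM; ring.
have By : y \in borel by rewrite mem_borel.
have Bf a : f a \in borel by rewrite mem_borel.
apply: (@isog_proj_gens F z _ (SL2_group F) borel_group f y t) => //.
- by apply/subsetP=> g /setIdP[].
- exact: mem_sl2.
- by rewrite sl2M // -sl21; congr sl2; ring.
- by rewrite sl2V // !sl2M //; congr sl2; ring.
- by move=> a b; rewrite sl2M //; congr sl2; ring.
- move=> a; rewrite conjgE sl2V // [(f a * y)%g]sl2M // sl2M ?sl2M_det //.
  by rewrite -vz; congr sl2; field.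
- move=> g /sl2P[a [b [c [d [e ->]]]]]; have [c0 | nzc] := eqVneq c 0.
    by left; rewrite mem_borel // c0.
  by right; exists (d / c); rewrite mem_coset // mulrCA divff ?mulr1.
- by move=> a b; rewrite tf mem_coset // mul1r => /eqP.
- by move=> a; rewrite tf mem_borel // oner_eq0.
- by rewrite {1}tf sl2M // mem_coset ?sl2M_det //; apply/eqP; ring.
- apply/subsetP=> g /setIdP[/sl2P[a [b [c [d [e ->]]]]]].
  rewrite GLval_sl2 // mxE /= => /eqP c0.
  have ad : a * d = 1 by rewrite -e c0; ring.
  have nza : a != 0 by apply: contra_eq_neq ad => ->; rewrite mul0r eq_sym oner_eq0.
  have nzd : d != 0 by apply: contra_eq_neq ad => ->; rewrite mulr0 eq_sym oner_eq0.
  have [i def_d] := gen_z (expf_neq0 2 nzd).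
  have dv : d = v ^+ i by apply: sqr_inj; rewrite def_d -vz -!exprM mulnC.
  have ->: sl2 a b c d = (y ^+ i * f (b * d)%R)%g.
    rewrite yi -dv sl2M //; last by rewrite mulVf //; ring.
    have aV : a = d^-1 by apply: (mulIf nzd); rewrite ad mulVf.
    by rewrite c0 aV; congr sl2; field.
  by rewrite groupM ?groupX // mem_gen // !inE ?eqxx ?orbT // imset_f ?inE.
move=> g /sl2P[a [b [c [d [e ->]]]]] core_g.
(* An element of the core fixes infinity, 0 and 1, whence [c = 0], [b = 0] and [a = d]; the
   determinant gives [a = 1]. *)
have: sl2 a b c d \in borel.
  by have := core_g 1%g (group1 _); rewrite mul1g mulg1.
rewrite mem_borel // => /eqP c0; subst c.
have := core_g _ (mem_sl2 det_t).
have := core_g _ (mem_sl2 (det_tf 1)).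
rewrite !sl2M // -(tf 0) -(tf 1) !mem_coset ?sl2M_det //.
rewrite !(mul0r, mulr0, mul1r, mulr1, addr0, add0r) => /eqP abd /eqP b0.
have da : d = a by rewrite abd -b0 add0r.
have a1 : a = 1 by apply: sqr_inj; rewrite expr1n -e da; ring.
by rewrite da a1 -b0 sl21.
Qed.

End SL2Model.

Lemma finField_prime_gen (F : finFieldType) (b : F) : prime #|F|.-1 -> b != 0 -> b != 1 ->
  forall a, a != 0 -> exists i, a = b ^+ i.
Proof.
move=> prF nzb nb1 a nza; pose u := finField_unit nzb; pose v := finField_unit nza.
have ou : #[u]%g == #|F|.-1.
  have: (#[u]%g %| #|F|.-1)%N by rewrite -card_finField_unit order_dvdG ?inE.
  have [_ H] := primeP prF; case/H/pred2P=> [/eqP | ->] //.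
  by rewrite order_eq1 => /eqP/(congr1 val)/= eqb; rewrite eqb eqxx in nb1.
have /cycleP[i eqi] : v \in <[u]>%g.
  suffices -> : <[u]>%g = [set: {unit F}]%g by rewrite inE.
  by apply/eqP; rewrite eqEcard subsetT card_finField_unit -orderE (eqP ou) leqnn.
by exists i; have /(congr1 val) := eqi; rewrite FinRing.val_unitX.
Qed.

(** * Centralizers of two-by-two matrices *)

Section Matrices2.

Variable F : finFieldType.
Implicit Types A B : 'M[F]_2.

Lemma mxtrace22 A : \tr A = A 0 0 + A 1 1.
Proof. by rewrite [A]mx22_eta /mxtrace big_ord_recl big_ord1 !mxE. Qed.

Lemma det22 A : \det A = A 0 0 * A 1 1 - A 0 1 * A 1 0.
Proof. by rewrite {1}[A]mx22_eta det_mx22. Qed.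

Lemma mx22P A B :
  A 0 0 = B 0 0 -> A 0 1 = B 0 1 -> A 1 0 = B 1 0 -> A 1 1 = B 1 1 -> A = B.
Proof. by move=> e00 e01 e10 e11; rewrite [A]mx22_eta [B]mx22_eta e00 e01 e10 e11. Qed.

Lemma Cayley_Hamilton22 A : A *m A = \tr A *: A - (\det A)%:M.
Proof.
rewrite mxtrace22 det22 [A in A *m A]mx22_eta mul_mx22.
by apply: mx22P; rewrite !mxE /=; ring.
Qed.

Lemma det_lin22 A c d :
  \det (c%:M + d *: A) = c ^+ 2 + c * d * \tr A + d ^+ 2 * \det A.
Proof. by rewrite !det22 mxtrace22 !mxE /=; ring. Qed.

(** A non-scalar matrix has a non-zero off-diagonal entry or distinct diagonal entries, and [d] is
    the ratio of the corresponding entries of [B] and [A]. *)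
Lemma comm_mx22 A B : ~~ is_scalar_mx A -> B *m A = A *m B -> exists c d, B = c%:M + d *: A.
Proof.
move=> nsA; rewrite [A]mx22_eta [B]mx22_eta !mul_mx22 => /matrixP eqAB.
have := eqAB 0 0; have := eqAB 0 1; have := eqAB 1 0; rewrite !mxE /=.
set a := A 0 0; set b := A 0 1; set c := A 1 0; set d := A 1 1.
set a' := B 0 0; set b' := B 0 1; set c' := B 1 0; set d' := B 1 1 => e10 e01 e00.
have nz : [|| b != 0, c != 0 | a != d].
  apply: contraR nsA; rewrite !negb_or !negbK => /and3P[/eqP b0 /eqP c0 /eqP ad].
  apply/is_scalar_mxP; exists a; apply: mx22P; rewrite !mxE //= -/a -/b -/c -/d ?b0 ?c0 ?ad //.
have eqbc : b' * c = b * c' by apply: (addrI (a' * a)); rewrite e00; ring.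
have eqb : b * (a' - d') = b' * (a - d).
  apply/eqP; rewrite -subr_eq0; apply/eqP; transitivity (a' * b + b' * d - (a * b' + b * d')).
    by ring.
  by rewrite e01 subrr.
have eqc : c * (a' - d') = c' * (a - d).
  apply/eqP; rewrite -subr_eq0; apply/eqP; transitivity (c * a' + d * c' - (c' * a + d' * c)).
    by ring.
  by rewrite -e10 subrr.
have linP k : b' = k * b -> c' = k * c -> a' - d' = k * (a - d) ->
    mx22 a' b' c' d' = (a' - k * a)%:M + k *: mx22 a b c d.
  move=> eb ec ead; apply: mx22P; rewrite !mxE /= ?eb ?ec; try by ring.
  by apply: (addrI (- a')); apply: oppr_inj; rewrite opprD opprK ead; ring.
case/or3P: nz => [nzb | nzc | nzad].
- exists (a' - b' / b * a), (b' / b); apply: linP.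
  + by rewrite divfK.
  + by rewrite mulrAC eqbc mulrAC divff // mul1r.
  by rewrite mulrAC -eqb mulrAC mulfV // mul1r.
- exists (a' - c' / c * a), (c' / c); apply: linP.
  + by rewrite mulrAC [c' * b]mulrC -eqbc mulfK.
  + by rewrite divfK.
  by rewrite mulrAC -eqc mulrAC mulfV // mul1r.
have nzd : a - d != 0 by rewrite subr_eq0.
exists (a' - (a' - d') / (a - d) * a), ((a' - d') / (a - d)); apply: linP.
- by rewrite mulrAC [_ * b]mulrC eqb mulfK.
- by rewrite mulrAC [_ * c]mulrC eqc mulfK.
by rewrite divfK.
Qed.

End Matrices2.

(** * Membership of SL(2,F) in the class *)

Section SL2Yn.

Variable F : finFieldType.
Hypotheses (ch2 : 2 \in [pchar F]) (prF : prime #|F|.-1).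
Implicit Types x t g c : {'GL_2[F]}.

Let G := SL2_group F.

Let oppF (a : F) : - a = a. Proof. exact: oppr_pchar2. Qed.
Let addFF (a : F) : a + a = 0. Proof. exact: addrr_pchar2. Qed.
Let sqr1 (a : F) : a ^+ 2 = 1 -> a = 1.
Proof. by rewrite -{1}(expr1n _ 2) => /eqP; rewrite eqf_sqr oppF orbb => /eqP. Qed.

Let GLval_inj g h : GLval g = GLval h -> g = h. Proof. exact: val_inj. Qed.

Let det1 g : g \in G -> \det (GLval g) = 1.
Proof. by rewrite inE => /eqP. Qed.

(** Coordinates in the algebra generated by [x], which contains the centralizer of a non-trivial
    [x]. *)
Definition lin_of x c (a b : F) := GLval c = a%:M + b *: GLval x.

Lemma nscalar_SL2 x : x \in G -> x != 1%g -> ~~ is_scalar_mx (GLval x).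
Proof.
move=> Gx; apply: contraNN => /is_scalar_mxP[a eqx]; have := det1 Gx.
rewrite eqx det_scalar => /sqr1 a1; apply/eqP/val_inj; rewrite /= eqx a1.
by [].
Qed.

Lemma lin_cent x c : x \in G -> x != 1%g -> c \in 'C_G[x]%g -> exists a b, lin_of x c a b.
Proof.
move=> Gx ntx /setIP[Gc /cent1P cxc]; apply: comm_mx22; first exact: nscalar_SL2.
by have := congr1 GLval cxc; rewrite !GL_MxE.
Qed.

Lemma lin_conj x c t a b : lin_of x c a b -> lin_of (x ^ t)%g (c ^ t)%g a b.
Proof.
rewrite /lin_of => eqc; rewrite !conjgE !GL_MxE eqc mulmxDl mulmxDr.
have tVt : GLval t^-1%g *m GLval t = 1%:M by rewrite -GL_MxE mulVg.
by rewrite -scalar_mxC [_ *m (_ *m a%:M)]mulmxA tVt mul1mx -scalemxAl -scalemxAr.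
Qed.

Lemma lin_eq x c c' a b : lin_of x c a b -> lin_of x c' a b -> c = c'.
Proof. by rewrite /lin_of => eqc eqc'; apply: val_inj; rewrite /= eqc -eqc'. Qed.

Lemma lin_commute x c c' a b a' b' : lin_of x c a b -> lin_of x c' a' b' -> commute c c'.
Proof.
rewrite /lin_of => eqc eqc'; apply: val_inj; rewrite /= -[LHS]/(GLval c *m GLval c').
rewrite -[RHS]/(GLval c' *m GLval c) eqc eqc' !mulmxDl !mulmxDr -!scalar_mxM.
rewrite !mul_scalar_mx -!scalemxAl -!scalemxAr !mul_mx_scalar !scalerA [a' * a]mulrC.
by rewrite [b' * a]mulrC [b' * b]mulrC [a' * b]mulrC -!addrA; congr (_ + _); rewrite addrCA.
Qed.

Lemma lin_id x : lin_of x x 0 1.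
Proof. by rewrite /lin_of scale1r raddf0 add0r. Qed.

Lemma lin_inv x : x \in G -> lin_of x x^-1%g (\tr (GLval x)) 1.
Proof.
move=> Gx; rewrite /lin_of; set X := GLval x; rewrite scale1r.
have uX : X \in unitmx by rewrite unitmxE det1 ?unitr1.
apply: (can_inj (mulKmx uX)); rewrite -GL_MxE mulgV GL_1E mulmxDr Cayley_Hamilton22.
rewrite det1 // mul_mx_scalar addrA -scalerDl addFF scale0r add0r.
by rewrite -scaleN1r oppF scale1r.
Qed.

Lemma lin_det x c a b : x \in G -> c \in G -> lin_of x c a b ->
  a ^+ 2 + a * b * \tr (GLval x) + b ^+ 2 = 1.
Proof. by move=> Gx Gc eqc; rewrite -(det1 Gc) eqc det_lin22 det1 // mulr1. Qed.

Lemma lin_tr x c a b : lin_of x c a b -> \tr (GLval c) = b * \tr (GLval x).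
Proof.
move=> ->; rewrite mxtraceD mxtrace_scalar mxtraceZ -[a *+ 2]/(a + a).
by rewrite addFF add0r.
Qed.

Lemma SL2_abelian_cent x : x \in G -> x != 1%g -> abelian 'C_G[x]%g.
Proof.
move=> Gx ntx; apply/centsP=> c Cc c' Cc'.
have [a [b eqc]] := lin_cent Gx ntx Cc; have [a' [b' eqc']] := lin_cent Gx ntx Cc'.
exact: lin_commute eqc eqc'.
Qed.

Lemma mxtraceJ x t : \tr (GLval (x ^ t)%g) = \tr (GLval x).
Proof.
rewrite conjgE GL_MxE mxtrace_mulC -GL_MxE.
by rewrite mulgK.
Qed.

Lemma norm_lin x g : x \in G -> x != 1%g -> g \in 'N_G('C_G[x])%g ->
  exists a b, [/\ lin_of x (x ^ g)%g a b, b * \tr (GLval x) = \tr (GLval x)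
                 & a ^+ 2 + a * \tr (GLval x) + b ^+ 2 = 1].
Proof.
move=> Gx ntx /setIP[Gg NCg]; have Cx : x \in 'C_G[x]%g by rewrite inE Gx cent1id.
have [a [b eqxg]] : exists a b, lin_of x (x ^ g)%g a b.
  by apply: lin_cent => //; rewrite memJ_norm.
have tr_b : b * \tr (GLval x) = \tr (GLval x) by rewrite -(lin_tr eqxg) mxtraceJ.
exists a, b; split=> //; rewrite -[RHS](lin_det Gx _ eqxg) ?groupJ //.
by rewrite -[a * b * _]mulrA tr_b.
Qed.

(** As conjugation preserves trace and determinant, [x ^ t] has coordinates [b = 1] and [a = 0] or
    [a = \tr x], so it is [x] or its inverse. An involution has trace 0; in the centralizer it would
    be scalar, hence 1. *)
Lemma cent_semisimple x t : x \in G -> x != 1%g -> \tr (GLval x) != 0 ->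
    t \in 'N_G('C_G[x])%g -> t \notin 'C_G[x]%g ->
  [/\ (x ^ t = x^-1)%g, odd #|'C_G[x]%g| & {in 'C_G[x]%g, forall c, c ^ t = c^-1}%g].
Proof.
move=> Gx ntx nz_tr Nt nCt; have [Gt _] := setIP Nt.
have xt : (x ^ t = x^-1)%g.
  have [a [b [eqxt tr_b det_b]]] := norm_lin Gx ntx Nt.
  have b1 : b = 1 by apply: (mulIf nz_tr); rewrite tr_b mul1r.
  subst b; have: a * (a + \tr (GLval x)) = 0.
    apply: (addIr 1); rewrite add0r -[RHS]det_b expr1n; ring.
  move/eqP; rewrite mulf_eq0 addr_eq0 oppF => /orP[] /eqP a0; subst a.
    case/negP: nCt; rewrite inE Gt; apply/cent1P/esym/commgP/conjg_fixP.
    exact: lin_eq eqxt (lin_id x).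
  exact: lin_eq eqxt (lin_inv Gx).
split=> //; last first.
  move=> c Cc; have [a [b eqc]] := lin_cent Gx ntx Cc; have [Gc _] := setIP Cc.
  have := lin_conj t eqc; rewrite xt /lin_of (lin_inv Gx) => eqct.
  apply: GLval_inj; rewrite eqct.
  rewrite (lin_inv Gc) (lin_tr eqc) eqc !scale1r scalerDr scale_scalar_mx.
  by rewrite !addrA; congr (_ + _); rewrite addrC.
rewrite -[odd _]negbK; apply/negP=> evenC.
have [c Cc oc] : {c | c \in 'C_G[x]%g & #[c]%g = 2%N} by apply: Cauchy; rewrite ?dvdn2.
have [a [b eqc]] := lin_cent Gx ntx Cc; have [Gc _] := setIP Cc.
have cV : (c^-1 = c)%g.
  by apply/eqP; rewrite eq_invg_mul; have := expg_order c; rewrite oc expg2 => ->.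
have tr0 : \tr (GLval c) = 0.
  have := lin_inv Gc; rewrite cV /lin_of scale1r => /eqP.
  rewrite -subr_eq0 opprD addrCA subrr addr0 oppr_eq0 -scalemx1 scalemx_eq0.
  by rewrite oner_eq0 orbF => /eqP.
have /eqP := lin_tr eqc; rewrite tr0 eq_sym mulf_eq0 (negPf nz_tr) orbF => /eqP b0.
have := lin_det Gx Gc eqc; rewrite b0 mulr0 mul0r expr0n !addr0 => /sqr1 a1.
have c1 : c = 1%g.
  apply: GLval_inj; rewrite eqc a1 b0 scale0r addr0.
  by [].
by rewrite c1 order1 in oc.
Qed.

Lemma in_Yn_SL2 : in_Yn (SL2 F).
Proof.
apply: (@in_Yn_criterion _ (SL2_group F)); first exact: SL2_abelian_cent.
move=> x t Gx ntx /setDP[Nt nCt]; have [Gt NCt] := setIP Nt.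
have Cx : x \in 'C_G[x]%g by rewrite inE Gx cent1id.
have fixC g h : g \in G -> h \in G -> (x ^ g = x ^ h)%g -> (g * h^-1)%g \in 'C_G[x]%g.
  move=> Gg Gh eqgh; rewrite inE groupM ?groupV //=.
  by apply/cent1P/esym/commgP/conjg_fixP; rewrite conjgM eqgh conjgK.
have [tr0 | nz_tr] := eqVneq (\tr (GLval x)) 0; last first.
  have [xt oddC invC] := cent_semisimple Gx ntx nz_tr Nt nCt.
  split; last by left.
  apply/subsetP=> g Ng; have [Gg _] := setIP Ng.
  have [Cg | nCg] := boolP (g \in 'C_G[x]%g).
    by rewrite -[g]mulg1 mem_mulg ?group1.
  have [xg _ _] := cent_semisimple Gx ntx nz_tr Ng nCg.
  rewrite -[g](mulgKV t) mem_mulg ?cycle_id //.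
  by apply: fixC; rewrite // xg.
have Clin c : c \in 'C_G[x]%g -> c != 1%g -> exists2 b, b != 0 & lin_of x c (1 + b) b.
  move=> Cc ntc; have [Gc _] := setIP Cc; have [a [b eqc]] := lin_cent Gx ntx Cc.
  have ab : a = 1 + b.
    apply/eqP; rewrite -subr_eq oppF; apply/eqP/sqr1.
    rewrite -[RHS](lin_det Gx Gc eqc) tr0 mulr0 addr0 sqrrD; congr (_ + _).
    by rewrite -[a * b *+ 2]/(_ + _) addFF addr0.
  exists b; last by rewrite -ab.
  apply: contraNneq ntc => b0; apply/eqP/GLval_inj.
  by rewrite eqc ab b0 scale0r !addr0.
have ntxJ g : (x ^ g)%g != 1%g by rewrite conjg_eq1.
have CxJ g : g \in 'N_G('C_G[x])%g -> (x ^ g)%g \in 'C_G[x]%g.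
  by case/setIP=> _ NCg; rewrite memJ_norm.
(* Unipotent case: a non-trivial element of the centralizer is determined by its coordinate
   [b != 0], which [t] multiplies by [k]. Since [k != 1] and [#|F| - 1] is prime, [k] generates the
   multiplicative group, and the powers of [t] are transitive on these elements. *)
have [k nzk xt] := Clin _ (CxJ t Nt) (ntxJ t).
have nk1 : k != 1.
  apply: contraNneq nCt => k1; rewrite inE Gt; apply/cent1P/esym/commgP/conjg_fixP.
  by apply: lin_eq xt _; rewrite k1 addFF; apply: lin_id.
have linJ c b i : lin_of x c (1 + b) b -> lin_of x (c ^ (t ^+ i))%g (1 + k ^+ i * b) (k ^+ i * b).
  move=> eqc; elim: i => [|i IHi]; first by rewrite expg0 conjg1 expr0 mul1r.
  rewrite expgSr conjgM; have := lin_conj t IHi; rewrite /lin_of xt => ->.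
  rewrite scalerDr scale_scalar_mx scalerA addrA -raddfD; congr (_%:M + _ *: _); last first.
    by rewrite exprSr; ring.
  rewrite exprS; transitivity (1 + k * k ^+ i * b + (k ^+ i * b + k ^+ i * b)); first by ring.
  by rewrite addFF addr0.
have orbC c c' : c \in 'C_G[x]%g -> c' \in 'C_G[x]%g -> c != 1%g -> c' != 1%g ->
    exists i, (c' = c ^ (t ^+ i))%g.
  move=> Cc Cc' ntc ntc'; have [b nzb eqc] := Clin _ Cc ntc; have [b' nzb' eqc'] := Clin _ Cc' ntc'.
  have [i eqi] := finField_prime_gen prF nzk nk1 (mulf_neq0 nzb' (invr_neq0 nzb)).
  exists i; apply: lin_eq eqc' _; have := linJ _ _ i eqc.
  by rewrite -eqi divfK.
split.
  apply/subsetP=> g Ng; have [Gg _] := setIP Ng.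
  have [i xgi] := orbC _ _ Cx (CxJ g Ng) ntx (ntxJ g).
  rewrite -[g](mulgKV (t ^+ i)%g) mem_mulg ?mem_cycle //.
  by apply: fixC; rewrite // groupX.
right=> R sRC ntR NRt; have [r Rr ntr] := trivgPn _ ntR.
apply/eqP; rewrite eqEsubset sRC; apply/subsetP=> c Cc.
have [-> | ntc] := eqVneq c 1%g; first exact: group1.
have [i ->] := orbC _ _ (subsetP sRC r Rr) Cc ntr ntc.
by rewrite memJ_norm // groupX.
Qed.

End SL2Yn.

End SpecialLinear2.

(** A non-trivial central element would have the whole group as its centralizer, which is
    abelian. *)
Lemma SL2_isog_PSL2 (F : finFieldType) :
  2 \in [pchar F]%R -> ~~ abelian (SL2 F) -> SL2 F \isog PSL2 F.
Proof.
move=> ch2 nab; suffices Z1 : 'Z(SL2 F)%g = 1%g.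
  by rewrite /PSL2 Z1; apply: (quotient1_isog (SL2_group F)).
apply/trivgP/subsetP=> z /setIP[Gz cGz]; rewrite inE; apply: contraR nab => ntz.
have := SL2_abelian_cent ch2 Gz ntz; apply: abelianS.
by rewrite subsetI subxx sub_cent1.
Qed.

Local Close Scope group_scope.
Unset Implicit Arguments.

Theorem theorem2p17 (gT : finGroupType) (G : {group gT}) :
  simple G -> ~~ abelian G ->
  (in_Yn G <->
   (G \isog 'Alt_('I_5) \/
    exists n : nat, prime (2 ^ n - 1) /\
      exists F : finFieldType, #|F| = 2 ^ n /\ G \isog PSL2 F)).
Proof.
move=> simG nabG; split=> [ynG | [isoA | [n [pr_n [F [oF isoP]]]]]]; last first.
- have ch2 : 2 \in [pchar F]%R := card_finPcharP oF isT.
  have prF : prime #|F|.-1 by rewrite oF -subn1.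
  have nab : ~~ abelian (SL2 F).
    by apply: contra nabG; rewrite (isog_abelian isoP); apply: quotient_abelian.
  have iso := isog_trans isoP (isog_symr (SL2_isog_PSL2 ch2 nab)).
  by apply: (isog_in_Yn (isog_symr iso)); apply: in_Yn_SL2.
- by apply: (isog_in_Yn (isog_symr isoA)); apply: Alt5_in_Yn.
have abC := @simple_in_Yn_cent _ _ simG nabG ynG.
have prN := @simple_in_Yn_norm_cent _ _ simG nabG ynG.
have [oddG | evenG] := boolP (odd #|G|).
  have ntG : G :!=: 1%g by apply: contraNneq nabG => ->; apply: abelian1.
  by case: (odd_CA_trivial abC prN oddG ntG).
have [t0 Gt0 ot0] : {t | t \in G & #[t]%g = 2} by apply: Cauchy; rewrite ?dvdn2.
have It0 : t0 \in invols G by rewrite inE Gt0 ot0.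
(* Alt(5), being isomorphic to PSL(2,4), is reached here with [n = 2]. *)
right; have [F [z [nzz gen_z [n pr_n oF] isoG]]] := even_recognition abC prN simG nabG It0.
exists n; split=> //; exists F; split=> //.
have ch2 : 2 \in [pchar F]%R := card_finPcharP oF isT.
have isoS := isog_trans isoG (isog_symr (isog_SL2_proj_gens ch2 nzz gen_z)).
apply: (isog_trans isoS); apply: (SL2_isog_PSL2 ch2).
by rewrite -(isog_abelian isoS).
Qed.
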